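(* Let $H_1:=([0,\infty),|\cdot|,\chi_1)$ be the half-line with its usual metric and the half-normal distribution $\chi_1$. Then $$H_1\notin\Gamma^\infty/U(1).$$ Consequently, the inclusion $\Gamma^\infty/U(1)\subset\Gamma^\infty/\mathbb{Z}_2$ is strict.
   Context: $\chi_1$ denotes the distribution of $|\xi|$, where $\xi\sim N(0,1)$ (the $\chi$ distribution with one degree of freedom). An mm-space is a complete separable metric space $(X,d_X)$ equipped with a Borel probability measure $\mu_X$. Two mm-spaces $X,Y$ are mm-isomorphic if there is an isometry $f\colon \operatorname{supp}\mu_X\to\operatorname{supp}\mu_Y$ (onto) with $f_*\mu_X=\mu_Y$. Measures are assumed fully supported unless otherwise stated (every mm-space $X$ is mm-isomorphic to $(\operatorname{supp}\mu_X,d_X,\mu_X)$), and mm-spaces are identified with their mm-isomorphism classes. Lipschitz order: $X\prec Y$ if there is a $1$-Lipschitz map $f\colon Y\to X$ with $f_*\mu_Y=\mu_X$. Box distance: let $I=[0,1)$ with Lebesgue measure $\mathcal L^1$; a parameter of $X$ is a Borel map $\varphi\colon I\to X$ with $\varphi_*\mathcal L^1=\mu_X$. $\Box(X,Y)$ is the infimum of all $\varepsilon\ge 0$ for which there are parameters $\varphi$ of $X$, $\psi$ of $Y$ and a Borel set $I_0\subset I$ with $\mathcal L^1(I_0)\ge 1-\varepsilon$ and $|d_X(\varphi(s),\varphi(t))-d_Y(\psi(s),\psi(t))|\le\varepsilon$ for all $s,t\in I_0$. A pyramid is a nonempty family $\mathcal P$ of mm-isomorphism classes of mm-spaces such that (i)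 $X\in\mathcal P$, $Y\prec X$ imply $Y\in\mathcal P$; (ii) for any $X,Y\in\mathcal P$ there is $Z\in\mathcal P$ with $X\prec Z$ and $Y\prec Z$; (iii) $\mathcal P$ is closed with respect to $\Box$. For an mm-space $X$, $\mathcal P_X:=\{Y\mid Y\prec X\}$. Gaussian models: $\gamma^n=N(0,I_n)$ is the standard Gaussian measure on $\mathbb R^n$; $\Gamma^n:=(\mathbb R^n,\|\cdot\|_2,\gamma^n)$ and $\Gamma^n_{\mathbb C}:=(\mathbb C^n,\|\cdot\|_2,\gamma^{2n})$, with $\mathbb C^n\cong\mathbb R^{2n}$ (all real and imaginary coordinates independent $N(0,1)$). $\mathbb Z_2=\{\pm1\}$ acts on $\mathbb R^n$ by $(\varepsilon,x)\mapsto\varepsilon x$, and $U(1)$ acts on $\mathbb C^n$ by $(e^{i\theta},z)\mapsto e^{i\theta}z$. For such an action of $G$ on $X$ with quotient map $\pi_G\colon X\to X/G$, the quotient $X/G$ carries $d_{X/G}([x],[y]):=\inf_{g\in G}d_X(x,gy)$ and $\mu_{X/G}:=(\pi_G)_*\mu_X$. Writing the overline for closure with respect to $\Box$, define the pyramids $$\Gamma^\infty/\mathbb Z_2:=\overline{\bigcup_{n\ge1}\mathcal P_{\Gamma^n/\mathbb Z_2}},\qquad \Gamma^\infty/U(1):=\overline{\bigcup_{n\ge1}\mathcal P_{\Gamma^n_{\mathbb C}/U(1)}}.$$ *)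

(* Defs.v *)
From HB Require Import structures.
From mathcomp Require Import all_boot all_order all_algebra generic_quotient.
From mathcomp Require Import complex ring lra.
From mathcomp Require Import all_classical all_reals all_analysis measurable_realfun.
Import Order.TTheory GRing.Theory Num.Theory.
Import numFieldNormedType.Exports.
Set Implicit Arguments. Unset Strict Implicit. Unset Printing Implicit Defensive.
Local Open Scope classical_set_scope.
Local Open Scope ring_scope.

#[short(type="completeMetricType")]
HB.structure Definition CompleteMetric (R : numDomainType) :=
  {T of Metric R T & Complete T}.

Notation borel T := (g_sigma_algebraType (@open T)).

Definition separable (T : topologicalType) :=
  exists2 D : set T, countable D & dense D.

Section metric_facts.
Context {R : realType}.
Implicit Types X Y : completeMetricType R.

Lemma ball_mdist (T : metricType R) (x y : T) e : ball x e y = (mdist x y < e).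
Proof. by rewrite ballEmdist. Qed.

Lemma lip_continuous (S T : metricType R) (f : S -> T) :
  (forall x y, mdist (f x) (f y) <= mdist x y) -> continuous f.
Proof.
move=> fl x; apply/cvg_ballP => e e0; near=> y.
rewrite ball_mdist (le_lt_trans (fl _ _))// -ball_mdist.
by near: y; exact: nbhsx_ballx.
Unshelve. all: by end_near. Qed.

Lemma continuous_borel (S T : ptopologicalType) (f : S -> T) :
  continuous f -> measurable_fun [set: borel S] (f : borel S -> borel T).
Proof.
move=> /continuousP cf; apply: (@measurability _ _ (borel S) (borel T) _ _ (@open T)) => // _ [U oU <-].
by rewrite setTI; apply: sub_sigma_algebra; exact: cf.
Qed.

Lemma dense_ball (T : metricType R) (D : set T) : dense D ->
  forall x e, 0 < e -> exists2 c, D c & mdist x c < e.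
Proof.
move=> dD x e e0.
have [||c []] := dD (ball x e)°.
- by exists x; exact: nbhsx_ballx.
- exact: open_interior.
move=> /interior_subset; rewrite ball_mdist => xc Dc; by exists c.
Qed.

Lemma separable_cover X (U : set X) : separable X -> open U ->
  exists I : set (X * rat), countable I /\
    U = \bigcup_(i in I) ball i.1 (ratr i.2).
Proof.
move=> [D cD dD] oU.
exists [set i | D i.1 /\ ball i.1 (ratr i.2) `<=` U]; split.
  apply: (@sub_countable _ _ _ (D `*` [set: rat])).
    by apply: subset_card_le => -[x r] /= [].
  apply: countableX => //; exact: countableP.
apply/seteqP; split=> [x Ux|x [i [/= _]]]; last exact.
have /nbhs_ballP[e /= e0 xeU] : nbhs x U by exact: open_nbhs_nbhs.
have [q] : exists q : rat, ratr q \in `]e / 4, e / 2[.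
  apply: rat_in_itvoo; rewrite ltr_pM2l// ltf_pV2 ?posrE//.
  by rewrite ltr_nat.
rewrite in_itv/= => /andP[q1 q2].
have [|c Dc xc] := dense_ball dD x (e := e / 4); first by rewrite divr_gt0.
exists (c, q).
  split=> //= y; rewrite ball_mdist => cy; apply: xeU; rewrite ball_mdist.
  rewrite (le_lt_trans (metric_triangle _ c _))// (splitr e) ltrD//.
    by rewrite (lt_trans xc)// (lt_trans q1).
  exact: lt_trans q2.
by rewrite /= ball_mdist metric_sym (lt_trans xc).
Qed.

Lemma countable_bigcup_measurable d (S : sigmaRingType d) I (A : set I)
    (F : I -> set S) : countable A ->
  (forall i, A i -> measurable (F i)) -> measurable (\bigcup_(i in A) F i).
Proof.
move=> /pfcard_geP[->|/unsquash f] mF; first by rewrite bigcup_set0.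
rewrite (_ : \bigcup_(i in A) F i = \bigcup_n F (f n)).
  by apply: bigcupT_measurable => n; apply: mF; exact: funS.
apply/seteqP; split=> [s [i Ai Fs]|s [n _ Fs]].
  by have [n _ fn] := @surj _ _ _ _ f _ Ai; exists n => //; rewrite fn.
by exists (f n) => //; exact: funS.
Qed.

Lemma measurable_mdist d (S : measurableType d) X (f : S -> X) :
  separable X -> (forall c, measurable_fun [set: S] (fun s => mdist c (f s))) ->
  measurable_fun [set: S] (f : S -> borel X).
Proof.
move=> sX mf; apply: (@measurability _ _ S (borel X) _ _ (@open X)) => // _ [U oU <-].
have [I [cI ->]] := separable_cover sX oU.
rewrite setTI preimage_bigcup; apply: countable_bigcup_measurable => //.
move=> i _; rewrite [X in measurable X](_ : _ =
    [set: S] `&` (fun s => mdist i.1 (f s)) @^-1` [set` `]-oo, (ratr i.2)[]).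
  exact: mf.
by rewrite setTI; apply/seteqP; split => s /=; rewrite ball_mdist in_itv.
Qed.

Lemma separable_image (S T : topologicalType) (f : S -> T) :
  continuous f -> range f = setT -> separable S -> separable T.
Proof.
move=> /continuousP cf sf [D cD dD]; exists (f @` D).
  exact: card_le_trans (card_image_le _ _) cD.
move=> U [y Uy] oU; have [x _ fx] : range f y by rewrite sf.
have [||z [Uz Dz]] := dD (f @^-1` U).
- by exists x; rewrite /= fx.
- exact: cf.
by exists (f z); split => //; exists z.
Qed.


Lemma eqW (x y : R) : x = y -> x <= y. Proof. by move=> ->. Qed.

Lemma cvg_half (C : R) : (C * 2^-1 ^+ n) @[n --> \oo] --> 0.
Proof. by apply: cvg_geometric; rewrite ger0_norm// invf_lt1// ltr1n. Qed.

Lemma half_lt (C e : R) : 0 < e -> \forall n \near \oo, C * 2^-1 ^+ n < e.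
Proof. by move=> e0; apply: (cvgr_lt 0 (cvg_half C)). Qed.

Lemma half_gt0 n : 0 < 2^-1 ^+ n :> R.
Proof. by rewrite exprn_gt0// invr_gt0. Qed.

Lemma fast_cauchy_cvg (T : completePseudoMetricType R) (C : R) (u : nat -> T) :
  0 < C -> (forall n, ball (u n) (C * 2^-1 ^+ n) (u n.+1)) ->
  exists l : T, u @ \oo --> l.
Proof.
move=> C0 hu.
have hk n k : (0 < k)%N ->
    ball (u n) (2 * C * (2^-1 ^+ n - 2^-1 ^+ (n + k))) (u (n + k)%N).
  elim: k => // -[|k] IH _.
    rewrite addn1; apply: le_ball (hu n); rewrite exprS.
    by apply: eqW; field.
  rewrite (addnS n k.+1); apply: le_ball (ball_triangle (IH isT) (hu _)).
  by apply: eqW; rewrite exprS; field.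
have cu : cauchy (u @ \oo).
  apply: cauchy_exP => e e0.
  have [N _ HN] := half_lt (2 * C) e0.
  exists (u N); exists N => // m /= Nm.
  rewrite -(subnKC Nm); case: (m - N)%N => [|k].
    by rewrite addn0; exact: ballxx.
  apply: le_ball (hk N k.+1 isT); apply: le_trans (ltW (HN N _)) => /=; last exact: leqnn.
  by rewrite ler_pM2l ?mulr_gt0// gerBl ltW// half_gt0.
by exists (lim (u @ \oo)); exact: cauchy_cvg cu.
Qed.

Lemma complete_fast (T : metricType R) :
  (forall u : nat -> T, (forall n, mdist (u n) (u n.+1) < 2^-1 ^+ n) ->
    exists l : T, u @ \oo --> l) ->
  forall F : set_system T, ProperFilter F -> cauchy F -> exists l : T, F --> l.
Proof.
move=> hT F FF /cauchyP cF.
have /choice[u hu] n : exists x, F (ball x (2^-1 ^+ n.+2)).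
  by apply: cF; exact: half_gt0.
have [n|l ul] := hT u.
  have [x [ux vx]] := filter_ex (filterI (hu n) (hu n.+1)).
  move: ux vx; rewrite !ball_mdist => ux vx.
  apply: le_lt_trans (metric_triangle _ x _) _.
  rewrite [mdist x _]metric_sym.
  apply: lt_le_trans (ltrD ux vx) _.
  by rewrite !exprS; have := half_gt0 n; lra.
exists l; apply/cvg_ballP => e e0.
have e20 : 0 < e / 2 by rewrite divr_gt0.
have [N _ HN] : \forall n \near \oo,
    2^-1 * 2^-1 * 2^-1 ^+ n < e / 2 /\ ball l (e / 2) (u n).
  by apply: filterI; [exact: half_lt|move/cvg_ballP : ul; exact].
have [h1 h2] := HN N (leqnn N).
apply: filterS (hu N) => y uy.
rewrite (splitr e); apply: ball_triangle h2 _; apply: le_ball uy.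
by rewrite !exprS mulrA ltW.
Qed.
End metric_facts.

Section mm_space.
Context {R : realType}.

Definition msupp (T : completeMetricType R) (mu : set T -> \bar R) : set T :=
  [set x | forall U, open U -> U x -> (0 < mu U)%E].

End mm_space.

Record mmSpace (R : realType) := MMSpace {
  mm_space :> completeMetricType R ;
  mm_separable : separable mm_space ;
  mm_meas : probability (borel mm_space) R ;
  mm_full : msupp mm_meas = [set: mm_space] }.

(* A family of mm-isomorphism classes is a predicate on mm-spaces (mmSpace R
   lives in a universe too large for set).  The families below are invariant
   under mm_iso, see box_closure_iso. *)
Definition mmFamily (R : realType) := mmSpace R -> Prop.

Section law.
Context {R : realType} d (S : measurableType d) (P : probability S R).
Context (T : completeMetricType R) (f : S -> T).
Hypothesis mf : measurable_fun [set: S] (f : S -> borel T).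

Definition law : probability (borel T) R :=
  distribution P (mfun_Sub (mem_set mf)).

Lemma lawE A : law A = P (f @^-1` A).
Proof. by []. Qed.

Hypothesis sT : separable T.
Hypothesis fP : forall U : set T, open U -> U !=set0 -> (0 < P (f @^-1` U))%E.

Lemma law_full : msupp law = [set: T].
Proof. by apply/seteqP; split=> // t _ U oU Ut; apply: fP => //; exists t. Qed.

(* The mm-space (T, mdist, f_* P). *)
Definition mm_law : mmSpace R := MMSpace sT law_full.

End law.

Section lipschitz_order.
Context {R : realType}.
Implicit Types X Y : mmSpace R.

Definition preserves_meas X Y (f : X -> Y) :=
  forall A : set (borel Y), measurable A ->
    pushforward (mm_meas X) (f : borel X -> borel Y) A = mm_meas Y A.

Definition mm_iso X Y := exists f : X -> Y,
  [/\ forall x y, mdist (f x) (f y) = mdist x y, range f = [set: Y] &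
      preserves_meas f].

Definition lip_le X Y := exists f : Y -> X,
  (forall x y, mdist (f x) (f y) <= mdist x y) /\ preserves_meas f.

Definition pyramid_of X : mmFamily R := fun Y => lip_le Y X.

End lipschitz_order.

Section box.
Context {R : realType}.
Implicit Types X Y : mmSpace R.

(* A parameter is represented by a map defined on all of R, of which only the
   restriction to unitI matters. *)
Definition unitI : set R := `[0, 1[.

Definition parameter X (phi : R -> X) :=
  measurable_fun unitI (phi : R -> borel X) /\
  forall A : set (borel X), measurable A ->
    lebesgue_measure (unitI `&` phi @^-1` A) = mm_meas X A.

Definition box_bound X Y (e : R) :=
  exists (phi : R -> X) (psi : R -> Y) (I0 : set R),
    [/\ parameter phi, parameter psi,
        measurable I0 /\ I0 `<=` unitI,
        ((1 - e)%:E <= lebesgue_measure I0)%E &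
        forall s t, I0 s -> I0 t ->
          `|mdist (phi s) (phi t) - mdist (psi s) (psi t)| <= e].

(* With values in \bar R the infimum of an empty set would be +oo, whereas the
   real-valued inf would return 0. *)
Definition box X Y : \bar R :=
  ereal_inf [set e%:E | e in [set e | 0 <= e /\ box_bound X Y e]].

Definition box_closure (P : mmFamily R) : mmFamily R :=
  fun X => forall e : R, 0 < e -> exists2 Y, P Y & (box X Y < e%:E)%E.

Lemma parameter_iso X Y (f : X -> Y) (phi : R -> X) :
  (forall x y, mdist (f x) (f y) = mdist x y) -> preserves_meas f ->
  parameter phi -> parameter (f \o phi).
Proof.
move=> fi fm [mphi pphi].
have mf : measurable_fun [set: borel X] (f : borel X -> borel Y).
  by apply: continuous_borel; apply: lip_continuous => x y; rewrite fi.
split; first exact: measurableT_comp mf mphi.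
move=> A mA; rewrite comp_preimage pphi; first exact: fm.
by rewrite -[X in measurable X]setTI; exact: mf.
Qed.

Lemma box_closure_iso (P : mmFamily R) X Y :
  mm_iso X Y -> box_closure P X -> box_closure P Y.
Proof.
move=> [f [fi _ fm]] PX e /PX[Z PZ XZ]; exists Z => //.
apply: le_lt_trans XZ; apply: le_ereal_inf => _ [a [a0 h] <-].
move: h => [phi [psi [I0 [pphi ppsi mI0 I0a I0P]]]]; exists a => //; split => //.
exists (f \o phi), psi, I0; split => //; first exact: parameter_iso.
by move=> s t; rewrite /= fi; exact: I0P.
Qed.

End box.

(* An isometric action with closed orbits: this is what makes the quotient
   pseudo-distance a distance. *)
Record isoAction (R : realType) (X : mmSpace R) := IsoAction {
  act_group : groupType ;
  act :> act_group -> X -> X ;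
  act1x : forall x, act 1%g x = x ;
  actMx : forall g h x, act (g * h)%g x = act g (act h x) ;
  act_isom : forall g x y, mdist (act g x) (act g y) = mdist x y ;
  act_closed : forall x, closed (range (act ^~ x)) }.

Section quotient.
Context {R : realType} (X : mmSpace R) (a : isoAction X).
Implicit Types (x y z : X) (g h : act_group a).

Lemma actKx g x : a g^-1%g (a g x) = x.
Proof. by rewrite -actMx mulVg act1x. Qed.

Definition orbit_rel x y := `[< exists g, a g x = y >].

Let orbit_relxx : reflexive orbit_rel.
Proof. by move=> x; apply/asboolP; exists 1%g; rewrite act1x. Qed.

Let orbit_relC : symmetric orbit_rel.
Proof.
by move=> x y; apply/asboolP/asboolP => -[g <-]; exists g^-1%g; rewrite actKx.
Qed.

Let orbit_rel_trans : transitive orbit_rel.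
Proof.
move=> y x z /asboolP[g <-] /asboolP[h <-]; apply/asboolP; exists (h * g)%g.
by rewrite actMx.
Qed.

Canonical orbit_equiv :=
  EquivRel orbit_rel orbit_relxx orbit_relC orbit_rel_trans.

Definition orbit_space := {eq_quot orbit_equiv}%qT.
HB.instance Definition _ := Choice.on orbit_space.

Definition orbit_pi (x : X) : orbit_space := \pi_({eq_quot orbit_equiv})%qT x.

Lemma orbit_piP x y : orbit_pi x = orbit_pi y <-> exists g, a g x = y.
Proof. by split=> [/eqquotP/asboolP|/asboolP h]//; exact/eqquotP. Qed.

Lemma orbit_piK (q : orbit_space) : orbit_pi (repr q) = q.
Proof. exact: reprK. Qed.

Definition orbit_mdist x y : R := inf (range (fun g => mdist x (a g y))).

Lemma orbit_mdist_le g x y : orbit_mdist x y <= mdist x (a g y).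
Proof.
apply: ge_inf; last by exists g.
by exists 0 => _ [h _ <-]; exact: mdist_ge0.
Qed.

Lemma orbit_mdist_ge x y c :
  (forall g, c <= mdist x (a g y)) -> c <= orbit_mdist x y.
Proof.
move=> xyc; apply: lb_le_inf; first by exists (mdist x (a 1%g y)), 1%g.
by move=> _ [g _ <-].
Qed.

Lemma orbit_mdist_lt x y c :
  orbit_mdist x y < c -> exists g, mdist x (a g y) < c.
Proof.
move=> xyc; apply: contrapT => /forallNP h; move: xyc; rewrite ltNge.
by move=> /negP; apply; apply: orbit_mdist_ge => g; rewrite leNgt; exact/negP.
Qed.

Lemma orbit_mdist_act g h x y : orbit_mdist (a g x) (a h y) = orbit_mdist x y.
Proof.
have le g' h' x' y' : orbit_mdist (a g' x') (a h' y') <= orbit_mdist x' y'.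
  apply: orbit_mdist_ge => k.
  rewrite -(act_isom g' x') -{2}(actKx h' y') -!actMx.
  by rewrite (le_trans (orbit_mdist_le (g' * k * h'^-1)%g _ _))// !actMx.
apply/eqP; rewrite eq_le le/=.
by rewrite -{1}(actKx g x) -{1}(actKx h y) le.
Qed.

Lemma orbit_mdistxx x : orbit_mdist x x = 0.
Proof.
apply/eqP; rewrite eq_le orbit_mdist_ge ?andbT; last by move=> *; exact: mdist_ge0.
by rewrite (le_trans (orbit_mdist_le 1%g _ _))// act1x mdistxx.
Qed.

Lemma orbit_mdistC x y : orbit_mdist x y = orbit_mdist y x.
Proof.
have le x' y' : orbit_mdist x' y' <= orbit_mdist y' x'.
  apply: orbit_mdist_ge => k; rewrite (le_trans (orbit_mdist_le k^-1%g _ _))//.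
  by rewrite -(act_isom k) -actMx mulgV act1x metric_sym.
by apply/eqP; rewrite eq_le !le.
Qed.

Lemma orbit_mdist_triangle y x z :
  orbit_mdist x z <= orbit_mdist x y + orbit_mdist y z.
Proof.
apply/ler_addgt0Pr => e e0; have e20 : 0 < e / 2 by rewrite divr_gt0.
have [|g xy] := @orbit_mdist_lt x y (orbit_mdist x y + e / 2).
  by rewrite ltrDl.
have [|h yz] := @orbit_mdist_lt y z (orbit_mdist y z + e / 2).
  by rewrite ltrDl.
rewrite (le_trans (orbit_mdist_le (g * h)%g _ _))// actMx.
rewrite (le_trans (metric_triangle _ (a g y) _))// act_isom.
by have := ltW (ltrD xy yz); lra.
Qed.

Lemma orbit_mdist_eq0 x y : orbit_mdist x y = 0 -> exists g, a g x = y.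
Proof.
move=> xy0; suff: range (a ^~ y) x.
  by move=> [g _ <-]; exists g^-1%g; rewrite actKx.
apply: act_closed; move=> B /nbhs_ballP[e /= e0 eB].
have [|g xg] := @orbit_mdist_lt x y e; first by rewrite xy0.
by exists (a g y); split; [exists g|apply: eB; rewrite ball_mdist].
Qed.

Definition orbit_space_mdist (p q : orbit_space) := orbit_mdist (repr p) (repr q).

Lemma orbit_space_mdistE x y :
  orbit_space_mdist (orbit_pi x) (orbit_pi y) = orbit_mdist x y.
Proof.
rewrite /orbit_space_mdist.
have [g <-] := (orbit_piP _ _).1 (esym (orbit_piK (orbit_pi x))).
have [h <-] := (orbit_piP _ _).1 (esym (orbit_piK (orbit_pi y))).
exact: orbit_mdist_act.
Qed.

Let q_mdistxx p : orbit_space_mdist p p = 0.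
Proof. exact: orbit_mdistxx. Qed.

Let q_mdist_positivity p q : orbit_space_mdist p q = 0 -> p = q.
Proof.
by move=> /orbit_mdist_eq0 /orbit_piP; rewrite !orbit_piK.
Qed.

Let q_mdist_sym p q : orbit_space_mdist p q = orbit_space_mdist q p.
Proof. exact: orbit_mdistC. Qed.

Let q_mdist_triangle q p r :
  orbit_space_mdist p r <= orbit_space_mdist p q + orbit_space_mdist q r.
Proof. exact: orbit_mdist_triangle. Qed.

HB.instance Definition _ := isMetric.Build R orbit_space
  q_mdistxx q_mdist_positivity q_mdist_sym q_mdist_triangle.

(* The quotient metric at arbitrary representatives. *)
Lemma orbit_piE x y : mdist (orbit_pi x) (orbit_pi y) = orbit_mdist x y.
Proof. exact: orbit_space_mdistE. Qed.

Lemma orbit_pi_continuous : continuous orbit_pi.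
Proof.
apply: lip_continuous => x y; rewrite orbit_piE.
by rewrite (le_trans (orbit_mdist_le 1%g _ _))// act1x.
Qed.

HB.instance Definition _ := isPointed.Build orbit_space (orbit_pi point).

Let q_complete (F : set_system orbit_space) :
  ProperFilter F -> cauchy F -> cvg F.
Proof.
move=> FF cF; apply/cvg_ex.
apply: complete_fast FF cF => q hq.
have /choice[s hs] (i : nat * X) : exists y, orbit_pi i.2 = q i.1 ->
    orbit_pi y = q i.1.+1 /\ mdist i.2 y < 2^-1 ^+ i.1.
  case: i => n x; have := hq n.
  rewrite -{1}(orbit_piK (q n.+1)) => h.
  have [xq|] := pselect (orbit_pi x = q n); last by exists x.
  move: h; rewrite -xq orbit_piE => /orbit_mdist_lt[g xg].
  exists (a g (repr (q n.+1))) => _; split=> //.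
  rewrite -[RHS]orbit_piK; apply/orbit_piP; exists g^-1%g.
  by rewrite actKx.
pose x := nat_rect (fun=> X) (repr (q 0%N)) (fun n x => s (n, x)).
have xq n : orbit_pi (x n) = q n.
  by elim: n => [|n IH]; [exact: orbit_piK|case: (hs (n, x n) IH)].
have [|n|l xl] := @fast_cauchy_cvg _ X 1 x; first exact: ltr01.
  by rewrite mul1r ball_mdist; case: (hs (n, x n) (xq n)).
exists (orbit_pi l).
rewrite (_ : q = orbit_pi \o x); last by apply/funext => n /=.
by move=> A lA; exact: (xl _ (orbit_pi_continuous lA)).
Qed.

HB.instance Definition _ := Uniform_isComplete.Build orbit_space q_complete.

Lemma orbit_pi_surj : range orbit_pi = [set: orbit_space].
Proof. by apply/seteqP; split=> // q _; exists (repr q) => //; exact: orbit_piK. Qed.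

Lemma orbit_pi_measurable :
  measurable_fun [set: borel X] (orbit_pi : borel X -> borel orbit_space).
Proof. exact: continuous_borel orbit_pi_continuous. Qed.

Lemma orbit_space_separable : separable orbit_space.
Proof.
exact: separable_image orbit_pi_continuous orbit_pi_surj (mm_separable X).
Qed.

Lemma orbit_pi_full (U : set orbit_space) : open U -> U !=set0 ->
  (0 < mm_meas X (orbit_pi @^-1` U))%E.
Proof.
move=> oU [q Uq].
have : msupp (mm_meas X) (repr q) by rewrite mm_full.
apply; last by rewrite /= orbit_piK.
by move/continuousP: orbit_pi_continuous; exact.
Qed.

Definition mm_quotient : mmSpace R :=
  mm_law orbit_pi_measurable orbit_space_separable orbit_pi_full.

End quotient.

Section euclidean_norm.
Context {R : realType}.
Implicit Types n : nat.

Definition norm2 n (x : 'rV[R]_n) : R := Num.sqrt (\sum_(i < n) x ord0 i ^+ 2).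

Lemma norm2_ge0 n (x : 'rV[R]_n) : 0 <= norm2 x.
Proof. exact: sqrtr_ge0. Qed.

Lemma sqr_norm2 n (x : 'rV[R]_n) : norm2 x ^+ 2 = \sum_(i < n) x ord0 i ^+ 2.
Proof. by rewrite sqr_sqrtr// sumr_ge0// => i _; exact: sqr_ge0. Qed.

Lemma coord_le_norm2 n (x : 'rV[R]_n) i : `|x ord0 i| <= norm2 x.
Proof.
rewrite -sqrtr_sqr ler_wsqrtr// (bigD1 i)//= lerDl sumr_ge0// => j _.
exact: sqr_ge0.
Qed.

Lemma norm2_eq0 n (x : 'rV[R]_n) : norm2 x = 0 -> x = 0.
Proof.
move=> x0; apply/rowP => i; rewrite mxE; apply/normr0_eq0/eqP.
by rewrite eq_le normr_ge0 andbT -x0 coord_le_norm2.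
Qed.

Lemma norm2_0 n : norm2 (0 : 'rV[R]_n) = 0.
Proof.
by rewrite /norm2 big1 ?sqrtr0// => i _; rewrite mxE expr0n.
Qed.

Lemma norm2Z n a (x : 'rV[R]_n) : norm2 (a *: x) = `|a| * norm2 x.
Proof.
rewrite /norm2 -sqrtr_sqr -sqrtrM ?sqr_ge0// mulr_sumr.
by congr Num.sqrt; apply: eq_bigr => i _; rewrite mxE exprMn.
Qed.

Lemma norm2N n (x : 'rV[R]_n) : norm2 (- x) = norm2 x.
Proof. by rewrite -scaleN1r norm2Z normrN1 mul1r. Qed.

Lemma dot_le_norm2 n (x y : 'rV[R]_n) :
  \sum_(i < n) x ord0 i * y ord0 i <= norm2 x * norm2 y.
Proof.
set C := (X in X <= _).
have [x0|x0] := eqVneq (norm2 x) 0.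
  rewrite x0 mul0r /C (norm2_eq0 x0) big1// => i _.
  by rewrite mxE mul0r.
have xgt0 : 0 < norm2 x ^+ 2 by rewrite exprn_gt0// lt_neqAle eq_sym x0 norm2_ge0.
have : 0 <= \sum_(i < n) (norm2 x ^+ 2 * y ord0 i - C * x ord0 i) ^+ 2.
  by apply: sumr_ge0 => i _; exact: sqr_ge0.
have -> : \sum_(i < n) (norm2 x ^+ 2 * y ord0 i - C * x ord0 i) ^+ 2 =
    norm2 x ^+ 2 * (norm2 x ^+ 2 * norm2 y ^+ 2 - C ^+ 2).
  transitivity (\sum_(i < n) (norm2 x ^+ 4 * y ord0 i ^+ 2
      - 2 * norm2 x ^+ 2 * C * (x ord0 i * y ord0 i) + C ^+ 2 * x ord0 i ^+ 2)).
    by apply: eq_bigr => i _; ring.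
  rewrite big_split/= sumrB -!mulr_sumr -!sqr_norm2 -/C; ring.
rewrite pmulr_rge0// subr_ge0 -exprMn => CC.
rewrite (le_trans (ler_norm C))// -(@ler_pXn2r _ 2)// ?nnegrE ?mulr_ge0 ?norm2_ge0//.
by rewrite real_normK ?num_real.
Qed.

Lemma ler_norm2D n (x y : 'rV[R]_n) : norm2 (x + y) <= norm2 x + norm2 y.
Proof.
rewrite -(@ler_pXn2r _ 2)// ?nnegrE ?addr_ge0 ?norm2_ge0// sqr_norm2.
have -> : \sum_(i < n) (x + y) ord0 i ^+ 2 =
    norm2 x ^+ 2 + 2 * (\sum_(i < n) x ord0 i * y ord0 i) + norm2 y ^+ 2.
  rewrite !sqr_norm2 mulr_sumr -!big_split/=; apply: eq_bigr => i _.
  by rewrite mxE; ring.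
by have := dot_le_norm2 x y; nra.
Qed.

Lemma norm2_box n (x : 'rV[R]_n) e : 0 < e ->
  (forall i, `|x ord0 i| < e / n.+1%:R) -> norm2 x < e.
Proof.
move=> e0 xe.
have h : norm2 x <= \sum_(i < n) `|x ord0 i|.
  rewrite -(@ler_pXn2r _ 2)// ?nnegrE ?norm2_ge0 ?sumr_ge0// sqr_norm2.
  rewrite [leRHS]expr2 mulr_suml; apply: ler_sum => i _.
  rewrite -real_normK ?num_real// expr2 ler_wpM2l// (bigD1 i)//= lerDl.
  by rewrite sumr_ge0.
apply: (le_lt_trans h); apply: (@le_lt_trans _ _ (\sum_(i < n) e / n.+1%:R)).
  by apply: ler_sum => i _; exact: ltW.
rewrite sumr_const card_ord -[ltLHS]mulr_natr mulrAC -mulrA gtr_pMr//.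
by rewrite ltr_pdivrMr// mul1r ltr_nat.
Qed.

End euclidean_norm.

Section euclid.
Context {R : realType} (n : nat).

(* 'rV[R]_n carries the sup-norm metric of the library, hence the alias. *)
Definition euclid := 'rV[R]_n.

HB.instance Definition _ := Choice.on euclid.
HB.instance Definition _ := isPointed.Build euclid (0 : 'rV[R]_n).

Definition euclid_mdist (x y : euclid) : R := norm2 (x - y : 'rV[R]_n).

Let e_mdistxx x : euclid_mdist x x = 0.
Proof. by rewrite /euclid_mdist subrr norm2_0. Qed.

Let e_mdist_positivity x y : euclid_mdist x y = 0 -> x = y.
Proof. by move=> /norm2_eq0/eqP; rewrite subr_eq0 => /eqP. Qed.

Let e_mdist_sym x y : euclid_mdist x y = euclid_mdist y x.
Proof. by rewrite /euclid_mdist -norm2N opprB. Qed.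

Let e_mdist_triangle y x z :
  euclid_mdist x z <= euclid_mdist x y + euclid_mdist y z.
Proof.
by rewrite (le_trans _ (ler_norm2D _ _))// addrA subrK.
Qed.

HB.instance Definition _ := isMetric.Build R euclid
  e_mdistxx e_mdist_positivity e_mdist_sym e_mdist_triangle.

Lemma euclid_mdistE (x y : euclid) : mdist x y = norm2 (x - y : 'rV[R]_n).
Proof. by []. Qed.

Let e_complete (F : set_system euclid) : ProperFilter F -> cauchy F -> cvg F.
Proof.
move=> FF cF; apply/cvg_ex.
apply: complete_fast FF cF => u hu.
have /choice[l hl] i : exists l : R, (fun m => (u m : 'rV[R]_n) ord0 i) @ \oo --> l.
  apply: (@fast_cauchy_cvg R R 1) => // m; rewrite mul1r.
  apply: le_lt_trans (hu m); rewrite euclid_mdistE.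
  by rewrite (le_trans _ (coord_le_norm2 _ i))// !mxE.
exists (\row_i l i : 'rV[R]_n); apply/cvg_ballP => e e0.
have : \forall m \near \oo, forall i : 'I_n,
    `|l i - (u m : 'rV[R]_n) ord0 i| < e / n.+1%:R.
  apply: filter_forall => i; have /cvgrPdist_lt := hl i; apply.
  by rewrite divr_gt0.
apply: filterS => m hm; rewrite ball_mdist euclid_mdistE.
by apply: norm2_box => // i; rewrite !mxE.
Qed.

HB.instance Definition _ := Uniform_isComplete.Build euclid e_complete.

Lemma euclid_separable : separable euclid.
Proof.
exists (range (fun q : 'rV[rat]_n => map_mx ratr q : euclid)).
  apply: card_le_trans (card_image_le _ _) _; exact: countableP.
move=> U [x Ux] oU.
have /nbhs_ballP[e /= e0 eU] : nbhs x U by exact: open_nbhs_nbhs.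
have /choice[q hq] i : exists q : rat,
    `|(x : 'rV[R]_n) ord0 i - ratr q| < e / n.+1%:R.
  have [|q] := @rat_in_itvoo R ((x : 'rV[R]_n) ord0 i)
     ((x : 'rV[R]_n) ord0 i + e / n.+1%:R); first by rewrite ltrDl divr_gt0.
  rewrite in_itv/= => /andP[q1 q2]; exists q.
  by rewrite distrC gtr0_norm ?subr_gt0// ltrBlDl.
exists (map_mx ratr (\row_i q i)); split; last by exists (\row_i q i).
apply: eU; rewrite ball_mdist euclid_mdistE; apply: norm2_box => // i.
by rewrite !mxE.
Qed.

End euclid.
Arguments euclid : clear implicits.

Section normal_itv.
Context {R : realType}.

Lemma normal_prob_itv_gt0 (a b : R) : a < b -> (0 < normal_prob 0 1 `]a, b[)%E.
Proof.
move=> ab; pose c : R := normal_peak 1 * expR (- (a ^+ 2 + b ^+ 2) / 2).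
have c0 : 0 < c by rewrite mulr_gt0 ?expR_gt0// normal_peak_gt0// oner_neq0.
apply: (@lt_le_trans _ _ (\int[lebesgue_measure]_(x in `]a, b[) c%:E)%E).
  rewrite integral_cst//= lebesgue_measure_itv/= lte_fin ab -EFinB -EFinM.
  by rewrite lte_fin mulr_gt0// subr_gt0.
apply: ge0_le_integral => //=.
- by move=> x _; rewrite lee_fin ltW.
- apply/measurable_EFinP/measurable_funTS; exact: measurable_normal_pdf.
- move=> x; rewrite in_itv/= => /andP[ax xb].
  rewrite lee_fin normal_pdfE ?oner_neq0// ler_wpM2l ?normal_peak_ge0//.
  rewrite ler_expR expr1n subr0 -mulr_natr mul1r ler_wpM2r ?invr_ge0//.
  rewrite lerN2; have [x0|x0] := leP 0 x.
    by rewrite (@le_trans _ _ (b ^+ 2)) ?lerDr ?sqr_ge0//; nra.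
  by rewrite (@le_trans _ _ (a ^+ 2)) ?lerDl ?sqr_ge0//; nra.
Qed.

End normal_itv.

Section product_probability.
Context {R : realType} d1 d2 (T1 : measurableType d1) (T2 : measurableType d2).
Context (P1 : probability T1 R) (P2 : probability T2 R).

Definition prod_prob : set (T1 * T2) -> \bar R := (P1 \x P2)%E.

HB.instance Definition _ := Measure.on prod_prob.

Let prod_prob_setT : prod_prob [set: T1 * T2] = 1%E.
Proof.
rewrite -setXTT; transitivity (P1 setT * P2 setT)%E.
  exact: product_measure1E.
by rewrite !probability_setT mule1.
Qed.

HB.instance Definition _ :=
  Measure_isProbability.Build _ _ _ prod_prob prod_prob_setT.

End product_probability.


Section gaussian.
Context {R : realType}.

(* normal_prob is a measure on measurableTypeR R, not on the display of R. *)
Local Notation tupleR n := (n.-tuple (measurableTypeR R)).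

Lemma measurable_tuple_cons n : measurable_fun [set: measurableTypeR R * tupleR n]
  (fun p => [tuple of p.1 :: p.2] : tupleR n.+1).
Proof. by apply: measurable_cons; [exact: measurable_fst|exact: measurable_snd]. Qed.

(* The n-fold product of N(0, 1). *)
Fixpoint gauss_tuple n : probability (tupleR n) R :=
  if n is m.+1 then
    distribution (prod_prob (normal_prob 0 1) (gauss_tuple m))
      (mfun_Sub (mem_set (@measurable_tuple_cons m)))
  else dirac [tuple].

Lemma gauss_tuple_box n (c : tupleR n) (e : R) : 0 < e ->
  exists A, [/\ measurable A, (0 < gauss_tuple n A)%E &
    forall t, A t -> forall i, `|tnth c i - tnth t i| < e].
Proof.
move=> e0; elim: n c => [|n IH] c.
  exists [set: tupleR 0]; split=> //; last by move=> ? _ [].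
  by rewrite probability_setT.
have [A [mA A0 Ae]] := IH [tuple of behead c].
pose I : set R := `]thead c - e, thead c + e[%classic.
pose beh (t : tupleR n.+1) : tupleR n := [tuple of behead t].
have behE (x : measurableTypeR R) (t : tupleR n) : beh [tuple of x :: t] = t by exact/val_inj.
pose B := (fun t : tupleR n.+1 => thead t) @^-1` I `&` beh @^-1` A.
have mB : measurable B.
  apply: measurableI; rewrite -[X in measurable X]setTI.
    by apply: (@measurable_tnth _ _ n.+1 ord0) => //; exact: measurable_itv.
  exact: measurable_behead.
exists B; split => //.
  rewrite /= /distribution /pushforward /=.
  rewrite [X in prod_prob _ _ X](_ : _ = I `*` A).
    rewrite /prod_prob product_measure1E//; last exact: measurable_itv.
    by rewrite mule_gt0// normal_prob_itv_gt0//; lra.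
  by apply/seteqP; split=> -[x t]; rewrite /B /= behE theadE.
move=> t [It At] i; case: (unliftP ord0 i) => [j ->|->].
  by rewrite [t]tuple_eta [c]tuple_eta !tnthS; exact: Ae At _.
move: It; rewrite /I /= in_itv/= => /andP[h1 h2].
by rewrite -/(thead c) -/(thead t) ltr_distlC; apply/andP; split; lra.
Qed.

Definition euclid_of_tuple n (t : tupleR n) : euclid R n :=
  \row_(i < n) tnth t i.

Lemma measurable_euclid_of_tuple n : measurable_fun [set: tupleR n]
  (@euclid_of_tuple n : tupleR n -> borel (euclid R n)).
Proof.
apply: measurable_mdist; first exact: euclid_separable.
move=> c; apply: measurableT_comp => //=.
  by apply: continuous_measurable_fun; exact: sqrt_continuous.
apply: measurable_sum => i; apply: measurable_funX.
rewrite (_ : (fun _ => _) = (fun t : tupleR n => (c : 'rV_n) ord0 i - tnth t i)).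
  by apply: measurable_funB => //; exact: measurable_tnth.
by apply/funext => t; rewrite !mxE.
Qed.

Lemma gauss_tuple_full n (U : set (euclid R n)) : open U -> U !=set0 ->
  (0 < gauss_tuple n (@euclid_of_tuple n @^-1` U))%E.
Proof.
move=> oU [x Ux].
have /nbhs_ballP[e /= e0 eU] : nbhs x U by exact: open_nbhs_nbhs.
have [|A [mA A0 Ae]] := @gauss_tuple_box n [tuple (x : 'rV_n) ord0 i | i < n] (e / n.+1%:R).
  by rewrite divr_gt0.
apply: lt_le_trans A0 _; apply: le_measure; rewrite ?inE//.
  rewrite -[X in measurable X]setTI; apply: measurable_euclid_of_tuple => //.
  exact: sub_sigma_algebra.
move=> t At; apply: eU; rewrite ball_mdist euclid_mdistE; apply: norm2_box => // i.
by have := Ae _ At i; rewrite tnth_mktuple !mxE.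
Qed.

(* (R^n, ||.||_2, N(0, I_n)) *)
Definition Gamma n : mmSpace R :=
  mm_law (@measurable_euclid_of_tuple n) (euclid_separable n) (@gauss_tuple_full n).

End gaussian.
Arguments Gamma : clear implicits.

Section complex_euclid.
Context {R : realType} (n : nat).

Definition ceuclid := 'rV[R[i]]_n.

HB.instance Definition _ := Choice.on ceuclid.
HB.instance Definition _ := isPointed.Build ceuclid (0 : 'rV[R[i]]_n).

Definition cnorm2 (z : 'rV[R[i]]_n) : R :=
  Num.sqrt (\sum_(j < n) Normc.normc (z ord0 j) ^+ 2).

Definition ceuclid_mdist (z w : ceuclid) : R := cnorm2 (z - w : 'rV[R[i]]_n).

(* C^n is identified with R^(2n): real parts first, then imaginary parts. *)
Definition c2r (z : 'rV[R[i]]_n) : 'rV[R]_(n + n) :=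
  row_mx (\row_j complex.Re (z ord0 j)) (\row_j complex.Im (z ord0 j)).

Definition r2c (x : 'rV[R]_(n + n)) : 'rV[R[i]]_n :=
  \row_j (x ord0 (lshift n j) +i* x ord0 (rshift n j))%C.

Lemma c2rK : cancel c2r r2c.
Proof.
move=> z; apply/rowP => j; rewrite mxE row_mxEl row_mxEr !mxE.
by case: (z ord0 j).
Qed.

Lemma r2cK : cancel r2c c2r.
Proof.
move=> x; apply/rowP => k; case: (split_ordP k) => j ->.
  by rewrite row_mxEl !mxE.
by rewrite row_mxEr !mxE.
Qed.

Lemma c2rB z w : c2r (z - w) = c2r z - c2r w.
Proof.
apply/rowP => k; case: (split_ordP k) => j ->;
  by rewrite ?(row_mxEl, row_mxEr, mxE); case: (z ord0 j) (w ord0 j) => ? ? [].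
Qed.

Lemma cnorm2E z : cnorm2 z = norm2 (c2r z).
Proof.
rewrite /cnorm2 /norm2 big_split_ord/= -big_split/=; congr Num.sqrt.
apply: eq_bigr => j _; rewrite row_mxEl row_mxEr !mxE.
by case: (z ord0 j) => a b /=; rewrite sqr_sqrtr// addr_ge0// sqr_ge0.
Qed.

Lemma cnorm2Z a z : cnorm2 (a *: z) = Normc.normc a * cnorm2 z.
Proof.
have a0 : 0 <= Normc.normc a by case: a => ? ?; exact: sqrtr_ge0.
rewrite /cnorm2 -[Normc.normc a in RHS](ger0_norm a0) -sqrtr_sqr.
rewrite -sqrtrM ?sqr_ge0// mulr_sumr.
by congr Num.sqrt; apply: eq_bigr => i _; rewrite mxE Normc.normcM exprMn.
Qed.

Lemma ceuclid_mdist_c2r (z w : ceuclid) :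
  ceuclid_mdist z w = mdist (c2r z : euclid R (n + n)) (c2r w).
Proof. by rewrite /ceuclid_mdist cnorm2E c2rB. Qed.

Let c_mdistxx z : ceuclid_mdist z z = 0.
Proof. by rewrite ceuclid_mdist_c2r mdistxx. Qed.

Let c_mdist_positivity z w : ceuclid_mdist z w = 0 -> z = w.
Proof.
by rewrite ceuclid_mdist_c2r => /mdist_positivity/(can_inj c2rK).
Qed.

Let c_mdist_sym z w : ceuclid_mdist z w = ceuclid_mdist w z.
Proof. by rewrite !ceuclid_mdist_c2r metric_sym. Qed.

Let c_mdist_triangle w z v :
  ceuclid_mdist z v <= ceuclid_mdist z w + ceuclid_mdist w v.
Proof. by rewrite !ceuclid_mdist_c2r; exact: metric_triangle. Qed.

HB.instance Definition _ := isMetric.Build R ceuclid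
  c_mdistxx c_mdist_positivity c_mdist_sym c_mdist_triangle.

Lemma ceuclid_mdistE (z w : ceuclid) : mdist z w = cnorm2 (z - w : 'rV[R[i]]_n).
Proof. by []. Qed.

Definition ceuclid_of_euclid (x : euclid R (n + n)) : ceuclid := r2c x.

Lemma ceuclid_of_euclid_isom x y :
  mdist (ceuclid_of_euclid x) (ceuclid_of_euclid y) = mdist x y.
Proof.
by rewrite [LHS]ceuclid_mdist_c2r /ceuclid_of_euclid !r2cK.
Qed.

Lemma ceuclid_of_euclid_continuous : continuous ceuclid_of_euclid.
Proof. by apply: lip_continuous => x y; rewrite ceuclid_of_euclid_isom. Qed.

Let c_complete (F : set_system ceuclid) : ProperFilter F -> cauchy F -> cvg F.
Proof.
move=> FF cF; apply/cvg_ex.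
apply: complete_fast FF cF => u hu.
have [||l ul] := @fast_cauchy_cvg _ (euclid R (n + n)) 1 (c2r \o u).
- exact: ltr01.
- by move=> m; rewrite mul1r ball_mdist /= -ceuclid_mdist_c2r; exact: hu.
exists (ceuclid_of_euclid l).
rewrite (_ : u = ceuclid_of_euclid \o (c2r \o u)); last first.
  by apply/funext => m; rewrite /ceuclid_of_euclid /= c2rK.
by move=> A lA; exact: (ul _ (ceuclid_of_euclid_continuous lA)).
Qed.

HB.instance Definition _ := Uniform_isComplete.Build ceuclid c_complete.

Lemma ceuclid_of_euclid_surj : range ceuclid_of_euclid = [set: ceuclid].
Proof. by apply/seteqP; split=> // z _; exists (c2r z) => //; exact: c2rK. Qed.

Lemma ceuclid_separable : separable ceuclid.
Proof.
exact: separable_image ceuclid_of_euclid_continuous ceuclid_of_euclid_surj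
  (euclid_separable _).
Qed.

Lemma gammaC_full (U : set ceuclid) : open U -> U !=set0 ->
  (0 < mm_meas (Gamma R (n + n)) (ceuclid_of_euclid @^-1` U))%E.
Proof.
move=> oU [z Uz].
have : msupp (mm_meas (Gamma R (n + n))) (c2r z) by rewrite mm_full.
apply; last by rewrite /= /ceuclid_of_euclid c2rK.
by move/continuousP: ceuclid_of_euclid_continuous; exact.
Qed.

(* All real and imaginary parts are independent N(0, 1). *)
Definition GammaC : mmSpace R :=
  mm_law (continuous_borel ceuclid_of_euclid_continuous) ceuclid_separable
    gammaC_full.

End complex_euclid.
Arguments ceuclid : clear implicits.
Arguments GammaC : clear implicits.

Section unit_scalar.
Context (K : numFieldType).

(* Scalars of absolute value 1: {1, -1} for K = R (see Z2P) and U(1) for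
   K = R[i]. *)
Definition unit_scalar := {u : K | `|u| == 1}.
HB.instance Definition _ := Choice.on unit_scalar.

Lemma unit_scalarP (u : unit_scalar) : `|val u| = 1.
Proof. exact/eqP/(valP u). Qed.

Let unit_one : unit_scalar := exist _ 1 (introT eqP (normr1 K)).

Let unit_mul_subproof (u v : unit_scalar) : `|val u * val v| == 1.
Proof. by rewrite normrM !unit_scalarP mulr1. Qed.
Let unit_mul (u v : unit_scalar) : unit_scalar :=
  exist _ (val u * val v) (unit_mul_subproof u v).

Let unit_inv_subproof (u : unit_scalar) : `|(val u)^-1| == 1.
Proof. by rewrite normfV unit_scalarP invr1. Qed.
Let unit_inv (u : unit_scalar) : unit_scalar :=
  exist _ (val u)^-1 (unit_inv_subproof u).

Let unit_neq0 (u : unit_scalar) : val u != 0.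
Proof. by rewrite -normr_eq0 unit_scalarP oner_neq0. Qed.

Let unit_mulA : associative unit_mul.
Proof. by move=> u v w; apply/val_inj; exact: mulrA. Qed.
Let unit_mul1 : left_id unit_one unit_mul.
Proof. by move=> u; apply/val_inj; exact: mul1r. Qed.
Let unit_1mul : right_id unit_one unit_mul.
Proof. by move=> u; apply/val_inj; exact: mulr1. Qed.
Let unit_mulV : left_inverse unit_one unit_inv unit_mul.
Proof. by move=> u; apply/val_inj; exact: mulVf. Qed.
Let unit_Vmul : right_inverse unit_one unit_inv unit_mul.
Proof. by move=> u; apply/val_inj; exact: mulfV. Qed.

HB.instance Definition _ := isGroup.Build unit_scalar
  unit_mulA unit_mul1 unit_1mul unit_mulV unit_Vmul.

Lemma val_unit1 : val (1%g : unit_scalar) = 1. Proof. by []. Qed.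
Lemma val_unitM (u v : unit_scalar) : val (u * v)%g = val u * val v.
Proof. by []. Qed.

End unit_scalar.

Section Z2_action.
Context (R : realType) (n : nat).

Definition Z2 := unit_scalar R.

Lemma Z2P (u : Z2) : val u = 1 \/ val u = - 1.
Proof.
have := unit_scalarP u; case: (ler0P (val u)) => _ h; [right|by left].
by rewrite -[val u]opprK h.
Qed.

Definition Z2_scale (u : Z2) (x : Gamma R n) : Gamma R n :=
  val u *: (x : 'rV[R]_n).

Let Z2_1 x : Z2_scale 1%g x = x.
Proof. exact: scale1r. Qed.

Let Z2_M u v x : Z2_scale (u * v)%g x = Z2_scale u (Z2_scale v x).
Proof. by rewrite /Z2_scale scalerA. Qed.

Let Z2_isom u x y : mdist (Z2_scale u x) (Z2_scale u y) = mdist x y.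
Proof.
by rewrite [LHS]euclid_mdistE -scalerBr norm2Z unit_scalarP mul1r.
Qed.

Let Z2_closed x : closed (range (Z2_scale ^~ x)).
Proof.
have cl y : closed [set (y : Gamma R n)].
  by apply/accessible_closed_set1/hausdorff_accessible; exact: metric_hausdorff.
have -> : range (Z2_scale ^~ x) = [set x] `|` [set (- (x : 'rV[R]_n)) : Gamma R n]; last first.
  by apply: closedU; exact: cl.
apply/seteqP; split=> [_ [u _ <-]|y [->|->]].
- by rewrite /Z2_scale; case: (Z2P u) => ->; [left; rewrite scale1r|right; rewrite scaleN1r].
- by exists 1%g => //; exact: Z2_1.
- have N1 : `|-1 : R| == 1 by rewrite normrN1.
  by exists (exist _ (-1) N1) => //; rewrite /Z2_scale scaleN1r.
Qed.

Definition Z2_action : isoAction (Gamma R n) :=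
  IsoAction Z2_1 Z2_M Z2_isom Z2_closed.

End Z2_action.

Section U1_action.
Context (R : realType) (n : nat).

Definition U1 := unit_scalar R[i].

Definition U1_scale (u : U1) (z : GammaC R n) : GammaC R n :=
  val u *: (z : 'rV[R[i]]_n).

Lemma U1_normc (u : U1) : Normc.normc (val u) = 1.
Proof.
have := unit_scalarP u; rewrite normc_def.
by case: (val u) => a b [].
Qed.

Let U1_1 z : U1_scale 1%g z = z.
Proof. exact: scale1r. Qed.

Let U1_M u v z : U1_scale (u * v)%g z = U1_scale u (U1_scale v z).
Proof. by rewrite /U1_scale scalerA. Qed.

Let U1_isom u z w : mdist (U1_scale u z) (U1_scale u w) = mdist z w.
Proof.
by rewrite [LHS]ceuclid_mdistE -scalerBr cnorm2Z U1_normc mul1r.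
Qed.

Let circle : set (R * R) := [set p | p.1 ^+ 2 + p.2 ^+ 2 = 1].

Let circle_compact : compact circle.
Proof.
pose I : set R := `[-1, 1]%classic.
apply: (@subclosed_compact (R * R)%type circle (I `*` I)).
- rewrite (_ : circle = (fun p : R * R => p.1 ^+ 2 + p.2 ^+ 2) @^-1` [set 1])//.
  apply: closed_comp; last exact: closed_eq.
  move=> p _; rewrite /continuous_at; under eq_fun do rewrite !expr2.
  by rewrite !expr2; apply: cvgD; apply: cvgM; first
    [exact: cvg_fst|exact: cvg_snd].
- by apply: compact_setX; exact: segment_compact.
- move=> [a b]; rewrite /circle /I /= !in_itv/= => ab; split.
    by apply/andP; split; nra.
  by apply/andP; split; nra.
Qed.

Let U1_closed z : closed (range (U1_scale ^~ z)).
Proof.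
pose f (p : R * R) : GammaC R n := (p.1 +i* p.2)%C *: (z : 'rV[R[i]]_n).
have -> : range (U1_scale ^~ z) = f @` circle.
  apply/seteqP; split=> [_ [u _ <-]|_ [[a b] ab <-]].
    exists (complex.Re (val u), complex.Im (val u)); last first.
      by rewrite /f /U1_scale; case: (val u).
    have := U1_normc u; case: (val u) => a b /= h.
    by rewrite /circle /= -(sqr_sqrtr (addr_ge0 (sqr_ge0 a) (sqr_ge0 b))) h expr1n.
  have ab1 : `|(a +i* b)%C : R[i]| == 1.
    by rewrite normc_def /=; rewrite [X in Num.sqrt X]ab sqrtr1.
  by exists (exist (fun u : R[i] => `|u| == 1) (a +i* b)%C ab1).
apply: compact_closed; first exact: metric_hausdorff.
apply: continuous_compact circle_compact; apply: continuous_subspaceT => p.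
have z0 : 0 <= cnorm2 (z : 'rV[R[i]]_n) by exact: sqrtr_ge0.
apply/cvg_ballP => e e0; pose d := e / 2 / (cnorm2 (z : 'rV[R[i]]_n) + 1).
have d0 : 0 < d by rewrite !divr_gt0// ltr_wpDl.
near=> q.
rewrite ball_mdist ceuclid_mdistE /f -scalerBl cnorm2Z.
have [pq1 pq2] : @ball R (R * R)%type p d q.
  by near: q; exact: (@nbhsx_ballx R (R * R)%type p d d0).
have nle (a b : R) : Normc.normc (a +i* b)%C <= `|a| + `|b|.
  rewrite -(@ler_pXn2r _ 2)// ?nnegrE ?addr_ge0 ?sqrtr_ge0// sqr_sqrtr.
    have := mulr_ge0 (normr_ge0 a) (normr_ge0 b).
    by rewrite -(real_normK (num_real a)) -(real_normK (num_real b)); nra.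
  by rewrite addr_ge0 ?sqr_ge0.
have h : Normc.normc ((p.1 +i* p.2)%C - (q.1 +i* q.2)%C) <= 2 * d.
  apply: le_trans (nle (p.1 - q.1) (p.2 - q.2)) _.
  by move: pq1 pq2; rewrite /ball/= => pq1 pq2; lra.
apply: (@le_lt_trans _ _ (2 * d * cnorm2 (z : 'rV[R[i]]_n))).
  exact: ler_wpM2r.
rewrite /d mulrA (mulrC 2) divfK// mulrAC ltr_pdivrMr ?ltr_wpDl//.
by rewrite ltr_pM2l// ltrDl.
Unshelve. all: by end_near. Qed.

Definition U1_action : isoAction (GammaC R n) :=
  IsoAction U1_1 U1_M U1_isom U1_closed.

End U1_action.

Section half_line.
Context (R : realType).

Definition half_line := {x : R | 0 <= x}.

Definition half_line_abs (x : R) : half_line := exist _ `|x| (normr_ge0 x).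

HB.instance Definition _ := Choice.on half_line.
HB.instance Definition _ := isPointed.Build half_line (half_line_abs 0).

Definition half_line_mdist (x y : half_line) : R := `|val x - val y|.

Let h_mdistxx x : half_line_mdist x x = 0.
Proof. by rewrite /half_line_mdist subrr normr0. Qed.

Let h_mdist_positivity x y : half_line_mdist x y = 0 -> x = y.
Proof. by move=> /normr0_eq0/eqP; rewrite subr_eq0 => /eqP/val_inj. Qed.

Let h_mdist_sym x y : half_line_mdist x y = half_line_mdist y x.
Proof. exact: distrC. Qed.

Let h_mdist_triangle y x z :
  half_line_mdist x z <= half_line_mdist x y + half_line_mdist y z.
Proof. exact: ler_distD. Qed.

HB.instance Definition _ := isMetric.Build R half_line
  h_mdistxx h_mdist_positivity h_mdist_sym h_mdist_triangle.

Lemma half_line_mdistE (x y : half_line) : mdist x y = `|val x - val y|.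
Proof. by []. Qed.

Let h_complete (F : set_system half_line) : ProperFilter F -> cauchy F -> cvg F.
Proof.
move=> FF cF; apply/cvg_ex.
apply: complete_fast FF cF => u hu.
have [||l ul] := @fast_cauchy_cvg R R 1 (val \o u).
- exact: ltr01.
- by move=> m; rewrite mul1r; exact: hu.
have l0 : 0 <= l.
  rewrite leNgt; apply/negP => l0.
  have [N _ /(_ N (leqnn N))] := cvgr_lt _ ul _ l0.
  by rewrite /= ltNge (valP (u N)).
exists (exist _ l l0); apply/cvg_ballP => e e0.
by move/cvg_ballP : ul => /(_ e e0).
Qed.

HB.instance Definition _ := Uniform_isComplete.Build half_line h_complete.

Lemma half_line_nbhs (U : set half_line) : open U -> U !=set0 ->
  exists x e : R, [/\ 0 < e & forall y, x < y < x + e -> U (half_line_abs y)].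
Proof.
move=> oU [x Ux].
have /nbhs_ballP[e /= e0 eU] : nbhs x U by exact: open_nbhs_nbhs.
exists (val x), e; split=> // y /andP[xy ye]; apply: eU.
have y0 : 0 <= y by rewrite (le_trans (valP x))// ltW.
rewrite ball_mdist half_line_mdistE /= (ger0_norm y0).
by rewrite distrC gtr0_norm ?subr_gt0// ltrBlDl.
Qed.

Lemma half_line_separable : separable half_line.
Proof.
exists (range (fun q : rat => half_line_abs (ratr q))).
  apply: card_le_trans (card_image_le _ _) _; exact: countableP.
move=> U U0 oU; have [x [e [e0 eU]]] := half_line_nbhs oU U0.
have [|q] := @rat_in_itvoo R x (x + e); first by rewrite ltrDl.
rewrite in_itv/= => qe; exists (half_line_abs (ratr q)).
by split; [exact: eU|exists q].
Qed.

Lemma measurable_half_line_abs : measurable_fun [set: measurableTypeR R]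
  (half_line_abs : measurableTypeR R -> borel half_line).
Proof.
apply: measurable_mdist half_line_separable _ => c.
rewrite (_ : (fun _ => _) = (fun x : R => `|val c - `|x| |)).
  by apply: measurableT_comp => //; apply: measurable_funB => //.
exact/funext.
Qed.

Lemma chi1_full (U : set half_line) : open U -> U !=set0 ->
  (0 < normal_prob 0 1 (half_line_abs @^-1` U))%E.
Proof.
move=> oU U0; have [x [e [e0 eU]]] := half_line_nbhs oU U0.
have xe : x < x + e by rewrite ltrDl.
apply: lt_le_trans (normal_prob_itv_gt0 xe) _.
apply: le_measure; rewrite ?inE//.
  rewrite -[X in measurable X]setTI; apply: measurable_half_line_abs => //.
  exact: sub_sigma_algebra.
Qed.

Definition chi1 : probability (borel half_line) R :=
  law (normal_prob 0 1) measurable_half_line_abs.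

Definition H1 : mmSpace R :=
  mm_law measurable_half_line_abs half_line_separable chi1_full.

Lemma H1E : mm_meas H1 = chi1.
Proof. by []. Qed.

End half_line.

Definition GammaInfZ2 (R : realType) : mmFamily R :=
  box_closure (fun X => exists2 n : nat, (0 < n)%N &
    pyramid_of (mm_quotient (Z2_action R n)) X).

Definition GammaInfU1 (R : realType) : mmFamily R :=
  box_closure (fun X => exists2 n : nat, (0 < n)%N &
    pyramid_of (mm_quotient (U1_action R n)) X).

(* Main.v *)
From HB Require Import structures.
From mathcomp Require Import all_boot all_order all_algebra.
From mathcomp Require Import complex ring lra.
From mathcomp Require Import all_classical all_reals all_analysis measurable_realfun.
Require Import Defs.
Import Order.TTheory GRing.Theory Num.Theory.
Import numFieldNormedType.Exports.
Set Implicit Arguments. Unset Strict Implicit. Unset Printing Implicit Defensive.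
Local Open Scope classical_set_scope.
Local Open Scope ring_scope.

(** Suppose that the half-line [H1] is within small box distance of a
1-Lipschitz image of C^n / U(1).  Matching parameters gives a function
v >= 0 on C^n = R^(2n) that is 1-Lipschitz, invariant under multiplication by
i, and whose law under the Gaussian measure is close to the half-normal law
([profile_of_GammaInfU1]).  Then F = v^2 has mean close to 1, variance close to
2, and |grad F|^2 <= 4 F, so that E |grad F|^2 is at most about 4 = 2 Var F.  On
the other hand F is even, hence orthogonal to the linear functions, and for such
functions the Gaussian Poincare inequality improves to
2 Var F <= E |grad F|^2, with equality only for quadratic forms up to a
constant.  So F is nearly a quadratic form with |grad F|^2 close to 4 F, that is,
the square of the norm of a projection, and its mean 1 makes the projection one
of rank 1.  But F is invariant under i, so the range of the projection is
a complex subspace and has even real dimension: a contradiction.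

The argument is carried out without derivatives or Hermite expansions.  Let
(x, y) be a pair of independent Gaussian vectors and F_t = F (cos t x + sin t y);
this process is stationary because the Gaussian measure of R^(2n) x R^(2n) is
rotation invariant.  For even F the difference D_t = F_t - F_(t + pi/2)
changes sign under t -> t + pi/2, and the triangle inequality for angles in L^2
gives the sharp bound E (D_h - D_0)^2 >= 4 sin^2 h E D_0^2 for dyadic h
([cov_dyadic], [incr_diff_ge]), which plays the role of the improved Poincare
inequality.  The upper bound |grad F|^2 <= 4 F enters through semiconcavity: an
inf-convolution makes v smooth enough from one side for F to lie below affine
functions of slope p with |p|^2 <= 4 F up to second order ([semiconcave_clip_sqr],
[semiconcave_affine_bound]), and averaging this one-sided bound over an exchange
of variables and over y -> - y controls E (F_h - F_0)^2 ([sqr_incr_le]).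

Since both bounds nearly meet, all the slack terms are small.  The difference
quotient b(x, y) = (F (c x + s y) - F (c x - s y)) / (2 s), with c = cos h and
s = sin h, is nearly linear in y ([linerr_dquot]), nearly symmetric
([sum_chord_le]), and E_y b(x, y)^2 is close to 4 F x in mean ([sqdq_close]).
Polarization shows that a(x, z) = E_y b(y, x) b(y, z) is close to
2 (F ((x + z)/sqrt 2) - F ((x - z)/sqrt 2)) ([dqinner_close]), whose second moment is 8 Var F, that is, about 16.  The
invariance under i makes b(., x) and b(., i x) orthogonal and of equal norm,
so Bessel's inequality gives 2 E a^2 <= (E b^2)^2 ([dqinner_sqr]), that is,
E a^2 is at most about 8.  The tail of the half-normal law and all error terms are
absorbed in [closing_estimates] and [clip_constants].

The inclusion of the pyramids holds because every unit real scalar is a unit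
complex scalar: C^n / U(1) is a 1-Lipschitz image of R^(2n) / Z_2
([lip_le_U1_Z2]).  It is strict because [H1] is R / Z_2 itself; its box distance
to itself vanishes as soon as it has a parameter, and a quantile function
provides one ([half_line_parameter]). *)

(** * Expectations of bounded functions *)

Section bounded_measurable.
Context {R : realType} d (T : measurableType d).
Implicit Types f g : T -> R.

(** Bounded measurable functions are stable under all the operations used below
and under partial expectation, so that linearity of the expectation and
Fubini's theorem apply to them without integrability hypotheses. *)
Definition bm f := measurable_fun [set: T] f /\ exists M, forall x, `|f x| <= M.

Lemma bm_cst (k : R) : bm (fun _ => k).
Proof. by split => //; exists `|k|. Qed.

Lemma bmD f g : bm f -> bm g -> bm (fun x => f x + g x).
Proof.
move=> [mf [M fM]] [mg [K gK]]; split; first exact: measurable_funD.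
by exists (M + K) => x; rewrite (le_trans (ler_normD _ _))// lerD.
Qed.

Lemma bmN f : bm f -> bm (fun x => - f x).
Proof.
move=> [mf [M fM]]; split; first exact: measurableT_comp.
by exists M => x; rewrite normrN.
Qed.

Lemma bmB f g : bm f -> bm g -> bm (fun x => f x - g x).
Proof. by move=> bf bg; apply: bmD => //; exact: bmN. Qed.

Lemma bmM f g : bm f -> bm g -> bm (fun x => f x * g x).
Proof.
move=> [mf [M fM]] [mg [K gK]]; split; first exact: measurable_funM.
by exists (M * K) => x; rewrite normrM ler_pM.
Qed.

Lemma bmX n f : bm f -> bm (fun x => f x ^+ n).
Proof.
move=> bf; elim: n => [|n IH]; first exact: bm_cst.
by under eq_fun do rewrite exprS; exact: bmM.
Qed.

Lemma bm_norm f : bm f -> bm (fun x => `|f x|).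
Proof.
move=> [mf [M fM]]; split; first exact: measurableT_comp.
by exists M => x; rewrite normr_id.
Qed.

Lemma bm_maxr f g : bm f -> bm g -> bm (fun x => Num.max (f x) (g x)).
Proof.
move=> [mf [M fM]] [mg [K gK]]; split; first exact: measurable_maxr.
exists (Num.max M K) => x; case: (leP (f x) (g x)) => _.
  by rewrite le_max gK orbT.
by rewrite le_max fM.
Qed.

End bounded_measurable.

Lemma bm_comp {R : realType} d1 d2 (T1 : measurableType d1)
    (T2 : measurableType d2) (f : T2 -> R) (h : T1 -> T2) :
  bm f -> measurable_fun [set: T1] h -> bm (fun x => f (h x)).
Proof.
by move=> [mf [M fM]] mh; split; [exact: measurableT_comp|exists M].
Qed.

Section expectation.
Context {R : realType} d (T : measurableType d) (P : probability T R).
Implicit Types f g : T -> R.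

Definition itg f := P.-integrable [set: T] (EFin \o f).

Definition Ex f : R := \int[P]_x f x.

Lemma bm_itg f : bm f -> itg f.
Proof.
move=> [mf [M fM]]; apply: measurable_bounded_integrable => //.
  by rewrite (le_lt_trans (probability_le1 P measurableT))// ltry.
exists M; split; first exact: num_real.
by move=> y My x _; exact: le_trans (fM x) (ltW My).
Qed.

Lemma itgD f g : itg f -> itg g -> itg (fun x => f x + g x).
Proof. by move=> If Ig; exact: (integrableD _ If Ig). Qed.

Lemma itgZ k f : itg f -> itg (fun x => k * f x).
Proof. by move=> If; apply: (integrableZl _ k If). Qed.

Lemma itgN f : itg f -> itg (fun x => - f x).
Proof. by move=> If; apply: (integrableN If). Qed.

Lemma ExD f g : itg f -> itg g -> Ex (fun x => f x + g x) = Ex f + Ex g.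
Proof. by move=> If Ig; exact: RintegralD. Qed.

Lemma ExZ k f : itg f -> Ex (fun x => k * f x) = k * Ex f.
Proof. by move=> If; exact: RintegralZl. Qed.

Lemma ExN f : itg f -> Ex (fun x => - f x) = - Ex f.
Proof.
move=> If; under [LHS]eq_Rintegral do rewrite -mulN1r.
by rewrite [LHS](ExZ _ If) mulN1r.
Qed.

Lemma ExB f g : itg f -> itg g -> Ex (fun x => f x - g x) = Ex f - Ex g.
Proof. by move=> If Ig; exact: RintegralB. Qed.

Lemma Ex_cst k : Ex (fun _ => k) = k.
Proof.
rewrite /Ex Rintegral_cst// [X in fine X](_ : _ = 1%E) ?mulr1//.
exact: probability_setT.
Qed.

Lemma le_Ex f g : itg f -> itg g -> (forall x, f x <= g x) -> Ex f <= Ex g.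
Proof. by move=> If Ig fg; apply: le_Rintegral. Qed.

Lemma Ex_ge0 f : (forall x, 0 <= f x) -> 0 <= Ex f.
Proof. by move=> f0; apply: Rintegral_ge0. Qed.

Lemma eq_Ex f g : f =1 g -> Ex f = Ex g.
Proof. by move=> /funext ->. Qed.

Lemma Ex_norm_le f : itg f -> `|Ex f| <= Ex (fun x => `|f x|).
Proof. by move=> If; exact: le_normr_Rintegral. Qed.

Lemma Ex_bound f M : itg f -> (forall x, `|f x| <= M) -> `|Ex f| <= M.
Proof.
move=> If fM; rewrite (le_trans (Ex_norm_le If))//.
rewrite -[leRHS]Ex_cst; apply: le_Ex => //; last exact: bm_itg (bm_cst _ _).
exact: (integrable_norm If).
Qed.

(** The Cauchy-Schwarz inequality: the quadratic form (a, b) |-> E (a f + b g)^2 is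
nonnegative, and it is evaluated at (E g^2, - E f g). *)
Lemma Ex_CS f g : bm f -> bm g ->
  Ex (fun x => f x * g x) ^+ 2 <= Ex (fun x => f x ^+ 2) * Ex (fun x => g x ^+ 2).
Proof.
move=> bf bg.
set A := Ex (fun x => f x ^+ 2); set B := Ex (fun x => g x ^+ 2).
set C := Ex (fun x => f x * g x).
have If2 := bm_itg (bmX 2 bf); have Ig2 := bm_itg (bmX 2 bg).
have Ifg := bm_itg (bmM bf bg).
have H (a b : R) : 0 <= a ^+ 2 * A + 2 * a * b * C + b ^+ 2 * B.
  rewrite -(ExZ _ If2) -(ExZ _ Ifg) -(ExZ _ Ig2) -ExD; try exact: itgZ.
  rewrite -ExD; [|by apply: itgD; exact: itgZ|exact: itgZ].
  apply: Ex_ge0 => x.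
  have -> : a ^+ 2 * f x ^+ 2 + 2 * a * b * (f x * g x) + b ^+ 2 * g x ^+ 2 =
    (a * f x + b * g x) ^+ 2 by ring.
  exact: sqr_ge0.
have A0 : 0 <= A by apply: Ex_ge0 => x; exact: sqr_ge0.
have B0 : 0 <= B by apply: Ex_ge0 => x; exact: sqr_ge0.
have [B0'|B1] := eqVneq B 0.
  have := H C (- (A + 1)/2); rewrite B0' !mulr0 addr0.
  have -> : C ^+ 2 * A + 2 * C * (- (A + 1) / 2) * C = - C ^+ 2 by field.
  by rewrite oppr_ge0.
have Bgt : 0 < B by rewrite lt_neqAle eq_sym B1.
have := H B (- C).
have -> : B ^+ 2 * A + 2 * B * - C * C + (- C) ^+ 2 * B = B * (A * B - C ^+ 2) by ring.
by rewrite pmulr_rge0// subr_ge0.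
Qed.

End expectation.

Section sections.
Context {R : realType} d1 d2 (T1 : measurableType d1) (T2 : measurableType d2).
Implicit Type f : T1 * T2 -> R.

Lemma bm_sectl f x : bm f -> bm (fun y => f (x, y)).
Proof. by move=> bf; apply: (bm_comp bf); exact: pair1_measurable. Qed.

Lemma bm_sectr f y : bm f -> bm (fun x => f (x, y)).
Proof. by move=> bf; apply: (bm_comp bf); exact: pair2_measurable. Qed.

(** Measurability of partial integrals is available for nonnegative functions;
adding the bound M makes f nonnegative without changing the statement. *)
Lemma bm_Exl (P2 : probability T2 R) f : bm f ->
  bm (fun x => Ex P2 (fun y => f (x, y))).
Proof.
move=> bf; case: (bf) => mf [M fM]; split; last first.
  by exists M => x; apply: Ex_bound => //; exact: bm_itg (bm_sectl x bf).
have mfM : measurable_fun setT (fun p => (f p + M)%:E).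
  by apply/measurable_EFinP; apply: measurable_funD.
have fM0 p : (0 <= (f p + M)%:E)%E.
  by rewrite lee_fin -lerBlDr sub0r; have /lerNnormlW := fM p; rewrite lerNl.
have := measurable_fun_fubini_tonelli_F (m2 := P2) _ mfM fM0.
move=> /(measurableT_comp (@fine_measurable R setT measurableT)) mF.
rewrite (_ : (fun x => _) = (fun x => Ex P2 (fun y => f (x, y) + M) - M)).
  by apply: measurable_funB.
apply/funext => x; rewrite ExD ?Ex_cst ?addrK//; last exact: bm_itg (bm_cst _ _).
exact: bm_itg (bm_sectl x bf).
Qed.

Lemma bm_Exr (P1 : probability T1 R) f : bm f ->
  bm (fun y => Ex P1 (fun x => f (x, y))).
Proof.
move=> bf; case: (bf) => mf [M fM]; split; last first.
  by exists M => y; apply: Ex_bound => //; exact: bm_itg (bm_sectr y bf).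
have mfM : measurable_fun setT (fun p => (f p + M)%:E).
  by apply/measurable_EFinP; apply: measurable_funD.
have fM0 p : (0 <= (f p + M)%:E)%E.
  by rewrite lee_fin -lerBlDr sub0r; have /lerNnormlW := fM p; rewrite lerNl.
have := measurable_fun_fubini_tonelli_G (m1 := P1) _ mfM fM0.
move=> /(measurableT_comp (@fine_measurable R setT measurableT)) mF.
rewrite (_ : (fun x => _) = (fun y => Ex P1 (fun x => f (x, y) + M) - M)).
  by apply: measurable_funB.
apply/funext => y; rewrite ExD ?Ex_cst ?addrK//; last exact: bm_itg (bm_cst _ _).
exact: bm_itg (bm_sectr y bf).
Qed.

End sections.

Section fubini.
Context {R : realType} d1 d2 (T1 : measurableType d1) (T2 : measurableType d2).
Context (P1 : probability T1 R) (P2 : probability T2 R).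

Lemma Ex_fubini1 (f : T1 * T2 -> R) : bm f ->
  Ex (prod_prob P1 P2) f = Ex P1 (fun x => Ex P2 (fun y => f (x, y))).
Proof.
move=> bf; have If : (P1 \x P2)%E.-integrable setT (EFin \o f).
  exact: (bm_itg (prod_prob P1 P2) bf).
rewrite /Ex /Rintegral; congr fine.
rewrite -[LHS](integral12_prod_meas1 If); apply: eq_integral => x _.
rewrite fineK//; apply: integrable_fin_num => //.
exact: (bm_itg P2 (bm_sectl x bf)).
Qed.

Lemma Ex_fubini2 (f : T1 * T2 -> R) : bm f ->
  Ex (prod_prob P1 P2) f = Ex P2 (fun y => Ex P1 (fun x => f (x, y))).
Proof.
move=> bf; have If : (P1 \x P2)%E.-integrable setT (EFin \o f).
  exact: (bm_itg (prod_prob P1 P2) bf).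
rewrite /Ex /Rintegral; congr fine.
rewrite -[LHS](integral21_prod_meas1 If); apply: eq_integral => x _.
rewrite fineK//; apply: integrable_fin_num => //.
exact: (bm_itg P1 (bm_sectr x bf)).
Qed.

Lemma Ex_swap (f : T1 * T2 -> R) : bm f ->
  Ex P1 (fun x => Ex P2 (fun y => f (x, y))) = Ex P2 (fun y => Ex P1 (fun x => f (x, y))).
Proof. by move=> bf; rewrite -Ex_fubini1// Ex_fubini2. Qed.

End fubini.

Lemma Ex_pushforward {R : realType} d1 d2 (T1 : measurableType d1)
    (T2 : measurableType d2) (P1 : probability T1 R) (P2 : probability T2 R)
    (h : T1 -> T2) (f : T2 -> R) : measurable_fun [set: T1] h ->
  (forall A, measurable A -> P2 A = P1 (h @^-1` A)) ->
  bm f -> Ex P2 f = Ex P1 (fun x => f (h x)).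
Proof.
move=> mh hP bf; rewrite /Ex /Rintegral; congr fine.
rewrite [RHS](_ : _ = \int[P1]_(x in h @^-1` setT) ((EFin \o f) \o h) x)%E; last first.
  by rewrite preimage_setT.
rewrite -integral_pushforward//; last 2 first.
- by apply/measurable_EFinP; case: bf.
- by rewrite preimage_setT; apply: (bm_itg P1); exact: bm_comp bf mh.
apply: eq_measure_integral => A mA _; exact: hP.
Qed.

(** * Rotation invariance of the Gaussian measure *)

Section lebesgue_shear.
Context {R : realType}.
Local Notation mu := (@lebesgue_measure R).
Local Notation TR := (measurableTypeR R).

Lemma ge0_integral_shift (f : TR -> \bar R) (a : R) :
  measurable_fun [set: TR] f -> (forall x, 0 <= f x)%E ->
  (\int[mu]_x f (x + a)%R = \int[mu]_x f x)%E.
Proof.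
move=> mf f0.
pose h (x : TR) : TR := (x + a)%R.
have mh : measurable_fun [set: TR] h by apply: measurable_funD.
rewrite [LHS](_ : _ = \int[mu]_(x in h @^-1` setT) (f \o h) x)%E; last first.
  by rewrite preimage_setT.
rewrite -ge0_integral_pushforward//.
apply: eq_measure_integral => A mA _.
apply/esym/lebesgue_measure_unique => //= _ [[u v]] _ <-.
rewrite /pushforward (_ : h @^-1` _ = `]u - a, v - a]%classic).
  rewrite !lebesgue_measure_itv/= !lte_fin ltrD2r.
  by case: ifP => // _; rewrite -!EFinB; congr EFin; ring.
by apply/seteqP; split => x /=; rewrite !in_itv/= /h ltrBlDr lerBrDr.
Qed.

Lemma ge0_integral_shear1 (H : TR * TR -> \bar R) (a : R) :
  measurable_fun [set: TR * TR] H -> (forall p, 0 <= H p)%E ->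
  (\int[mu]_x \int[mu]_y H (x + a * y, y)%R = \int[mu]_x \int[mu]_y H (x, y))%E.
Proof.
move=> mH H0.
have mS : measurable_fun [set: TR * TR] (fun p : TR * TR => H (p.1 + a * p.2, p.2)).
  apply: (measurableT_comp mH); apply: measurable_fun_pair => //=.
  by apply: measurable_funD => //; apply: measurable_funM.
have E1 := @fubini_tonelli _ _ TR TR R mu mu
  (fun p : TR * TR => H (p.1 + a * p.2, p.2)) mS (fun p => H0 _).
have E2 := @fubini_tonelli _ _ TR TR R mu mu H mH H0.
apply: (etrans E1); apply: (etrans _ (esym E2)); apply: eq_integral => y _ /=.
exact: (ge0_integral_shift (f := fun x => H (x, y)) (a * y)
  (measurableT_comp mH (pair2_measurable y)) (fun x => H0 _)).
Qed.

Lemma ge0_integral_shear2 (H : TR * TR -> \bar R) (b : R) :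
  measurable_fun [set: TR * TR] H -> (forall p, 0 <= H p)%E ->
  (\int[mu]_x \int[mu]_y H (x, y + b * x)%R = \int[mu]_x \int[mu]_y H (x, y))%E.
Proof.
move=> mH H0; apply: eq_integral => x _ /=.
exact: (ge0_integral_shift (f := fun y => H (x, y)) (b * x)
  (measurableT_comp mH (pair1_measurable x)) (fun y => H0 _)).
Qed.

(** A rotation of the plane with s <> 0 is the product of the three shears with
slopes a, - s and a, where a = (1 - c) / s, and shears preserve Lebesgue measure
by Tonelli's theorem and translation invariance. *)
Lemma ge0_integral_rot (H : TR * TR -> \bar R) (c s : R) :
  measurable_fun [set: TR * TR] H -> (forall p, 0 <= H p)%E ->
  c ^+ 2 + s ^+ 2 = 1 -> s != 0 ->
  (\int[mu]_x \int[mu]_y H (c * x + s * y, - s * x + c * y)%R =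
   \int[mu]_x \int[mu]_y H (x, y))%E.
Proof.
move=> mH H0 cs s0; pose a := (1 - c) / s.
pose S1 (p : TR * TR) : TR * TR := (p.1 + a * p.2, p.2).
pose S2 (p : TR * TR) : TR * TR := (p.1, p.2 + - s * p.1).
have mS1 : measurable_fun [set: TR * TR] S1.
  apply: measurable_fun_pair => //=.
  by apply: measurable_funD => //; apply: measurable_funM.
have mS2 : measurable_fun [set: TR * TR] S2.
  apply: measurable_fun_pair => //=.
  by apply: measurable_funD => //; apply: measurable_funM.
have -> : (fun x => \int[mu]_y H (c * x + s * y, - s * x + c * y)%R)%E =
   (fun x => \int[mu]_y (H \o S1 \o S2) (S1 (x, y)))%E.
  apply/funext => x; apply: eq_integral => y _ /=; congr H.
  rewrite /S1 /S2 /= /a; congr pair; last by field.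
  have -> : c * x + s * y = c * x + (1 - c ^+ 2) / s * y.
    by rewrite -cs; field.
  by field.
have mH1 := measurableT_comp mH mS1.
apply: etrans (ge0_integral_shear1 a (measurableT_comp mH1 mS2) (fun p => H0 _)) _.
apply: etrans (ge0_integral_shear2 (- s) mH1 (fun p => H0 _)) _.
exact: ge0_integral_shear1.
Qed.

End lebesgue_shear.

Section gaussian_line.
Context {R : realType}.
Local Notation mu := (@lebesgue_measure R).
Local Notation TR := (measurableTypeR R).
Local Notation g1 := (@normal_prob R 0 1).
Local Notation pdf := (@normal_pdf R 0 1).

(** The density is a Radon-Nikodym derivative, unique almost everywhere. *)
Lemma ge0_integral_normal (f : TR -> \bar R) :
  measurable_fun [set: TR] f -> (forall x, 0 <= f x)%E ->
  (\int[g1]_x f x = \int[mu]_x (f x * (pdf x)%:E))%E.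
Proof.
move=> mf f0.
have dom := normal_prob_dominates (0 : R) 1.
rewrite -(Radon_Nikodym_SigmaFinite.change_of_variables dom)//.
have RI := Radon_Nikodym_SigmaFinite.f_integrable dom.
apply: ae_eq_integral => //.
- by apply: emeasurable_funM => //; exact: measurable_int RI.
- apply: emeasurable_funM => //; apply/measurable_EFinP.
  exact: measurable_normal_pdf.
- apply: ae_eqe_mul2l; apply: integral_ae_eq => //.
  + by apply/measurable_EFinP; exact: measurable_normal_pdf.
  + by move=> A _ mA; rewrite -(Radon_Nikodym_SigmaFinite.f_integral dom).
Qed.

Lemma normal_pdf_rot (c s x y : R) : c ^+ 2 + s ^+ 2 = 1 ->
  pdf (c * x + s * y) * pdf (- s * x + c * y) = pdf x * pdf y.
Proof.
move=> cs; rewrite !normal_pdfE ?oner_neq0// /normal_fun.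
rewrite mulrACA [RHS]mulrACA -!expRD; congr (_ * expR _).
rewrite !subr0 -!mulrDl; congr (_ / _).
transitivity (- ((c ^+ 2 + s ^+ 2) * (x ^+ 2 + y ^+ 2))); first by ring.
by rewrite cs; ring.
Qed.

(** The plane Gaussian density depends on x^2 + y^2 only, so that the rotation
invariance of Lebesgue measure carries over. *)
Lemma Ex_normal_rot (f : TR * TR -> R) (c s : R) : bm f ->
  c ^+ 2 + s ^+ 2 = 1 -> s != 0 ->
  Ex g1 (fun x => Ex g1 (fun y => f (c * x + s * y, - s * x + c * y))) =
  Ex g1 (fun x => Ex g1 (fun y => f (x, y))).
Proof.
move=> bf cs s0; case: (bf) => mf [M fM].
pose rt (p : TR * TR) : TR * TR := (c * p.1 + s * p.2, - s * p.1 + c * p.2).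
have mrt : measurable_fun [set: TR * TR] rt.
  by apply: measurable_fun_pair => /=; apply: measurable_funD => //;
    apply: measurable_funM.
have main (h : TR * TR -> R) : measurable_fun [set: TR * TR] h -> (forall p, 0 <= h p) ->
   (\int[prod_prob g1 g1]_p (h (rt p))%:E = \int[prod_prob g1 g1]_p (h p)%:E)%E.
  move=> mh h0.
  have tolb (k : TR * TR -> R) : measurable_fun [set: TR * TR] k -> (forall p, 0 <= k p) ->
      (\int[prod_prob g1 g1]_p (k p)%:E =
       \int[mu]_x \int[mu]_y (k (x, y) * (pdf x * pdf y))%:E)%E.
    move=> mk k0.
    have mEk : measurable_fun [set: TR * TR] (EFin \o k) by exact/measurable_EFinP.
    have Ek0 p : (0 <= (EFin \o k) p)%E by rewrite /= lee_fin.
    apply: (etrans (fubini_tonelli1 (EFin \o k) mEk Ek0)).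
    have mk1 x : measurable_fun [set: TR] (fun y => (k (x, y))%:E).
      by apply/measurable_EFinP; exact: measurableT_comp mk (pair1_measurable x).
    rewrite /fubini_F ge0_integral_normal/=; last 2 first.
    - exact: (measurable_fun_fubini_tonelli_F (EFin \o k)).
    - by move=> x; apply: integral_ge0 => y _; rewrite lee_fin.
    apply: eq_integral => x _; rewrite ge0_integral_normal//; last by move=> ?; rewrite lee_fin.
    rewrite -ge0_integralZr//=.
    - by apply: eq_integral => y _; rewrite -!EFinM; congr EFin; ring.
    - apply: emeasurable_funM => //.
      by apply/measurable_EFinP; exact: measurable_normal_pdf.
    - by move=> y _; rewrite mule_ge0// lee_fin// normal_pdf_ge0.
    - by rewrite lee_fin normal_pdf_ge0.
  pose H (p : TR * TR) := ((h p * (pdf p.1 * pdf p.2))%:E : \bar R).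
  have mH : measurable_fun [set: TR * TR] H.
    apply/measurable_EFinP; apply: measurable_funM => //; apply: measurable_funM.
      by apply: measurableT_comp => //; exact: measurable_normal_pdf.
    by apply: measurableT_comp => //; exact: measurable_normal_pdf.
  have H0 p : (0 <= H p)%E.
    by rewrite lee_fin mulr_ge0// mulr_ge0// normal_pdf_ge0.
  apply: etrans (tolb (fun p => h (rt p)) (measurableT_comp mh mrt) (fun p => h0 _)) _.
  apply: etrans (esym (tolb h mh h0)).
  apply: etrans (ge0_integral_rot mH H0 cs s0).
  apply: eq_integral => x _; apply: eq_integral => y _.
  by rewrite /H /= normal_pdf_rot.
have bfr : bm (fun p => f (rt p)) by exact: bm_comp bf mrt.
have bM : bm (fun _ : TR * TR => M) by exact: bm_cst.
have e1 := Ex_fubini1 g1 g1 bfr; have e2 := Ex_fubini1 g1 g1 bf.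
rewrite /rt /= in e1; rewrite -e1 -e2.
apply: (addIr M).
rewrite -[X in _ + X](Ex_cst (prod_prob g1 g1) M) -ExD; try exact: bm_itg.
rewrite -[X in _ = _ + X](Ex_cst (prod_prob g1 g1) M) -ExD; try exact: bm_itg.
rewrite /Ex /Rintegral; congr fine; apply: (main (fun p => f p + M)).
  by apply: measurable_funD.
by move=> p; rewrite -lerBlDr sub0r; have /lerNnormlW := fM p; rewrite lerNl.
Qed.

End gaussian_line.

Section gaussian_space.
Context {R : realType}.
Local Notation TR := (measurableTypeR R).
Local Notation tupleR n := (n.-tuple (measurableTypeR R)).
Local Notation g1 := (@normal_prob R 0 1).
Local Notation gauss := (@gauss_tuple R).

Lemma Ex_gaussS n (f : tupleR n.+1 -> R) : bm f ->
  Ex (gauss n.+1) f = Ex g1 (fun x => Ex (gauss n) (fun t => f [tuple of x :: t])).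
Proof.
move=> bf.
have bc := bm_comp bf (@measurable_tuple_cons R n).
apply: etrans (Ex_fubini1 g1 (gauss n) bc).
exact: (Ex_pushforward (P1 := prod_prob g1 (gauss n)) (@measurable_tuple_cons R n)).
Qed.

Definition comb n (c s : R) (x y : tupleR n) : tupleR n :=
  [tuple (c * tnth x i + s * tnth y i : TR) | i < n].

Lemma tnth_comb n c s (x y : tupleR n) i :
  tnth (comb c s x y) i = c * tnth x i + s * tnth y i.
Proof. exact: tnth_mktuple. Qed.

Lemma comb_cons n c s (x0 y0 : TR) (x y : tupleR n) :
  comb c s [tuple of x0 :: x] [tuple of y0 :: y] =
  [tuple of (c * x0 + s * y0) :: comb c s x y].
Proof.
apply: eq_from_tnth => i; rewrite tnth_comb; case: (unliftP ord0 i) => [j ->|->].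
  by rewrite !tnthS tnth_comb.
by rewrite !tnth0.
Qed.

Lemma measurable_comb n c s : measurable_fun [set: tupleR n * tupleR n]
  (fun p => comb c s p.1 p.2).
Proof.
apply/measurable_fun_tnthP => i.
rewrite (_ : _ \o _ = (fun p : tupleR n * tupleR n => c * tnth p.1 i + s * tnth p.2 i)).
  apply: measurable_funD; apply: measurable_funM => //.
    exact: measurableT_comp (measurable_tnth i) measurable_fst.
  exact: measurableT_comp (measurable_tnth i) measurable_snd.
by apply/funext => p /=; rewrite tnth_comb.
Qed.

Let cons2 n (p : (TR * TR) * (tupleR n * tupleR n)) : tupleR n.+1 * tupleR n.+1 :=
  ([tuple of p.1.1 :: p.2.1], [tuple of p.1.2 :: p.2.2]).

Let measurable_cons2 n : measurable_fun setT (@cons2 n).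
Proof.
have m11 : measurable_fun setT (fun p : (TR * TR) * (tupleR n * tupleR n) => (p.1.1, p.2.1)).
  apply: measurable_fun_pair.
    exact: measurableT_comp measurable_fst measurable_fst.
  exact: measurableT_comp measurable_fst measurable_snd.
have m22 : measurable_fun setT (fun p : (TR * TR) * (tupleR n * tupleR n) => (p.1.2, p.2.2)).
  apply: measurable_fun_pair.
    exact: measurableT_comp measurable_snd measurable_fst.
  exact: measurableT_comp measurable_snd measurable_snd.
apply: measurable_fun_pair.
  exact: measurableT_comp (@measurable_tuple_cons R n) m11.
exact: measurableT_comp (@measurable_tuple_cons R n) m22.
Qed.

Lemma measurable_rot n c s : measurable_fun [set: tupleR n * tupleR n]
  (fun p => (comb c s p.1 p.2, comb (- s) c p.1 p.2)).
Proof. exact: measurable_fun_pair (measurable_comb c s) (measurable_comb (- s) c). Qed.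

(** By induction on n: a rotation of a pair of vectors acts on each pair of
coordinates by the same plane rotation. *)
Lemma Ex_gauss_rot n (f : tupleR n * tupleR n -> R) (c s : R) : bm f ->
  c ^+ 2 + s ^+ 2 = 1 -> s != 0 ->
  Ex (gauss n) (fun x => Ex (gauss n) (fun y => f (comb c s x y, comb (- s) c x y))) =
  Ex (gauss n) (fun x => Ex (gauss n) (fun y => f (x, y))).
Proof.
move=> + cs s0; elim: n f => [|n IH] f bf.
  apply: eq_Ex => x; apply: eq_Ex => y.
  have e0 (u v : tupleR 0) : u = v by rewrite [u]tuple0 [v]tuple0.
  by congr (f (_, _)); exact: e0.
pose f' p := f (cons2 p).
have bf' : bm f' by exact: bm_comp bf (@measurable_cons2 n).
(* both sides become iterated over x0, y0, x, y *)
have split4 (h : tupleR n.+1 * tupleR n.+1 -> R) : bm h ->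
  Ex (gauss n.+1) (fun x => Ex (gauss n.+1) (fun y => h (x, y))) =
  Ex g1 (fun x0 => Ex g1 (fun y0 => Ex (gauss n) (fun x => Ex (gauss n) (fun y =>
    h (cons2 ((x0, y0), (x, y))))))).
  move=> bh; have bh' : bm (fun p => h (cons2 p)) by exact: bm_comp bh (@measurable_cons2 n).
  have b1 : bm (fun x => Ex (gauss n.+1) (fun y => h (x, y))) by exact: bm_Exl.
  rewrite (Ex_gaussS b1); apply: eq_Ex => x0.
  have b2 : bm (fun q : tupleR n * TR => Ex (gauss n) (fun y =>
      h (cons2 ((x0, q.2), (q.1, y))))).
    apply: (@bm_Exl _ _ _ (tupleR n * TR)%type _ _ (fun r => h (cons2 ((x0, r.1.2), (r.1.1, r.2))))).
    apply: (bm_comp bh'); apply: measurable_fun_pair; apply: measurable_fun_pair => //.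
    - exact: measurableT_comp measurable_snd measurable_fst.
    - exact: measurableT_comp measurable_fst measurable_fst.
  have := Ex_swap (gauss n) g1 b2; rewrite /= => <-.
  apply: eq_Ex => x; rewrite (Ex_gaussS (bm_sectl _ bh)).
  by apply: eq_Ex => y0.
have bfr := bm_comp bf (@measurable_rot n.+1 c s).
apply: etrans (split4 _ bfr) _; apply: etrans (esym (split4 _ bf)).
pose G (r : TR * TR) := Ex (gauss n) (fun x => Ex (gauss n) (fun y => f' (r, (x, y)))).
have bG : bm G.
  rewrite /G; under eq_fun => r do rewrite -(Ex_fubini1 (gauss n) (gauss n) (bm_sectl r bf')).
  exact: bm_Exl.
apply: etrans (Ex_normal_rot bG cs s0).
apply: eq_Ex => x0; apply: eq_Ex => y0; rewrite /G -(IH _ (bm_sectl _ bf')).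
apply: eq_Ex => x; apply: eq_Ex => y.
by rewrite /f' /cons2 /= !comb_cons.
Qed.

End gaussian_space.

(** * Gaussian moments *)

Section integrable_extra.
Context {R : realType} d (T : measurableType d) (P : probability T R).
Implicit Types f g : T -> R.

Lemma itgB f g : itg P f -> itg P g -> itg P (fun x => f x - g x).
Proof. by move=> If Ig; apply: itgD => //; exact: itgN. Qed.

Lemma itg_cst k : itg P (fun _ => k).
Proof. exact: bm_itg (bm_cst _ _). Qed.

Lemma itg_dom f g : measurable_fun [set: T] f -> itg P g ->
  (forall x, `|f x| <= g x) -> itg P f.
Proof.
move=> mf Ig fg; apply: le_integrable Ig => //; first exact/measurable_EFinP.
by move=> x _; rewrite lee_fin (le_trans (fg x))// ler_norm.
Qed.

Lemma itg_sum I (r : seq I) (F : I -> T -> R) : (forall i, itg P (F i)) ->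
  itg P (fun x => \sum_(i <- r) F i x).
Proof.
move=> IF; elim: r => [|i r IH].
  by under eq_fun do rewrite big_nil; exact: itg_cst.
by under eq_fun do rewrite big_cons; exact: itgD.
Qed.

Lemma Ex_sum I (r : seq I) (F : I -> T -> R) : (forall i, itg P (F i)) ->
  Ex P (fun x => \sum_(i <- r) F i x) = \sum_(i <- r) Ex P (F i).
Proof.
move=> IF; elim: r => [|i r IH].
  by under eq_fun do rewrite big_nil; rewrite Ex_cst big_nil.
under eq_fun do rewrite big_cons; rewrite ExD ?IH ?big_cons//.
exact: itg_sum.
Qed.

End integrable_extra.

Section gaussian_moments.
Context {R : realType}.
Local Notation mu := (@lebesgue_measure R).
Local Notation TR := (measurableTypeR R).
Local Notation g1 := (@normal_prob R 0 1).

(** The integrand is, up to the factor s, the density of N(0, s^2) relative to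
N(0, 1).  This one-parameter family of exact integrals yields all the moments
that are needed. *)
Lemma integral_normal_gauss (s : R) : 0 < s ->
  (\int[g1]_x (expR (- (s ^- 2 - 1) * x ^+ 2 / 2))%:E = s%:E)%E.
Proof.
move=> s0; have sn0 : s != 0 by rewrite gt_eqF.
rewrite ge0_integral_normal; last 2 first.
- apply/measurable_EFinP; apply: measurableT_comp => //.
  by apply: measurable_funM => //; apply: measurable_funM.
- by move=> x; rewrite lee_fin expR_ge0.
transitivity (\int[mu]_x ((s * normal_pdf 0 s x)%:E))%E; last first.
  under eq_integral do rewrite EFinM.
  rewrite ge0_integralZl//=.
  - by rewrite integral_normal_pdf mule1.
  - by apply/measurable_EFinP; exact: measurable_normal_pdf.
  - by move=> x _; rewrite lee_fin normal_pdf_ge0.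
  - by rewrite lee_fin ltW.
apply: eq_integral => x _; rewrite -EFinM; congr EFin.
rewrite !normal_pdfE ?oner_neq0// /normal_fun !subr0 expr1n.
have pk : normal_peak 1 = s * normal_peak s.
  rewrite /normal_peak expr1n mul1r -mulrnAr sqrtrM ?sqr_ge0// sqrtr_sqr gtr0_norm//.
  by rewrite invfM mulrA divff// mul1r.
rewrite mulrCA -expRD [RHS]mulrA -pk; congr (_ * expR _).
by field.
Qed.

Lemma itg_normal_exp (s : R) : 0 < s ->
  itg g1 (fun x : TR => expR (- (s ^- 2 - 1) * x ^+ 2 / 2)).
Proof.
move=> s0; apply/integrableP; split.
  apply/measurable_EFinP; apply: measurableT_comp => //.
  by apply: measurable_funM => //; apply: measurable_funM.
under eq_integral do rewrite /= ger0_norm ?expR_ge0//.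
by rewrite integral_normal_gauss// ltry.
Qed.

Lemma Ex_normal_exp (s : R) : 0 < s ->
  Ex g1 (fun x : TR => expR (- (s ^- 2 - 1) * x ^+ 2 / 2)) = s.
Proof. by move=> s0; rewrite /Ex /Rintegral integral_normal_gauss. Qed.

(** (x^2 / 20)^5 is at most exp (5 x^2 / 20), which is integrable by the case
s^2 = 2 of the exact integrals.  The tenth moment is what bounds the tail of
the fourth moment with room to spare. *)
Lemma itg_normalX10 : itg g1 (fun x : TR => x ^+ 10).
Proof.
have q0 : 0 < Num.sqrt 2 :> R by rewrite sqrtr_gt0.
have I := itgZ (20 ^+ 5) (itg_normal_exp q0); apply: (itg_dom _ I).
  exact: measurable_funX.
move=> x; rewrite ger0_norm ?exprn_even_ge0// sqr_sqrtr//.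
have -> : - (2^-1 - 1) * x ^+ 2 / 2 = 5%:R * (x ^+ 2 / 20) :> R.
  by field.
rewrite expRM_natl -exprMn.
have -> : x ^+ 10 = (20 * (x ^+ 2 / 20)) ^+ 5 :> R.
  by rewrite mulrC divfK// -exprM.
have h0 : 0 <= x ^+ 2 / 20 by rewrite divr_ge0// sqr_ge0.
apply: lerXn2r; [by rewrite nnegrE mulr_ge0|by rewrite nnegrE mulr_ge0// expR_ge0|].
by rewrite ler_pM2l// (le_trans _ (expR_ge1Dx _))// lerDr.
Qed.

Lemma itg_normalX k : (k <= 5)%N -> itg g1 (fun x : TR => (x ^+ 2) ^+ k).
Proof.
move=> k5; have I := itgD (itg_cst g1 1) itg_normalX10; apply: (itg_dom _ I).
  by apply: measurable_funX; exact: measurable_funX.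
suff H (x : R) : `|(x ^+ 2) ^+ k| <= 1 + x ^+ 10 by move=> x; exact: H.
have h j : 0 <= (x ^+ 2) ^+ j by apply: exprn_ge0; exact: sqr_ge0.
rewrite ger0_norm// (_ : x ^+ 10 = (x ^+ 2) ^+ 5); last by rewrite -exprM.
have [x1|x1] := leP (x ^+ 2) 1.
  by rewrite (le_trans (exprn_ile1 k (sqr_ge0 x) x1))// lerDl h.
by rewrite (le_trans (ler_weXn2l (ltW x1) k5))// lerDr.
Qed.

Lemma itg_normal_id : itg g1 (fun x : TR => x).
Proof.
have I := itgD (itg_cst g1 1) (itg_normalX (k := 1) isT); apply: (itg_dom _ I) => //.
suff H (x : R) : `|x| <= 1 + (x ^+ 2) ^+ 1 by move=> x; exact: H.
by rewrite expr1 ler_norml; nra.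
Qed.

Lemma expR_ge_deg2 (y : R) : 0 <= y -> 1 + y + y ^+ 2 / 2 <= expR y.
Proof.
move=> y0; have -> : 1 + y + y ^+ 2 / 2 = series (exp_coeff y) 3.
  rewrite /series /= !big_nat_recr//= big_geq// /exp_coeff /= add0r.
  by rewrite expr0 expr1 !fact0 !factS !fact0 /=; field.
rewrite /expR; apply: nondecreasing_cvgn_le; last exact: is_cvg_series_exp_coeff.
apply/nondecreasing_seqP => n; rewrite /series /= big_nat_recr//= lerDl.
exact: exp_coeff_ge0.
Qed.

Lemma expRN_le2 (y : R) : 0 <= y -> expR (- y) <= 1 - y + y ^+ 2 / 2.
Proof.
move=> y0; rewrite expRN -[leLHS]mul1r ler_pdivrMr ?expR_gt0//.
have h0 : 0 < 1 - y + y ^+ 2 / 2 by have := sqr_ge0 (y - 1); nra.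
apply: (le_trans _ (ler_wpM2l (ltW h0) (expR_ge_deg2 y0))).
by have := sqr_ge0 (y ^+ 2); nra.
Qed.

Section values.
Let m2 := Ex g1 (fun x : TR => (x ^+ 2) ^+ 1).
Let m4 := Ex g1 (fun x : TR => (x ^+ 2) ^+ 2).

(** Expanding exp (- k x^2 / 2) to first and second order in k bounds its
integral s by the moments; k = s^(-2) - 1 tends to 0 as s tends to 1. *)
Let taylor (s : R) (k := s ^- 2 - 1) : 0 < s -> s <= 1 ->
  1 - k / 2 * m2 <= s /\ s <= 1 - k / 2 * m2 + k ^+ 2 / 8 * m4.
Proof.
move=> s0 s1.
have k0 : 0 <= k by rewrite subr_ge0 invf_ge1 ?exprn_gt0// exprn_ile1// ltW.
have I1 := itg_normalX (k := 1) isT; have I2 := itg_normalX (k := 2) isT.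
have Ie := itg_normal_exp s0; have Ic := itg_cst g1 (1 : R).
have Iq := itgB Ic (itgZ (k / 2) I1).
split.
  have := le_Ex (P := g1) Iq Ie.
  rewrite Ex_normal_exp// (ExB Ic (itgZ (k / 2) I1)) Ex_cst (ExZ _ I1); apply => x.
  rewrite (le_trans _ (expR_ge1Dx _))// expr1 le_eqVlt; apply/orP; left; apply/eqP.
  by rewrite -/k; ring.
have := le_Ex (P := g1) Ie (itgD Iq (itgZ (k ^+ 2 / 8) I2)).
rewrite Ex_normal_exp// (ExD Iq (itgZ (k ^+ 2 / 8) I2)) (ExZ _ I2).
rewrite (ExB Ic (itgZ (k / 2) I1)) Ex_cst (ExZ _ I1); apply => x.
have y0 : 0 <= k * (x : R) ^+ 2 / 2 by rewrite divr_ge0// mulr_ge0// sqr_ge0.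
have := expRN_le2 y0; rewrite -/k !mulNr => /le_trans; apply.
by rewrite le_eqVlt; apply/orP; left; apply/eqP; field.
Qed.

Let m4_ge0 : 0 <= m4.
Proof. by apply: Ex_ge0 => x; apply: exprn_ge0; exact: sqr_ge0. Qed.

Let m2_ge0 : 0 <= m2.
Proof. by apply: Ex_ge0 => x; apply: exprn_ge0; exact: sqr_ge0. Qed.

Let kE (s : R) : 0 < s -> s ^- 2 - 1 = (1 - s) * (1 + s) / s ^+ 2.
Proof. by move=> s0; field; rewrite gt_eqF. Qed.

Let m2_ge1 : 1 <= m2.
Proof.
have h (s : R) : 0 < s -> s < 1 -> s ^+ 2 <= m2.
  move=> s0 s1; have [+ _] := taylor s0 (ltW s1).
  rewrite kE// lerBlDl -lerBlDr => H.
  have : (1 - s) * s ^+ 2 <= (1 - s) * m2; last by rewrite ler_pM2l ?subr_gt0.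
  have : (1 - s) * s ^+ 2 <= (1 - s) * (1 + s) / 2 * m2.
    rewrite (le_trans (ler_wpM2r (sqr_ge0 s) H))// le_eqVlt; apply/orP; left.
    by apply/eqP; field; rewrite gt_eqF.
  have := mulr_ge0 (sqr_ge0 (1 - s)) m2_ge0; lra.
rewrite leNgt; apply/negP => m21.
have := h ((1 + m2) / 2); have := m2_ge0; nra.
Qed.

Let m2_le1 : m2 <= 1.
Proof.
have h (s : R) : 2^-1 <= s -> s < 1 -> m2 <= 1 + 8 * (1 - s) * m4.
  move=> s2 s1; have s0 : 0 < s by lra.
  have [_] := taylor s0 (ltW s1); rewrite kE// => H.
  have H2 : (1 + s) / (2 * s ^+ 2) * m2 <= 1 + (1 - s) * (1 + s) ^+ 2 / (8 * s ^+ 4) * m4.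
    rewrite -(@ler_pM2l _ (1 - s)) ?subr_gt0// -subr_ge0.
    move: H; rewrite -subr_ge0 => /le_trans; apply; rewrite le_eqVlt; apply/orP; left.
    by apply/eqP; field; rewrite gt_eqF.
  have H3 : m2 <= (1 + s) / (2 * s ^+ 2) * m2.
    by rewrite ler_peMl// ler_pdivlMr ?mulr_gt0 ?exprn_gt0//; nra.
  apply: (le_trans H3); apply: (le_trans H2); rewrite lerD2l ler_wpM2r//.
  rewrite ler_pdivrMr ?mulr_gt0 ?exprn_gt0//.
  have s4 : 16^-1 <= s ^+ 4.
    have -> : 16^-1 = 2^-1 ^+ 4 :> R by rewrite exprVn; congr (_^-1); ring.
    by apply: lerXn2r; rewrite ?nnegrE// ltW.
  have : (1 + s) ^+ 2 <= 4 by nra.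
  have : 0 < 1 - s by lra.
  move: (s ^+ 4) ((1 + s) ^+ 2) s4 => a b; nra.
rewrite leNgt; apply/negP => m21.
pose d := (m2 - 1) / (16 * (m4 + m2)).
have den : 0 < 16 * (m4 + m2) by have := m4_ge0; have := m2_ge1; nra.
have d0 : 0 < d by rewrite divr_gt0// subr_gt0.
have d1 : d <= 2^-1 by rewrite ler_pdivrMr//; have := m4_ge0; nra.
have : m2 <= 1 + 8 * (1 - (1 - d)) * m4 by apply: h; lra.
have -> : 8 * (1 - (1 - d)) * m4 = (m2 - 1) * (m4 / (m4 + m2)) / 2.
  by rewrite /d; field; rewrite gt_eqF//; have := m4_ge0; have := m2_ge1; nra.
have : m4 / (m4 + m2) <= 1.
  by rewrite ler_pdivrMr; have := m4_ge0; have := m2_ge1; nra.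
move: (m4 / _) => q; nra.
Qed.

Lemma Ex_normal_sqr : Ex g1 (fun x : TR => (x ^+ 2) ^+ 1) = 1.
Proof. by apply/eqP; rewrite eq_le m2_le1 m2_ge1. Qed.

(** The second-order Taylor bound as s tends to 1, the first-order terms being
matched by the second moment. *)
Lemma Ex_normal_pow4_ge : 3 <= Ex g1 (fun x : TR => (x ^+ 2) ^+ 2).
Proof.
rewrite -/m4; have h (s : R) : 0 < s -> s < 1 -> 3 * s ^+ 3 <= m4.
  move=> s0 s1; have [_] := taylor s0 (ltW s1).
  rewrite /m2 Ex_normal_sqr mulr1 kE// => H.
  have H2 : 4 * s ^+ 2 * (1 + 2 * s) <= (1 + s) ^+ 2 * m4.
    rewrite -(@ler_pM2l _ ((1 - s) ^+ 2 / (8 * s ^+ 4))); last first.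
      by rewrite divr_gt0 ?mulr_gt0 ?exprn_gt0// subr_gt0.
    rewrite -subr_ge0; move: H; rewrite -subr_ge0 => /le_trans; apply.
    by rewrite le_eqVlt; apply/orP; left; apply/eqP; field; rewrite gt_eqF.
  have H3 : (1 + s) ^+ 2 * m4 <= 4 * m4 by rewrite ler_wpM2r//; nra.
  have : 4 * (3 * s ^+ 3) <= 4 * m4; last by rewrite ler_pM2l.
  apply: le_trans H3; apply: le_trans H2.
  have -> : 4 * (3 * s ^+ 3) = 4 * s ^+ 2 * (3 * s) by ring.
  by rewrite ler_wpM2l ?mulr_ge0 ?sqr_ge0//; lra.
rewrite leNgt; apply/negP => m43.
pose q := m4 / 3; have mq : m4 = 3 * q by rewrite /q; field.
have q0 : 0 <= q by rewrite divr_ge0.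
have q1 : q < 1 by move: m43; rewrite mq; lra.
have := h (1 - (1 - q) / 6); rewrite mq => H.
have {}H : 3 * (1 - (1 - q) / 6) ^+ 3 <= 3 * q by apply: H; lra.
set t := (1 - q) / 6 in H; have tq : q = 1 - 6 * t by rewrite /t; field.
have t0 : 0 < t by rewrite /t; lra.
have t1 : t <= 1 by rewrite /t; lra.
have : (1 - t) ^+ 3 = 1 - 3 * t + t ^+ 2 * (3 - t) by ring.
by rewrite tq in H; have := sqr_ge0 t; nra.
Qed.
End values.

End gaussian_moments.

Section pushforward_integrable.
Context {R : realType} d1 d2 (T1 : measurableType d1) (T2 : measurableType d2).
Context (P1 : probability T1 R) (P2 : probability T2 R) (h : T1 -> T2).
Hypothesis mh : measurable_fun [set: T1] h.
Hypothesis hP : forall f, bm f -> Ex P2 f = Ex P1 (fun x => f (h x)).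

Lemma Ex_indic d (T : measurableType d) (P : probability T R) A : measurable A ->
  (Ex P (\1_A))%:E = P A.
Proof.
move=> mA; rewrite /Ex /Rintegral integral_indic// setIT fineK//.
by rewrite fin_num_measure.
Qed.

(** The hypothesis on bounded functions, tested on indicators, says that h maps P1
to P2. *)
Lemma same_law A : measurable A -> P2 A = P1 (h @^-1` A).
Proof.
move=> mA; have mA' : measurable (h @^-1` A) by rewrite -[X in measurable X]setTI; exact: mh.
rewrite -!Ex_indic// hP//.
by split; [exact: measurable_indic|exists 1 => x; rewrite indicE; case: (_ \in _); rewrite ?normr1 ?normr0].
Qed.

Lemma itg_pull (f : T2 -> R) : measurable_fun [set: T2] f -> itg P2 f ->
  itg P1 (fun x => f (h x)).
Proof.
move=> mf /integrableP[_ If]; apply/integrableP; split.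
  by apply/measurable_EFinP; exact: measurableT_comp mf mh.
apply: le_lt_trans If.
rewrite [leRHS](eq_measure_integral (pushforward P1 h)); last first.
  by move=> A mA _; exact: same_law.
rewrite ge0_integral_pushforward//= ?preimage_setT//.
by apply/measurable_EFinP; exact: measurableT_comp.
Qed.

Lemma Ex_pull (f : T2 -> R) : measurable_fun [set: T2] f -> itg P2 f ->
  Ex P2 f = Ex P1 (fun x => f (h x)).
Proof.
move=> mf If; rewrite /Ex /Rintegral; congr fine.
rewrite [LHS](eq_measure_integral (pushforward P1 h)); last first.
  by move=> A mA _; exact: same_law.
rewrite integral_pushforward//= ?preimage_setT//.
  exact/measurable_EFinP.
exact: itg_pull.
Qed.

End pushforward_integrable.

Lemma Ex_fubini_itg {R : realType} d1 d2 (T1 : measurableType d1)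
    (T2 : measurableType d2) (P1 : probability T1 R) (P2 : probability T2 R)
    (f : T1 * T2 -> R) :
  itg (prod_prob P1 P2) f -> (forall x, itg P2 (fun y => f (x, y))) ->
  Ex (prod_prob P1 P2) f = Ex P1 (fun x => Ex P2 (fun y => f (x, y))).
Proof.
move=> If Is; rewrite /Ex /Rintegral; congr fine.
rewrite -[LHS](integral12_prod_meas1 If); apply: eq_integral => x _.
by rewrite fineK//; apply: integrable_fin_num => //; exact: Is.
Qed.

Section gaussian_vector.
Context {R : realType}.
Local Notation TR := (measurableTypeR R).
Local Notation tupleR n := (n.-tuple (measurableTypeR R)).
Local Notation g1 := (@normal_prob R 0 1).
Local Notation gauss := (@gauss_tuple R).

Lemma Ex_marginal n (i : 'I_n) (f : TR -> R) : bm f ->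
  Ex g1 f = Ex (gauss n) (fun t => f (tnth t i)).
Proof.
move=> bf; elim: n i => [[]//|n IH] i.
rewrite (Ex_gaussS (f := fun t => f (tnth t i))); last first.
  by apply: (bm_comp bf); exact: measurable_tnth.
case: (unliftP ord0 i) => [j ->|->].
  rewrite -[LHS](Ex_cst g1); apply: eq_Ex => x; rewrite (IH j).
  by apply: eq_Ex => t; rewrite tnthS.
by apply: eq_Ex => x; rewrite -[LHS](Ex_cst (gauss n)).
Qed.

Lemma itg_marginal n (i : 'I_n) (f : TR -> R) : measurable_fun [set: TR] f ->
  itg g1 f -> itg (gauss n) (fun t => f (tnth t i)).
Proof.
move=> mf If; apply: (itg_pull (P2 := g1)) => //; first exact: measurable_tnth.
exact: Ex_marginal.
Qed.

Lemma Ex_marginal_itg n (i : 'I_n) (f : TR -> R) : measurable_fun [set: TR] f ->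
  itg g1 f -> Ex (gauss n) (fun t => f (tnth t i)) = Ex g1 f.
Proof.
move=> mf If; apply/esym/(Ex_pull (P2 := g1)) => //; first exact: measurable_tnth.
exact: Ex_marginal.
Qed.

Definition dot n (p : 'I_n -> R) (t : tupleR n) : R := \sum_(i < n) p i * tnth t i.

Lemma measurable_dot n p : measurable_fun [set: tupleR n] (@dot n p).
Proof.
apply: measurable_sum => i; apply: measurable_funM => //.
exact: measurable_tnth.
Qed.

Lemma dot_cons n p (x : TR) (t : tupleR n) :
  dot p [tuple of x :: t] = p ord0 * x + dot (fun i => p (lift ord0 i)) t.
Proof.
by rewrite /dot big_ord_recl tnth0; congr (_ + _); apply: eq_bigr => i _; rewrite tnthS.
Qed.

Lemma itg_tnth n (i : 'I_n) : itg (gauss n) (fun t => tnth t i).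
Proof. exact: (itg_marginal i (f := fun x => x) _ itg_normal_id). Qed.

Lemma itg_dot n (p : 'I_n -> R) : itg (gauss n) (dot p).
Proof. by apply: itg_sum => i; apply: itgZ; exact: itg_tnth. Qed.

Lemma itg_tnth2 n (i : 'I_n) : itg (gauss n) (fun t => tnth t i ^+ 2).
Proof.
apply: (itg_marginal i (f := fun x : TR => (x ^+ 2) ^+ 1) _ (itg_normalX (k := 1) isT)).
by apply: measurable_funX; exact: measurable_funX.
Qed.

Lemma sqr_dot_le n (p : 'I_n -> R) (t : 'I_n -> R) :
  (\sum_(i < n) p i * t i) ^+ 2 <= (\sum_(i < n) p i ^+ 2) * \sum_(i < n) t i ^+ 2.
Proof.
pose v : 'rV[R]_n := \row_i p i; pose w : 'rV[R]_n := \row_i t i.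
have vE : norm2 v ^+ 2 = \sum_(i < n) p i ^+ 2.
  by rewrite sqr_norm2; apply: eq_bigr => i _; rewrite mxE.
have wE : norm2 w ^+ 2 = \sum_(i < n) t i ^+ 2.
  by rewrite sqr_norm2; apply: eq_bigr => i _; rewrite mxE.
have E : \sum_(i < n) v ord0 i * w ord0 i = \sum_(i < n) p i * t i.
  by apply: eq_bigr => i _; rewrite !mxE.
have EN : \sum_(i < n) (- v) ord0 i * w ord0 i = - \sum_(i < n) p i * t i.
  by rewrite -sumrN; apply: eq_bigr => i _; rewrite !mxE mulNr.
have := dot_le_norm2 v w; have := dot_le_norm2 (- v) w.
rewrite E EN norm2N -vE -wE -exprMn => h1 h2.
rewrite -(real_normK (num_real (\sum_(i < n) p i * t i))).
rewrite lerXn2r ?nnegrE ?mulr_ge0 ?norm2_ge0//.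
by rewrite ler_norml h2 andbT lerNl.
Qed.

Lemma itg_dot2 n (p : 'I_n -> R) : itg (gauss n) (fun t => dot p t ^+ 2).
Proof.
have I := itgZ (\sum_(i < n) p i ^+ 2) (itg_sum (index_enum 'I_n) (@itg_tnth2 n)).
apply: (itg_dom _ I); first by apply: measurable_funX; exact: measurable_dot.
move=> t; rewrite ger0_norm ?sqr_ge0//.
exact: sqr_dot_le.
Qed.

Lemma Ex_normal_id : Ex g1 (fun x : TR => x) = 0.
Proof.
have mN : measurable_fun [set: TR] (fun x : TR => - x : TR) by exact: measurable_funN.
suff : Ex g1 (fun x : TR => x) = Ex g1 (fun x : TR => - x).
  by rewrite (ExN itg_normal_id); lra.
apply: (Ex_pull (P2 := g1) mN) => //; last exact: itg_normal_id.
move=> f bf.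
have := Ex_normal_rot (f := fun q => f q.1) (c := 0) (s := -1).
move=> /(_ (bm_comp bf measurable_fst)) /=; rewrite expr0n sqrrN expr1n add0r oppr_eq0 oner_eq0.
move=> /(_ erefl isT) H.
transitivity (Ex g1 (fun x : TR => Ex g1 (fun _ : TR => f x))).
  by apply: eq_Ex => x; rewrite Ex_cst.
rewrite -H -[RHS](Ex_cst g1); apply: eq_Ex => x; apply: eq_Ex => y.
by rewrite mul0r add0r mulN1r.
Qed.

Lemma Ex_dot n (p : 'I_n -> R) : Ex (gauss n) (dot p) = 0.
Proof.
rewrite /dot Ex_sum => [|i]; last by apply: itgZ; exact: itg_tnth.
rewrite big1// => i _; rewrite ExZ; last exact: itg_tnth.
rewrite (@Ex_marginal_itg n i (fun x => x))//; last exact: itg_normal_id.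
by rewrite Ex_normal_id mulr0.
Qed.

Lemma Ex_gaussS_itg n (f : tupleR n.+1 -> R) :
  measurable_fun [set: tupleR n.+1] f -> itg (gauss n.+1) f ->
  (forall x : TR, itg (gauss n) (fun t => f [tuple of x :: t])) ->
  Ex (gauss n.+1) f = Ex g1 (fun x => Ex (gauss n) (fun t => f [tuple of x :: t])).
Proof.
move=> mf If Is.
have hP (h : tupleR n.+1 -> R) : bm h -> Ex (gauss n.+1) h =
    Ex (prod_prob g1 (gauss n)) (fun p => h [tuple of p.1 :: p.2]).
  by move=> bh; apply: (Ex_pushforward (@measurable_tuple_cons R n)).
rewrite (Ex_pull (@measurable_tuple_cons R n) hP mf If).
apply: Ex_fubini_itg => //.
exact: (itg_pull (@measurable_tuple_cons R n) hP mf If).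
Qed.

Lemma Ex_dot2 n (p : 'I_n -> R) :
  Ex (gauss n) (fun t => dot p t ^+ 2) = \sum_(i < n) p i ^+ 2.
Proof.
elim: n p => [|n IH] p.
  rewrite big_ord0 -[RHS](Ex_cst (gauss 0)); apply: eq_Ex => t.
  by rewrite /dot big_ord0 expr0n.
pose p' i := p (lift ord0 i).
have I0 (x : TR) : itg (gauss n) (fun t => 2 * (p ord0 * x) * dot p' t).
  by apply: itgZ; exact: itg_dot.
have Ic (x : TR) : itg (gauss n) (fun t => (p ord0 * x) ^+ 2) by exact: itg_cst.
have Is (x : TR) : (fun t : tupleR n => dot p [tuple of x :: t] ^+ 2) =
    (fun t => (p ord0 * x) ^+ 2 + 2 * (p ord0 * x) * dot p' t + dot p' t ^+ 2).
  by apply/funext => t; rewrite dot_cons; ring.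
rewrite Ex_gaussS_itg; last 3 first.
- by apply: measurable_funX; exact: measurable_dot.
- exact: itg_dot2.
- by move=> x; rewrite Is; apply: itgD; [exact: itgD|exact: itg_dot2].
transitivity (Ex g1 (fun x : TR => p ord0 ^+ 2 * (x ^+ 2) ^+ 1 + \sum_(i < n) p' i ^+ 2)).
  apply: eq_Ex => x; rewrite Is (ExD (itgD (Ic x) (I0 x)) (itg_dot2 _)).
  rewrite (ExD (Ic x) (I0 x)) Ex_cst ExZ; last exact: itg_dot.
  by rewrite Ex_dot mulr0 addr0 IH expr1 exprMn.
have I1 := itg_normalX (R := R) (k := 1) isT.
rewrite (ExD (itgZ _ I1) (itg_cst _ _)) (ExZ _ I1) Ex_cst Ex_normal_sqr mulr1.
by rewrite big_ord_recl.
Qed.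

Definition sqn n (t : tupleR n) : R := \sum_(i < n) tnth t i ^+ 2.

Lemma sqn_ge0 n (t : tupleR n) : 0 <= sqn t.
Proof. by apply: sumr_ge0 => i _; exact: sqr_ge0. Qed.

Lemma measurable_sqn n : measurable_fun [set: tupleR n] (@sqn n).
Proof.
apply: measurable_sum => i; apply: measurable_funX; exact: measurable_tnth.
Qed.

Lemma itg_sqn2 n : itg (gauss n) (fun t => sqn t ^+ 2).
Proof.
have I4 (i : 'I_n) : itg (gauss n) (fun t => (tnth t i ^+ 2) ^+ 2).
  apply: (itg_marginal i (f := fun x : TR => (x ^+ 2) ^+ 2) _ (itg_normalX (k := 2) isT)).
  by apply: measurable_funX; exact: measurable_funX.
have I := itgZ (\sum_(i < n) 1 ^+ 2) (itg_sum (index_enum 'I_n) I4).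
apply: (itg_dom _ I); first by apply: measurable_funX; exact: measurable_sqn.
move=> t; rewrite ger0_norm ?sqr_ge0//.
have := sqr_dot_le (fun=> 1) (fun i : 'I_n => tnth t i ^+ 2).
by under eq_bigr do rewrite mul1r.
Qed.

Definition oppt n (t : tupleR n) : tupleR n := [tuple (- tnth t i : TR) | i < n].

Lemma tnth_oppt n (t : tupleR n) i : tnth (oppt t) i = - tnth t i.
Proof. exact: tnth_mktuple. Qed.

Lemma measurable_oppt n : measurable_fun [set: tupleR n] (@oppt n).
Proof.
apply/measurable_fun_tnthP => i.
rewrite (_ : _ \o _ = (fun t : tupleR n => - tnth t i)).
  by apply: measurable_funN; exact: measurable_tnth.
by apply/funext => t /=; rewrite tnth_oppt.
Qed.

Lemma Ex_oppt n (f : tupleR n -> R) : bm f ->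
  Ex (gauss n) (fun t => f (oppt t)) = Ex (gauss n) f.
Proof.
move=> bf.
have := Ex_gauss_rot (n := n) (f := fun q => f q.1) (c := 0) (s := -1).
move=> /(_ (bm_comp bf measurable_fst)) /=; rewrite expr0n sqrrN expr1n add0r oppr_eq0 oner_eq0.
move=> /(_ erefl isT) H.
transitivity (Ex (gauss n) (fun x => Ex (gauss n) (fun _ : tupleR n => f x))); last first.
  by apply: eq_Ex => x; rewrite Ex_cst.
rewrite -H -[LHS](Ex_cst (gauss n)); apply: eq_Ex => x; apply: eq_Ex => y.
congr f; apply: eq_from_tnth => i.
by rewrite tnth_oppt tnth_comb mul0r add0r mulN1r.
Qed.

Definition catt m n (p : tupleR m * tupleR n) : tupleR (m + n) :=
  [tuple of p.1 ++ p.2].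

Lemma measurable_catt m n : measurable_fun [set: tupleR m * tupleR n] (@catt m n).
Proof.
apply/measurable_fun_tnthP => i; case: (split_ordP i) => j ->.
  rewrite (_ : _ \o _ = (fun p => tnth p.1 j)); last first.
    by apply/funext => p /=; rewrite /catt tnth_lshift.
  exact: measurableT_comp (measurable_tnth j) measurable_fst.
rewrite (_ : _ \o _ = (fun p => tnth p.2 j)); last first.
  by apply/funext => p /=; rewrite /catt tnth_rshift.
exact: measurableT_comp (measurable_tnth j) measurable_snd.
Qed.

Lemma Ex_catt m n (f : tupleR (m + n) -> R) : bm f ->
  Ex (gauss (m + n)) f =
  Ex (gauss m) (fun x => Ex (gauss n) (fun y => f (catt (x, y)))).
Proof.
elim: m f => [|m IH] f bf.
  rewrite -[LHS](Ex_cst (gauss 0)); apply: eq_Ex => x; apply: eq_Ex => y.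
  by congr f; apply/val_inj; rewrite /= (tuple0 x).
have bfc : bm (fun p => f (@catt m.+1 n p)) by exact: bm_comp bf (@measurable_catt m.+1 n).
rewrite (Ex_gaussS (n := m) (bm_Exl (gauss n) bfc)).
rewrite (Ex_gaussS (n := m + n) bf); apply: eq_Ex => x.
have bx : bm (fun t : tupleR (m + n) => f [tuple of x :: t]).
  have bf1 : @bm R _ (tupleR (m + n).+1) f by [].
  exact: bm_sectl x (bm_comp bf1 (@measurable_tuple_cons R (m + n))).
rewrite (IH _ bx); apply: eq_Ex => t; apply: eq_Ex => y.
by congr f; apply/val_inj.
Qed.

(** Multiplication by i on C^n = R^n x R^n, real parts first. *)
Definition rotJ n (t : tupleR (n + n)) : tupleR (n + n) :=
  catt ([tuple (- tnth t (rshift n i) : TR) | i < n],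
        [tuple (tnth t (lshift n i) : TR) | i < n]).

Lemma tnth_rotJl n (t : tupleR (n + n)) i : tnth (rotJ t) (lshift n i) = - tnth t (rshift n i).
Proof. by rewrite /rotJ /catt tnth_lshift tnth_mktuple. Qed.

Lemma tnth_rotJr n (t : tupleR (n + n)) i : tnth (rotJ t) (rshift n i) = tnth t (lshift n i).
Proof. by rewrite /rotJ /catt tnth_rshift tnth_mktuple. Qed.

Lemma measurable_rotJ n : measurable_fun [set: tupleR (n + n)] (@rotJ n).
Proof.
apply/measurable_fun_tnthP => i; case: (split_ordP i) => j ->.
  rewrite (_ : _ \o _ = (fun t : tupleR (n + n) => - tnth t (rshift n j))).
    by apply: measurable_funN; exact: measurable_tnth.
  by apply/funext => t /=; rewrite tnth_rotJl.
rewrite (_ : _ \o _ = (fun t : tupleR (n + n) => tnth t (lshift n j))).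
  exact: measurable_tnth.
by apply/funext => t /=; rewrite tnth_rotJr.
Qed.

(** Multiplication by i is the rotation by a right angle in each plane spanned by
a real part and the corresponding imaginary part. *)
Lemma Ex_rotJ n (f : tupleR (n + n) -> R) : bm f ->
  Ex (gauss (n + n)) (fun t => f (rotJ t)) = Ex (gauss (n + n)) f.
Proof.
move=> bf; rewrite !Ex_catt//; last exact: bm_comp bf (@measurable_rotJ n).
have bfc : bm (fun p => f (@catt n n p)) by exact: bm_comp bf (@measurable_catt n n).
have := Ex_gauss_rot (c := 0) (s := -1) bfc.
rewrite expr0n sqrrN expr1n add0r oppr_eq0 oner_eq0 => /(_ erefl isT) <-.
apply: eq_Ex => x; apply: eq_Ex => y; congr f; apply: eq_from_tnth => i.
case: (split_ordP i) => j ->.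
  by rewrite tnth_rotJl /catt !tnth_lshift tnth_rshift tnth_comb mul0r add0r mulN1r.
by rewrite tnth_rotJr /catt tnth_lshift !tnth_rshift tnth_comb opprK mul1r mul0r addr0.
Qed.

End gaussian_vector.

(** * The stationary process of rotations *)

Ltac bm_tac := repeat first [assumption | exact: bm_cst | apply: bmD | apply: bmN
  | apply: bmM | apply: bmX].

Section stationary.
Context {R : realType} (n : nat).
Local Notation T := (n.-tuple (measurableTypeR R)).
Local Notation gauss := (@gauss_tuple R n).

Local Notation PP := (prod_prob gauss gauss).
Local Notation E := (Ex PP).

(** For a pair p of independent Gaussian vectors, t |-> rot t p is stationary: its
law does not depend on t. *)
Definition rot (t : R) (p : T * T) : T * T :=
  (comb (cos t) (sin t) p.1 p.2, comb (- sin t) (cos t) p.1 p.2).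

Lemma measurable_rotT t : measurable_fun [set: T * T] (rot t).
Proof. exact: measurable_rot. Qed.

Lemma rotD a b p : rot a (rot b p) = rot (a + b) p.
Proof.
by congr pair; apply: eq_from_tnth => i; rewrite !tnth_comb cosD sinD; ring.
Qed.

Lemma rot0 p : rot 0 p = p.
Proof.
case: p => x y; congr pair; apply: eq_from_tnth => i; rewrite !tnth_comb /= cos0 sin0; ring.
Qed.

Lemma bm_rot t (g : T * T -> R) : bm g -> bm (fun p => g (rot t p)).
Proof. by move=> bg; exact: bm_comp bg (measurable_rotT t). Qed.

(** The rotation by shears excludes sin t = 0; such an angle is the sum of two
others. *)
Lemma E_rot t (g : T * T -> R) : bm g -> E (fun p => g (rot t p)) = E g.
Proof.
have H u (h : T * T -> R) : sin u != 0 -> bm h -> E (fun p => h (rot u p)) = E h.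
  move=> u0 bh; rewrite (Ex_fubini1 gauss gauss bh) (Ex_fubini1 gauss gauss (bm_rot u bh)).
  exact: Ex_gauss_rot bh (cos2Dsin2 u) u0.
move=> bg; have [t0|t0] := eqVneq (sin t) 0; last exact: H.
have c0 : cos t != 0.
  by apply/eqP => c0; have := cos2Dsin2 t; rewrite t0 c0 expr0n addr0 => /eqP; rewrite eq_sym oner_eq0.
rewrite -(H (pi / 2) g)//; last by rewrite sin_pihalf oner_neq0.
rewrite -(H (t - pi / 2) (fun p => g (rot (pi / 2) p))); last exact: bm_rot.
- by apply: eq_Ex => p; rewrite rotD addrC subrK.
- by rewrite sinB sin_pihalf cos_pihalf mulr0 mulr1 sub0r oppr_eq0.
Qed.

Definition cov (G : T * T -> R) t := E (fun p => G p * G (rot t p)).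

Lemma covE G a b : bm G -> E (fun p => G (rot a p) * G (rot b p)) = cov G (b - a).
Proof.
move=> bG; apply: etrans (E_rot a (bmM bG (bm_rot (b - a) bG))).
by apply: eq_Ex => p; rewrite rotD subrK.
Qed.

Lemma E_incr G a b : bm G ->
  E (fun p => (G (rot a p) - G (rot b p)) ^+ 2) = 2 * (cov G 0 - cov G (b - a)).
Proof.
move=> bG; have ba := bm_rot a bG; have bb := bm_rot b bG.
transitivity (E (fun p => G (rot a p) * G (rot a p) - 2 * (G (rot a p) * G (rot b p)) + G (rot b p) * G (rot b p))).
  by apply: eq_Ex => p; ring.
rewrite ExD; try (apply: bm_itg; bm_tac).
rewrite ExB; try (apply: bm_itg; bm_tac).
rewrite ExZ; last by apply: bm_itg; bm_tac.
by rewrite !covE// !subrr; ring.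
Qed.

Lemma covN G t : bm G -> cov G (- t) = cov G t.
Proof.
move=> bG; apply: etrans (esym (E_rot t (bmM bG (bm_rot (- t) bG)))) _.
by apply: eq_Ex => p; rewrite rotD addNr rot0 mulrC.
Qed.

(** The vectors G_0, G_h, G_2h of L^2 have equal norms and equal consecutive angles; the
triangle inequality for angles says that the angle between G_0 and G_2h is at
most twice the angle between G_0 and G_h.  In terms of cosines this is the
Cauchy-Schwarz inequality for G_h and G_0 + G_2h. *)
Lemma cov_double G h : bm G ->
  2 * cov G h ^+ 2 <= cov G 0 * (cov G 0 + cov G (2 * h)).
Proof.
move=> bG; have b1 := bm_rot h bG; have b2 := bm_rot (2 * h) bG; have b0 := bm_rot 0 bG.
have := Ex_CS PP b1 (bmD b0 b2).
rewrite (_ : Ex PP (fun p => G (rot h p) * _) = 2 * cov G h); last first.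
  transitivity (E (fun p => G (rot h p) * G (rot 0 p) + G (rot h p) * G (rot (2 * h) p))).
    by apply: eq_Ex => p; ring.
  rewrite ExD; try (apply: bm_itg; bm_tac).
  rewrite !covE// sub0r covN// (_ : 2 * h - h = h); by ring.
rewrite (_ : Ex PP (fun p => G (rot h p) ^+ 2) = cov G 0); last first.
  by rewrite -(subrr h) -covE//; apply: eq_Ex => p; ring.
rewrite (_ : Ex PP _ = 2 * (cov G 0 + cov G (2 * h))); last first.
  transitivity (E (fun p => G (rot 0 p) * G (rot 0 p) + 2 * (G (rot 0 p) * G (rot (2 * h) p)) +
    G (rot (2 * h) p) * G (rot (2 * h) p))).
    by apply: eq_Ex => p; ring.
  rewrite ExD; try (apply: bm_itg; bm_tac).
  rewrite ExD; try (apply: bm_itg; bm_tac).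
  rewrite ExZ; last by apply: bm_itg; bm_tac.
  by rewrite !covE// !subrr subr0; ring.
by rewrite exprMn; nra.
Qed.

Lemma cov0_ge0 G : bm G -> 0 <= cov G 0.
Proof. by move=> bG; apply: Ex_ge0 => p; rewrite rot0 -expr2 sqr_ge0. Qed.

(** A process that changes sign after pi/2 has G_0 orthogonal to G_(pi/4).  Halving
the angle repeatedly with [cov_double] gives that the angle between G_0 and
G_h is at least 2 h for every dyadic h: the process turns at least twice as fast
as the rotation, which is the spectral gap 2 of even functions. *)
Lemma cov_dyadic G m : bm G -> (forall p, G (rot (pi / 2) p) = - G p) ->
  cov G (pi / 2 ^+ m.+2) <= cov G 0 * cos (2 * (pi / 2 ^+ m.+2)).
Proof.
move=> bG anti; have c0 := cov0_ge0 bG.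
elim: m => [|m IH].
  have e4 : pi / 2 ^+ 2 = pi / 2 - pi / 2 ^+ 2 :> R by field.
  have : cov G (pi / 2 ^+ 2) = - cov G (pi / 2 ^+ 2).
    rewrite -{2}covN// {1}e4 /cov -ExN; last by apply: bm_itg; apply: bmM => //; exact: bm_rot.
    by apply: eq_Ex => p; rewrite -rotD anti mulrN.
  have -> : 2 * (pi / 2 ^+ 2) = pi / 2 :> R by field.
  by rewrite cos_pihalf mulr0; lra.
set h := pi / 2 ^+ m.+3.
have h2 : 2 * h = pi / 2 ^+ m.+2 by rewrite /h [2 ^+ m.+3]exprS; field; rewrite expf_neq0.
have h0 : 0 <= h by rewrite divr_ge0 ?pi_ge0 ?exprn_ge0.
have h2le : 2 * h <= pi / 2.
  rewrite h2 ler_pM2l ?pi_gt0// lef_pV2 ?posrE ?exprn_gt0//.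
  by rewrite exprS ler_peMr// exprn_ege1// ler1n.
have C0 : 0 <= cos (2 * h).
  apply: cos_ge0_pihalf; rewrite h2le andbT.
  by have := pi_ge0 R; lra.
have D := cov_double h bG.
have {}D : cov G h ^+ 2 <= (cov G 0 * cos (2 * h)) ^+ 2.
  have E2 : cos (2 * (2 * h)) = 2 * cos (2 * h) ^+ 2 - 1.
    by rewrite [2 * (2 * h)]mulr_natl cos_mulr2n -[_ ^+ 2 *+ 2]mulr_natl.
  rewrite -h2 E2 in IH.
  have := ler_wpM2l c0 IH; rewrite exprMn; nra.
rewrite leNgt; apply/negP => lt.
have : (cov G 0 * cos (2 * h)) ^+ 2 < cov G h ^+ 2.
  have r0 : 0 <= cov G 0 * cos (2 * h) by exact: mulr_ge0.
  by rewrite ltr_pXn2r// nnegrE ltW// (le_lt_trans r0 lt).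
by rewrite ltNge D.
Qed.

End stationary.

Ltac itg_tac := try (apply: bm_itg; bm_tac).

Section even_process.
Context {R : realType} (n : nat).
Local Notation T := (n.-tuple (measurableTypeR R)).
Local Notation gauss := (@gauss_tuple R n).
Local Notation PP := (prod_prob gauss gauss).
Local Notation E := (Ex PP).
Variables (F : T -> R) (m : nat).
Hypothesis bF : bm F.
Hypothesis Fopp : forall x, F (oppt x) = F x.

(** Half of the mean square of F x - F y for independent x and y; see
[cov_diff0]. *)
Definition variance_of := Ex gauss (fun x => F x ^+ 2) - Ex gauss F ^+ 2.
Local Notation VF := variance_of.
Local Notation h := (pi / 2 ^+ m.+3 : R).
Local Notation c := (cos h).
Local Notation s := (sin h).

Let G (p : T * T) := F p.1.
Let D (p : T * T) := F p.1 - F p.2.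
Let M (p : T * T) := F p.1 + F p.2.

Let bG : bm G. Proof. exact: bm_comp bF measurable_fst. Qed.
Let bG2 : bm (fun p : T * T => F p.2). Proof. exact: bm_comp bF measurable_snd. Qed.
Let bD : bm D. Proof. exact: bmB. Qed.
Let bM : bm M. Proof. exact: bmD. Qed.

Lemma rot_pihalf (p : T * T) : rot (pi / 2) p = (p.2, oppt p.1).
Proof.
rewrite /rot cos_pihalf sin_pihalf; congr pair; apply: eq_from_tnth => i.
  by rewrite tnth_comb; ring.
by rewrite tnth_comb tnth_oppt; ring.
Qed.

Let GE p : F p.2 = G (rot (pi / 2) p).
Proof. by rewrite rot_pihalf. Qed.

Let Danti p : D (rot (pi / 2) p) = - D p.
Proof. by rewrite /D rot_pihalf /= Fopp opprB. Qed.

Let U p := G (rot h p) - G p.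
Let e := E (fun p => U p ^+ 2).
Let eE : E (fun p => (G (rot h p) - G p) ^+ 2) = e. Proof. by []. Qed.
Let bU : bm U. Proof. by apply: bmB => //; exact: bm_rot. Qed.

Lemma cov_diff0 : cov D 0 = 2 * VF.
Proof.
have E1 : E (fun p : T * T => F p.1 ^+ 2) = Ex gauss (fun x => F x ^+ 2).
  rewrite Ex_fubini1/=; last exact: (bmX 2 bG).
  by apply: eq_Ex => x; rewrite Ex_cst.
have E2 : E (fun p : T * T => F p.2 ^+ 2) = Ex gauss (fun x => F x ^+ 2).
  rewrite Ex_fubini1/=; last exact: (bmX 2 bG2).
  by rewrite Ex_cst.
have E3 : E (fun p : T * T => F p.1 * F p.2) = Ex gauss F ^+ 2.
  rewrite Ex_fubini1/=; last exact: (bmM bG bG2).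
  rewrite expr2 -ExZ; last exact: bm_itg.
  apply: eq_Ex => x; rewrite ExZ; last exact: bm_itg.
  by rewrite mulrC.
transitivity (E (fun p : T * T => F p.1 ^+ 2 - 2 * (F p.1 * F p.2) + F p.2 ^+ 2)).
  by apply: eq_Ex => p; rewrite rot0 /D; ring.
have b12 := bmM bG bG2; have b1 := bmX 2 bG; have b2 := bmX 2 bG2.
rewrite (ExD (f := fun p => _ - _)); [|apply: bm_itg; apply: bmB => //; apply: bmM => //; exact: bm_cst|exact: bm_itg].
rewrite ExB; [|exact: bm_itg|apply: itgZ; exact: bm_itg].
rewrite ExZ; last exact: bm_itg.
by rewrite E1 E2 E3 /VF; ring.
Qed.

Let h2E : 2 * h = pi / 2 ^+ m.+2.
Proof. by rewrite [2 ^+ m.+3]exprS; field; rewrite expf_neq0. Qed.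

(** The lower bound on the increments of F_0 - F_(pi/2), which changes sign under
the quarter turn because F is even. *)
Lemma incr_diff_ge : 8 * VF * s ^+ 2 <= 2 * (cov D 0 - cov D h).
Proof.
have := cov_dyadic m.+1 bD Danti; rewrite cov_diff0.
rewrite [2 * h]mulr_natl cos_mulr2n cos2sin2 -[_ *+ 2]mulr_natl; lra.
Qed.

Lemma incr_diff2_ge : 32 * VF * (s ^+ 2 * c ^+ 2) <= 2 * (cov D 0 - cov D (2 * h)).
Proof.
have := cov_dyadic m bD Danti; rewrite cov_diff0 -h2E.
have c4 : cos (2 * (2 * h)) = 1 - 2 * sin (2 * h) ^+ 2.
  by rewrite [2 * (2 * h)]mulr_natl cos_mulr2n cos2sin2; ring.
have s2 : sin (2 * h) = 2 * (c * s).
  by rewrite [2 * h]mulr_natl sin_mulr2n; ring.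
by rewrite c4 s2 !exprMn; lra.
Qed.

(** Parallelogram identity for F_0 and F_(pi/2), with stationarity. *)
Let split_incr (a : R) :
  E (fun p => (M (rot a p) - M p) ^+ 2) + E (fun p => (D (rot a p) - D p) ^+ 2) =
  4 * E (fun p => (G (rot a p) - G p) ^+ 2).
Proof.
have bg := bm_rot a bG; have bV : bm (fun p => G (rot a p) - G p) by exact: bmB.
have bV2 := bmX 2 bV; have bVr := bm_rot (pi / 2) bV2.
rewrite -ExD; [|apply: bm_itg; apply: bmX; apply: bmB => //; exact: bm_rot
               |apply: bm_itg; apply: bmX; apply: bmB => //; exact: bm_rot].
have Er : E (fun p => (G (rot a (rot (pi / 2) p)) - G (rot (pi / 2) p)) ^+ 2) =
   E (fun p => (G (rot a p) - G p) ^+ 2) by exact: (E_rot (pi / 2) bV2).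
transitivity (E (fun p => 2 * (G (rot a p) - G p) ^+ 2 +
   2 * (G (rot a (rot (pi / 2) p)) - G (rot (pi / 2) p)) ^+ 2)); last first.
  rewrite ExD; [|apply: itgZ; exact: bm_itg|apply: itgZ; exact: bm_itg].
  by rewrite !ExZ; [rewrite Er; ring|exact: bm_itg|exact: bm_itg].
apply: eq_Ex => p; rewrite /M /D GE (GE p) !rotD (addrC (pi / 2)).
by rewrite -/(G p) -/(G (rot a p)); ring.
Qed.

Let incr0 (H : T * T -> R) (a : R) : bm H ->
  E (fun p => (H (rot a p) - H p) ^+ 2) = 2 * (cov H 0 - cov H a).
Proof.
move=> bH; have := E_incr a 0 bH; rewrite sub0r covN// => <-.
by apply: eq_Ex => p; rewrite rot0.
Qed.

(** What remains of the energy e after the lower bound on the increments of the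
difference: in the near-equality case the sum F_0 + F_(pi/2) is almost constant
in t, as it is for quadratic forms. *)
Lemma incr_sum_le : 2 * (cov M 0 - cov M h) <= 4 * e - 8 * VF * s ^+ 2.
Proof.
have := split_incr h; rewrite eE (incr0 _ bM) (incr0 _ bD).
by have := incr_diff_ge; lra.
Qed.

Let incr_ge0 (H : T * T -> R) (a : R) : bm H -> 0 <= 2 * (cov H 0 - cov H a).
Proof. by move=> bH; rewrite -incr0//; apply: Ex_ge0 => p; exact: sqr_ge0. Qed.

Lemma incr_diff_le : 2 * (cov D 0 - cov D h) <= 4 * e.
Proof.
have := split_incr h; rewrite eE (incr0 _ bM) (incr0 _ bD).
by have := incr_ge0 h bM; lra.
Qed.

(** In the near-equality case the second difference of F_t is small.  It is half
the sum of those of F_0 - F_(pi/2) and F_0 + F_(pi/2); for the former the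
second difference is the excess of four times the squared increment at h over
the squared increment at 2 h, for the latter already the increments are small. *)
Lemma second_diff_le :
  E (fun p => (G (rot h p) + G (rot (- h) p) - 2 * G p) ^+ 2) <=
  18 * e - 24 * VF * (s ^+ 2 * c ^+ 2) - 12 * VF * s ^+ 2.
Proof.
pose A p := D (rot h p) - D p; pose B p := D (rot (- h) p) - D p.
pose K p := M (rot h p) - M p; pose K' p := M (rot (- h) p) - M p.
have bA : bm A by apply: bmB => //; exact: bm_rot.
have bB : bm B by apply: bmB => //; exact: bm_rot.
have bK : bm K by apply: bmB => //; exact: bm_rot.
have bK' : bm K' by apply: bmB => //; exact: bm_rot.
have bGh := bm_rot h bG; have bGh' := bm_rot (- h) bG.
have EA : E (fun p => A p ^+ 2) = 2 * (cov D 0 - cov D h) by exact: incr0.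
have EB : E (fun p => B p ^+ 2) = 2 * (cov D 0 - cov D h) by rewrite [LHS]incr0// covN.
have EK : E (fun p => K p ^+ 2) = 2 * (cov M 0 - cov M h) by exact: incr0.
have EK' : E (fun p => K' p ^+ 2) = 2 * (cov M 0 - cov M h) by rewrite [LHS]incr0// covN.
have EAB : E (fun p => (A p - B p) ^+ 2) = 2 * (cov D 0 - cov D (2 * h)).
  have := E_incr h (- h) bD; rewrite (_ : - h - h = - (2 * h)); last by ring.
  by rewrite covN// => <-; apply: eq_Ex => p; rewrite /A /B; ring.
have ES : E (fun p => (A p + B p) ^+ 2) = 8 * (cov D 0 - cov D h) - 2 * (cov D 0 - cov D (2 * h)).
  rewrite -EAB; have -> : 8 * (cov D 0 - cov D h) = 2 * E (fun p => A p ^+ 2) + 2 * E (fun p => B p ^+ 2).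
    by rewrite EA EB; ring.
  rewrite -!ExZ; itg_tac.
  rewrite -ExD; itg_tac.
  rewrite -ExB; itg_tac.
  by apply: eq_Ex => p; ring.
apply: (@le_trans _ _ (E (fun p => 3 / 4 * ((A p + B p) ^+ 2 + K p ^+ 2 + K' p ^+ 2)))).
  apply: le_Ex; itg_tac.
  move=> p; have -> : G (rot h p) + G (rot (- h) p) - 2 * G p =
     2^-1 * (A p + B p + K p + K' p) by rewrite /A /B /K /K' /M /D /G; field.
  move: (A p + B p) (K p) (K' p) => x y z.
  have := sqr_ge0 (x - y); have := sqr_ge0 (x - z); have := sqr_ge0 (y - z); nra.
rewrite ExZ; itg_tac.
rewrite ExD; itg_tac.
rewrite ExD; itg_tac.
rewrite ES EK EK'.
have := incr_diff_le; have := incr_diff2_ge; have := incr_sum_le.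
lra.
Qed.

Lemma chord_ge : 8 * VF * (s ^+ 2 * c ^+ 2) <= E (fun p => (G (rot h p) - G (rot (- h) p)) ^+ 2).
Proof.
have -> : E (fun p => (G (rot h p) - G (rot (- h) p)) ^+ 2) =
   E (fun p => (G (rot (2 * h) p) - G p) ^+ 2).
  rewrite incr0// E_incr// (_ : - h - h = - (2 * h)) ?covN//; ring.
have := split_incr (2 * h); rewrite incr0// (incr0 _ bD).
by have := incr_ge0 (2 * h) bM; have := incr_diff2_ge; lra.
Qed.

Lemma chord_le : E (fun p => (G (rot h p) - G (rot (- h) p)) ^+ 2) <= 4 * e.
Proof.
have bGh := bm_rot h bG; have bGh' := bm_rot (- h) bG.
have e' : E (fun p => (G (rot (- h) p) - G p) ^+ 2) = e by rewrite /e /U !incr0// covN.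
apply: (@le_trans _ _ (E (fun p => 2 * U p ^+ 2 + 2 * (G (rot (- h) p) - G p) ^+ 2))).
  apply: le_Ex; itg_tac => p; rewrite /U.
  by have := sqr_ge0 (G (rot h p) + G (rot (- h) p) - 2 * G p); nra.
rewrite ExD; itg_tac.
rewrite !ExZ; itg_tac.
by rewrite e' -/e; lra.
Qed.

(** The chord of F_0 + F_(pi/2) is, up to a factor, dquot x y - dquot y x: this bounds
the asymmetry of the difference quotient. *)
Lemma sum_chord_le : E (fun p => (M (rot h p) - M (rot (- h) p)) ^+ 2) <=
  4 * (4 * e - 8 * VF * s ^+ 2).
Proof.
have bGh := bm_rot h bM; have bGh' := bm_rot (- h) bM.
apply: (@le_trans _ _ (E (fun p => 2 * (M (rot h p) - M p) ^+ 2 + 2 * (M (rot (- h) p) - M p) ^+ 2))).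
  apply: le_Ex; itg_tac => p.
  by have := sqr_ge0 (M (rot h p) + M (rot (- h) p) - 2 * M p); nra.
rewrite ExD; itg_tac.
rewrite !ExZ; itg_tac.
by rewrite !incr0// covN//; have := incr_sum_le; lra.
Qed.

End even_process.

(** * Semiconcavity as a one-sided gradient bound *)

Section semiconcave.
Context {R : realType} (n : nat).
Local Notation T := (n.-tuple (measurableTypeR R)).
Local Notation gauss := (@gauss_tuple R n).
Local Notation PP := (prod_prob gauss gauss).
Local Notation E := (Ex PP).

(** For the square F = u^2 of a 1-Lipschitz function the slope p is 2 u grad u, whence
the bound by 4 F.  The slack d allows for infima that are not attained. *)
Definition semiconcave (F : T -> R) := exists2 C : R, 0 <= C &
  forall (x : T) (d : R), 0 < d -> d <= 1 -> exists2 p : 'I_n -> R,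
    \sum_(i < n) p i ^+ 2 <= 4 * (F x + d) &
    forall y : T, F y <= F x + d + \sum_(i < n) p i * (tnth y i - tnth x i)
      + C * \sum_(i < n) (tnth y i - tnth x i) ^+ 2.

(** The semiconcavity inequality at the points c x + s y, with the displacement
(c - 1) x + s y and the slack s^2, all second-order terms being collected. *)
Definition affine_bound (F : T -> R) (K : R) := forall (c s : R) (x : T),
  0 <= c -> 0 < s -> c ^+ 2 + s ^+ 2 = 1 -> exists2 p : 'I_n -> R,
    \sum_(i < n) p i ^+ 2 <= 4 * (F x + s ^+ 2) &
    forall y : T, F (comb c s x y) <= F x + s * dot p y +
      s ^+ 2 * (K * (1 + sqn x + sqn y)).

Variables (F : T -> R) (L : R).
Hypothesis bF : bm F.
Hypothesis F0 : forall x, 0 <= F x.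
Hypothesis FL : forall x, F x <= L.
Hypothesis Fopp : forall x, F (oppt x) = F x.
Hypothesis Fsc : semiconcave F.

Lemma semiconcave_affine_bound : exists2 K : R, 0 <= K & affine_bound F K.
Proof.
have [C C0 sc] := Fsc; have L0 : 0 <= L by rewrite (le_trans (F0 [tuple 0 | i < n]))//.
exists (2 * L + 3 + 2 * C); first by lra.
move=> c s x c0 s0 cs; have s2 : s ^+ 2 <= 1 by have := sqr_ge0 c; lra.
have [p pF H] := sc x (s ^+ 2) (exprn_gt0 _ s0) s2; exists p => // y.
apply: le_trans (H _) _.
have S0 := sqn_ge0 x; have S1 := sqn_ge0 y.
set A := \sum_(i < n) _ * _; set B := \sum_(i < n) _ ^+ 2.
have c1 : 1 - c <= s ^+ 2 by nra.
have c1' : 0 <= 1 - c by have := sqr_ge0 s; nra.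
have Ale : A <= s * dot p y + s ^+ 2 * (2 * (L + 1) + sqn x / 2).
  rewrite /A; under eq_bigr => i _ do rewrite tnth_comb.
  have -> : \sum_(i < n) p i * (c * tnth x i + s * tnth y i - tnth x i) =
      s * dot p y + (1 - c) * \sum_(i < n) - (p i * tnth x i).
    by rewrite /dot !mulr_sumr -big_split/=; apply: eq_bigr => i _; ring.
  rewrite lerD2l; set P := \sum_(i < n) _.
  have Ple : P <= 2 * (L + 1) + sqn x / 2.
    apply: (@le_trans _ _ ((\sum_(i < n) p i ^+ 2) / 2 + sqn x / 2)); last first.
      by rewrite lerD2r; have := FL x; lra.
    rewrite /P /sqn !mulr_suml -big_split/=; apply: ler_sum => i _.
    by have := sqr_ge0 (p i + tnth x i); nra.
  apply: (@le_trans _ _ ((1 - c) * (2 * (L + 1) + sqn x / 2))).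
    by rewrite ler_wpM2l.
  by rewrite ler_wpM2r//; lra.
have Ble : B <= s ^+ 2 * (2 * (sqn x + sqn y)).
  rewrite /B /sqn -big_split/= 2!mulr_sumr; apply: ler_sum => i _.
  rewrite tnth_comb; move: (tnth x i) (tnth y i) => a b.
  have -> : c * a + s * b - a = s * b - (1 - c) * a by ring.
  have h1 : (1 - c) ^+ 2 <= s ^+ 2 by nra.
  have h2 : (1 - c) ^+ 2 * a ^+ 2 <= s ^+ 2 * a ^+ 2 by rewrite ler_wpM2r ?sqr_ge0.
  by have := sqr_ge0 (s * b + (1 - c) * a); nra.
have CB := ler_wpM2l C0 Ble.
have s20 : 0 <= s ^+ 2 by exact: sqr_ge0.
have : 0 <= s ^+ 2 * ((2 * L + 3) * sqn y + (2 * L + 5/2) * sqn x + 2 * C).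
  by rewrite mulr_ge0// !addr_ge0// ?mulr_ge0//; lra.
lra.
Qed.

End semiconcave.

(** Young's inequality for the positive part of a perturbed linear term. *)
Lemma sqr_posD (R : realFieldType) (t a l e : R) : 0 < t -> 0 <= e -> a <= l + e ->
  Num.max a 0 ^+ 2 <= (1 + t) * Num.max l 0 ^+ 2 + (1 + t^-1) * e ^+ 2.
Proof.
move=> t0 e0 ale; set u := Num.max a 0; set v := Num.max l 0.
have v0 : 0 <= v by rewrite le_max lexx orbT.
have u0 : 0 <= u by rewrite le_max lexx orbT.
have uv : u <= v + e.
  rewrite /u ge_max addr_ge0// andbT (le_trans ale)// lerD2r.
  by rewrite /v le_max lexx.
have : u ^+ 2 <= (v + e) ^+ 2 by nra.
move=> /le_trans; apply.
have : 0 <= t * (v - t^-1 * e) ^+ 2 by rewrite mulr_ge0 ?sqr_ge0// ltW.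
have -> : t * (v - t^-1 * e) ^+ 2 = t * v ^+ 2 - 2 * v * e + t^-1 * e ^+ 2.
  by field; rewrite gt_eqF.
lra.
Qed.

Lemma sqr_maxN (R : realDomainType) (a : R) : Num.max a 0 ^+ 2 + Num.max (- a) 0 ^+ 2 = a ^+ 2.
Proof.
by case: (leP a 0) => a0; case: (leP (- a) 0) => a1; rewrite ?expr0n/=; nra.
Qed.

Section step.
Context {R : realType} (n : nat).
Local Notation T := (n.-tuple (measurableTypeR R)).
Local Notation gauss := (@gauss_tuple R n).
Local Notation PP := (prod_prob gauss gauss).
Local Notation E := (Ex PP).

Definition mom4 := Ex gauss (fun x => sqn x ^+ 2).

Variables (F : T -> R) (K : R).
Hypothesis bF : bm F.
Hypothesis F0 : forall x, 0 <= F x.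
Hypothesis Fopp : forall x, F (oppt x) = F x.
Hypothesis K0 : 0 <= K.
Hypothesis Kstep : affine_bound F K.

Lemma mom4_ge0 : 0 <= mom4.
Proof. by apply: Ex_ge0 => x; exact: sqr_ge0. Qed.

Lemma dot_oppt (p : 'I_n -> R) (y : T) : dot p (oppt y) = - dot p y.
Proof.
by rewrite /dot -sumrN; apply: eq_bigr => i _; rewrite tnth_oppt mulrN.
Qed.

Lemma sqn_oppt (y : T) : sqn (oppt y) = sqn y.
Proof. by apply: eq_bigr => i _; rewrite tnth_oppt sqrrN. Qed.

Lemma oppt_comb c s (x y : T) : oppt (comb c s x y) = comb (- c) (- s) x y.
Proof. by apply: eq_from_tnth => i; rewrite tnth_oppt !tnth_comb; ring. Qed.

Lemma comb_oppt c s (x y : T) : comb c s x (oppt y) = comb c (- s) x y.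
Proof. by apply: eq_from_tnth => i; rewrite !tnth_comb tnth_oppt; ring. Qed.

Lemma bm_F_comb c s : bm (fun p : T * T => F (comb c s p.1 p.2)).
Proof. exact: bm_comp bF (measurable_comb c s). Qed.

Lemma sqr_sum3_le (u v : R) : (1 + u + v) ^+ 2 <= 3 * (1 + u ^+ 2 + v ^+ 2).
Proof.
by have := sqr_ge0 (1 - u); have := sqr_ge0 (1 - v); have := sqr_ge0 (u - v); nra.
Qed.

(** The increment U = F (c x + s y) - F x changes sign when the two arguments of F
are exchanged, so E U^2 is twice E (U^+)^2, and for the positive part the
upper bound by an affine function suffices.  Averaging over y and - y, the
positive parts of p.y and - p.y add up to (p.y)^2, whose mean is |p|^2 <= 4 F. *)
Lemma sqr_incr_le (t c s : R) : 0 < t -> 0 <= c -> 0 < s -> c ^+ 2 + s ^+ 2 = 1 ->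
  E (fun p => (F (comb c s p.1 p.2) - F p.1) ^+ 2) <=
  s ^+ 2 * (4 * (1 + t) * (Ex gauss F + s ^+ 2) +
    6 * (1 + t^-1) * K ^+ 2 * s ^+ 2 * (1 + 2 * mom4)).
Proof.
move=> t0 c0 s0 cs; have ti : 0 < t^-1 by rewrite invr_gt0.
pose U (p : T * T) := F (comb c s p.1 p.2) - F p.1.
have bU : bm U by apply: bmB; [exact: bm_F_comb|exact: bm_comp bF measurable_fst].
pose Up p := Num.max (U p) 0 ^+ 2.
have bUp : bm Up by apply: bmX; apply: bm_maxr => //; exact: bm_cst.
(* the reflection that exchanges x and c x + s y *)
pose sg (p : T * T) : T * T := (comb c s p.1 p.2, oppt (comb (- s) c p.1 p.2)).
have msg : measurable_fun [set: T * T] sg.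
  apply: measurable_fun_pair; first exact: measurable_comb.
  exact: measurableT_comp (@measurable_oppt R n) (measurable_comb _ _).
have Esg g : bm g -> E (fun p => g (sg p)) = E g.
  move=> bg; pose g' (p : T * T) := g (p.1, oppt p.2).
  have bg' : bm g'.
    apply: (bm_comp bg); apply: measurable_fun_pair; first exact: measurable_fst.
    exact: measurableT_comp (@measurable_oppt R n) measurable_snd.
  rewrite (Ex_fubini1 gauss gauss (bm_comp bg msg)).
  have := Ex_gauss_rot bg' cs; rewrite gt_eqF// => /(_ isT) /= H.
  apply: (etrans H); rewrite (Ex_fubini1 gauss gauss bg); apply: eq_Ex => x.
  exact: (Ex_oppt (bm_sectl x bg)).
have Usg p : U (sg p) = - U p.
  rewrite /U /sg /=; have -> : comb c s (comb c s p.1 p.2) (oppt (comb (- s) c p.1 p.2)) = p.1.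
    apply: eq_from_tnth => i; rewrite tnth_comb tnth_oppt !tnth_comb.
    transitivity ((c ^+ 2 + s ^+ 2) * tnth p.1 i); first by ring.
    by rewrite cs mul1r.
  by rewrite opprB.
have -> : E (fun p => (F (comb c s p.1 p.2) - F p.1) ^+ 2) = 2 * E Up.
  transitivity (E (fun p => Up p + Up (sg p))).
    by apply: eq_Ex => p; rewrite /Up Usg sqr_maxN.
  rewrite ExD; [|exact: bm_itg|by apply: bm_itg; exact: bm_comp bUp msg].
  by rewrite Esg//; ring.
pose B x := (1 + t) * s ^+ 2 * (4 * (F x + s ^+ 2)) +
    6 * (1 + t^-1) * s ^+ 4 * K ^+ 2 * (1 + sqn x ^+ 2 + mom4).
have inner x : 2 * Ex gauss (fun y => Up (x, y)) <= B x.
  have bx := bm_sectl x bUp.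
  have -> : 2 * Ex gauss (fun y => Up (x, y)) =
      Ex gauss (fun y => Up (x, y) + Up (x, oppt y)).
    rewrite ExD; [|exact: bm_itg|by apply: bm_itg; exact: bm_comp bx (@measurable_oppt R n)].
    by rewrite (Ex_oppt bx); ring.
  have [p pF H] := Kstep x c0 s0 cs.
  have I2 := itg_dot2 p; have IQ := itg_sqn2 (R := R) n.
  have Id : itg gauss (fun y => (1 + t) * s ^+ 2 * dot p y ^+ 2) by exact: itgZ.
  have Iq : itg gauss (fun y => 6 * (1 + t^-1) * s ^+ 4 * K ^+ 2 * (1 + sqn x ^+ 2 + sqn y ^+ 2)).
    by apply: itgZ; apply: itgD => //; exact: itg_cst.
  apply: (@le_trans _ _ (Ex gauss (fun y => (1 + t) * s ^+ 2 * dot p y ^+ 2 +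
     6 * (1 + t^-1) * s ^+ 4 * K ^+ 2 * (1 + sqn x ^+ 2 + sqn y ^+ 2)))).
    apply: le_Ex.
    - apply: bm_itg; apply: bmD => //; exact: bm_comp bx (@measurable_oppt R n).
    - exact: itgD.
    move=> y; set e := s ^+ 2 * (K * (1 + sqn x + sqn y)).
    have e0 : 0 <= e.
      apply: mulr_ge0; first exact: sqr_ge0.
      by apply: mulr_ge0 => //; have := sqn_ge0 x; have := sqn_ge0 y; lra.
    have H1 : U (x, y) <= s * dot p y + e by have := H y; rewrite /U /= /e; lra.
    have H2 : U (x, oppt y) <= - (s * dot p y) + e.
      by have := H (oppt y); rewrite dot_oppt sqn_oppt /U /= /e; lra.
    have := sqr_posD t0 e0 H1; have := sqr_posD t0 e0 H2.
    have := sqr_maxN (s * dot p y); rewrite /Up.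
    move: (Num.max (s * _) 0 ^+ 2) (Num.max (- _) 0 ^+ 2) => a b ab h1 h2.
    apply: (le_trans (lerD h2 h1)).
    have -> : (1 + t) * a + (1 + t^-1) * e ^+ 2 + ((1 + t) * b + (1 + t^-1) * e ^+ 2) =
       (1 + t) * s ^+ 2 * dot p y ^+ 2 + 2 * (1 + t^-1) * e ^+ 2.
      by have := congr1 ( *%R (1 + t)) ab; rewrite exprMn; lra.
    rewrite lerD2l; have -> : e ^+ 2 = s ^+ 4 * K ^+ 2 * (1 + sqn x + sqn y) ^+ 2.
      by rewrite /e; ring.
    have t1 : 0 <= 2 * (1 + t^-1) * (s ^+ 4 * K ^+ 2).
      apply: mulr_ge0; first lra.
      by apply: mulr_ge0; [exact: exprn_even_ge0|exact: sqr_ge0].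
    by have := ler_wpM2l t1 (sqr_sum3_le (sqn x) (sqn y)); lra.
  rewrite ExD// ExZ// Ex_dot2 ExZ; last by apply: itgD => //; exact: itg_cst.
  rewrite ExD//; last exact: itg_cst.
  rewrite Ex_cst /B lerD// ler_wpM2l// mulr_ge0 ?sqr_ge0//; lra.
have IB : itg gauss B.
  apply: itgD; apply: itgZ.
    by apply: itgZ; apply: itgD; [exact: bm_itg|exact: itg_cst].
  by apply: itgD; [apply: itgD|]; [exact: itg_cst|exact: itg_sqn2|exact: itg_cst].
rewrite (Ex_fubini1 gauss gauss bUp) -ExZ; last by apply: bm_itg; exact: bm_Exl.
apply: (@le_trans _ _ (Ex gauss B)).
  apply: le_Ex => //; apply: bm_itg; apply: bmM; [exact: bm_cst|exact: bm_Exl].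
have IF := bm_itg gauss bF; have IQ := itg_sqn2 (R := R) n.
have Ic k := itg_cst gauss (k : R).
have IFs := itgD IF (Ic (s ^+ 2)); have IQ1 := itgD (Ic 1) IQ.
have IQm := itgD IQ1 (Ic mom4).
rewrite /B (ExD (itgZ _ (itgZ _ IFs)) (itgZ _ IQm)) (ExZ _ (itgZ _ IFs)) (ExZ _ IFs).
rewrite (ExD IF (Ic _)) (ExZ _ IQm) (ExD IQ1 (Ic _)) (ExD (Ic _) IQ) !Ex_cst -/mom4.
by rewrite le_eqVlt; apply/orP; left; apply/eqP; ring.
Qed.

End step.

(** * Difference quotients are nearly linear *)

(** From |a^2 - b^2| = |a - b| |a + b| by weighted arithmetic and geometric means. *)
Lemma young_sqr (R : realFieldType) (l a b : R) : 0 < l ->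
  `|a ^+ 2 - b ^+ 2| <= (a - b) ^+ 2 / (2 * l) + l * (a ^+ 2 + b ^+ 2).
Proof.
move=> l0; have li : 0 < l^-1 by rewrite invr_gt0.
have -> : (a - b) ^+ 2 / (2 * l) = l^-1 * (a - b) ^+ 2 / 2 by field; rewrite gt_eqF.
have h (e : R) : e ^+ 2 = 1 -> 0 <= l^-1 / 2 * (a - b - e * l * (a + b)) ^+ 2.
  by move=> _; rewrite mulr_ge0 ?sqr_ge0// divr_ge0// ltW.
have ex (e : R) : e ^+ 2 = 1 -> l^-1 / 2 * (a - b - e * l * (a + b)) ^+ 2 =
   l^-1 * (a - b) ^+ 2 / 2 - e * (a ^+ 2 - b ^+ 2) + l * (a + b) ^+ 2 / 2.
  move=> e1; rewrite -[l * _ / 2 in RHS](mul1r) -[X in X * (l * _ / 2)]e1.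
  by field; rewrite gt_eqF.
have := h 1; rewrite ex ?expr1n// => /(_ erefl) h1.
have := h (-1); rewrite ex ?sqrrN ?expr1n// => /(_ erefl) h2.
have h3 : l * (a + b) ^+ 2 / 2 <= l * (a ^+ 2 + b ^+ 2).
  have h4 : (a + b) ^+ 2 / 2 <= a ^+ 2 + b ^+ 2 by have := sqr_ge0 (a - b); nra.
  by have := ler_wpM2l (ltW l0) h4; rewrite mulrA.
by rewrite ler_norml; apply/andP; split; lra.
Qed.

Section linearization.
Context {R : realType} (n : nat).
Local Notation T := (n.-tuple (measurableTypeR R)).
Local Notation gauss := (@gauss_tuple R n).
Local Notation PP := (prod_prob gauss gauss).
Local Notation E := (Ex PP).
Local Notation mom4 := (@mom4 R n).

Variables (F : T -> R) (K c s : R).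
Hypothesis bF : bm F.
Hypothesis F0 : forall x, 0 <= F x.
Hypothesis Kstep : affine_bound F K.
Hypotheses (c0 : 0 <= c) (s0 : 0 < s) (cs : c ^+ 2 + s ^+ 2 = 1).

Definition dquot (x y : T) := (F (comb c s x y) - F (comb c (- s) x y)) / (2 * s).
Definition sdiff (x y : T) := F (comb c s x y) + F (comb c (- s) x y) - 2 * F x.
Local Notation Kq := (6 * s ^+ 2 * K ^+ 2).
Definition linerr (x y : T) := (sdiff x y / s) ^+ 2 / 2 + Kq * (1 + sqn x ^+ 2 + sqn y ^+ 2).

(** The bounds from above at y and - y bound F (c x + s y) - F x from both sides,
up to the second difference: the affine bound is then also a lower bound, and
the slope p is a genuine linear approximation. *)
Lemma linerr_dquot x : exists2 p : 'I_n -> R,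
  \sum_(i < n) p i ^+ 2 <= 4 * (F x + s ^+ 2) &
  forall y, (dquot x y - dot p y) ^+ 2 <= linerr x y.
Proof.
have [p pF H] := Kstep x c0 s0 cs; exists p => // y.
set e := s ^+ 2 * (K * (1 + sqn x + sqn y)).
have H1 : F (comb c s x y) - F x <= s * dot p y + e by have := H y; rewrite /e; lra.
have H2 : F (comb c (- s) x y) - F x <= - (s * dot p y) + e.
  by have := H (oppt y); rewrite dot_oppt sqn_oppt comb_oppt /e; lra.
have sn0 : s != 0 by rewrite gt_eqF.
have -> : (dquot x y - dot p y) ^+ 2 =
   ((F (comb c s x y) - F (comb c (- s) x y)) / 2 - s * dot p y) ^+ 2 / s ^+ 2.
  by rewrite /dquot; field.
rewrite ler_pdivrMr ?exprn_gt0//.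
have -> : linerr x y * s ^+ 2 = sdiff x y ^+ 2 / 2 + s ^+ 4 * K ^+ 2 * (6 * (1 + sqn x ^+ 2 + sqn y ^+ 2)).
  by rewrite /linerr; field.
apply: (@le_trans _ _ (sdiff x y ^+ 2 / 2 + 2 * e ^+ 2)).
  move: H1 H2; rewrite /sdiff; move: (F (comb c s x y)) (F (comb c (- s) x y)) (F x) (s * dot p y) => u u' f l h1 h2.
  have : ((u - u') / 2 - l) ^+ 2 <= (`|u + u' - 2 * f| / 2 + e) ^+ 2.
    rewrite -[leLHS]real_normK ?num_real//.
    have h3 : `|(u - u') / 2 - l| <= `|u + u' - 2 * f| / 2 + e.
      rewrite ler_norml; have := ler_norm (u + u' - 2 * f).
      by have := ler_norm (- (u + u' - 2 * f)); rewrite normrN => *; apply/andP; split; lra.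
    by have := normr_ge0 ((u - u') / 2 - l); nra.
  move=> /le_trans; apply; rewrite -[X in _ <= X / 2 + _]real_normK ?num_real//.
  by have := sqr_ge0 (`|u + u' - 2 * f| / 2 - e); nra.
have -> : 2 * e ^+ 2 = s ^+ 4 * K ^+ 2 * (2 * (1 + sqn x + sqn y) ^+ 2) by rewrite /e; ring.
rewrite lerD2l ler_wpM2l//; last by have := sqr_sum3_le (sqn x) (sqn y); lra.
by apply: mulr_ge0; [exact: exprn_even_ge0|exact: sqr_ge0].
Qed.

Lemma bm_dquot : bm (fun p : T * T => dquot p.1 p.2).
Proof.
by apply: bmM; [apply: bmB; exact: (bm_comp bF (measurable_comb _ _))|exact: bm_cst].
Qed.

Lemma bm_sdiff2 : bm (fun p : T * T => (sdiff p.1 p.2 / s) ^+ 2 / 2).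
Proof.
have b1 : bm (fun p : T * T => F p.1) by exact: bm_comp bF measurable_fst.
have b2 := bm_comp bF (measurable_comb (n := n) c s).
have b3 := bm_comp bF (measurable_comb (n := n) c (- s)).
by rewrite /sdiff; bm_tac.
Qed.

Definition sqdq x := Ex gauss (fun y => dquot x y ^+ 2).
Local Notation N := sqdq.
Definition mlinerr x := Ex gauss (fun y => (sdiff x y / s) ^+ 2 / 2) + Kq * (1 + sqn x ^+ 2 + mom4).
Definition tlinerr := E (fun p => (sdiff p.1 p.2 / s) ^+ 2 / 2) + Kq * (1 + 2 * mom4).
Local Notation B2 := (E (fun p => dquot p.1 p.2 ^+ 2)).

Lemma bm_sqdq : bm N.
Proof. exact: (bm_Exl gauss (bmX 2 bm_dquot)). Qed.

Lemma Ex_sqdq : Ex gauss N = B2.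
Proof. by rewrite (Ex_fubini1 gauss gauss (bmX 2 bm_dquot)). Qed.

Let IQ := itg_sqn2 (R := R) n.
Let Ic k : itg gauss (fun _ => k : R) := itg_cst gauss k.
Let IF := bm_itg gauss bF.

Lemma itg_mlinerr : itg gauss mlinerr.
Proof.
apply: itgD; first exact: bm_itg (bm_Exl gauss bm_sdiff2).
exact: itgZ (itgD (itgD (Ic 1) IQ) (Ic _)).
Qed.

Lemma Ex_mlinerr : Ex gauss mlinerr = tlinerr.
Proof.
have b := bm_itg gauss (bm_Exl gauss bm_sdiff2).
have I2 := itgD (itgD (Ic 1) IQ) (Ic mom4).
rewrite (ExD b (itgZ _ I2)) (ExZ _ I2) (ExD (itgD (Ic 1) IQ) (Ic _)) (ExD (Ic 1) IQ).
rewrite !Ex_cst /tlinerr (Ex_fubini1 gauss gauss bm_sdiff2) -/mom4; congr (_ + _ * _).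
ring.
Qed.

Lemma Ex_linerr x : itg gauss (linerr x) /\ Ex gauss (linerr x) = mlinerr x.
Proof.
have b := bm_itg gauss (bm_sectl x bm_sdiff2).
have I2 := itgD (Ic (1 + sqn x ^+ 2)) IQ; split; first exact: itgD b (itgZ _ I2).
by rewrite /linerr (ExD b (itgZ _ I2)) (ExZ _ I2) (ExD (Ic _) IQ) Ex_cst.
Qed.

Lemma sqdq_le (l : R) x : 0 < l ->
  N x <= (1 + l) * (4 * (F x + s ^+ 2)) + (1 + l^-1) * mlinerr x.
Proof.
move=> l0; have [p pF H] := linerr_dquot x; have [I1 <-] := Ex_linerr x.
have li : 0 < l^-1 by rewrite invr_gt0.
have I2 := itg_dot2 p.
apply: (@le_trans _ _ (Ex gauss (fun y => (1 + l) * dot p y ^+ 2 + (1 + l^-1) * linerr x y))).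
  apply: le_Ex; [exact: bm_itg (bm_sectl x (bmX 2 bm_dquot))|exact: itgD (itgZ _ I2) (itgZ _ I1)|].
  move=> y; have h := ler_wpM2l (_ : 0 <= 1 + l^-1) (H y).
  have {}h := h (addr_ge0 ler01 (ltW li)).
  apply: le_trans (_ : _ <= (1 + l) * dot p y ^+ 2 + (1 + l^-1) * (dquot x y - dot p y) ^+ 2) _; last first.
    by rewrite lerD2l.
  move: (dquot x y) (dot p y) => a b.
  have : 0 <= l * (b - l^-1 * (a - b)) ^+ 2 by rewrite mulr_ge0 ?sqr_ge0// ltW.
  have -> : l * (b - l^-1 * (a - b)) ^+ 2 = l * b ^+ 2 - 2 * b * (a - b) + l^-1 * (a - b) ^+ 2.
    by field; rewrite gt_eqF.
  lra.
rewrite (ExD (itgZ _ I2) (itgZ _ I1)) (ExZ _ I2) (ExZ _ I1) Ex_dot2 lerD2r.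
by rewrite ler_wpM2l//; lra.
Qed.

(** [sqdq_le] gives a nonnegative g >= N - 4 F, hence |N - 4 F| <= 2 g - (N - 4 F); the
mean of N being bounded below by [chord_ge], this one-sided bound suffices. *)
Lemma sqdq_close (l : R) : 0 < l ->
  Ex gauss (fun x => `|N x - 4 * F x|) <=
  2 * (4 * l * Ex gauss F + 4 * (1 + l) * s ^+ 2 + (1 + l^-1) * tlinerr) - B2 + 4 * Ex gauss F.
Proof.
move=> l0; have li : 0 < l^-1 by rewrite invr_gt0.
have Im := itg_mlinerr; have IN := bm_itg gauss bm_sqdq.
pose g x := 4 * l * F x + 4 * (1 + l) * s ^+ 2 + (1 + l^-1) * mlinerr x.
have Ig1 := itgD (itgZ (4 * l) IF) (Ic (4 * (1 + l) * s ^+ 2)).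
have Ig : itg gauss g := itgD Ig1 (itgZ (1 + l^-1) Im).
have m0 x : 0 <= mlinerr x.
  have [p _ H] := linerr_dquot x; have [_ <-] := Ex_linerr x.
  by apply: Ex_ge0 => y; apply: le_trans (H y); exact: sqr_ge0.
have g0 x : 0 <= g x.
  rewrite /g; apply: addr_ge0; last by apply: mulr_ge0 => //; lra.
  apply: addr_ge0; first by apply: mulr_ge0 => //; lra.
  by apply: mulr_ge0; [lra|exact: sqr_ge0].
apply: (@le_trans _ _ (Ex gauss (fun x => 2 * g x - N x + 4 * F x))).
  apply: le_Ex.
  - by apply: bm_itg; apply: bm_norm; apply: bmB; [exact: bm_sqdq|apply: bmM => //; exact: bm_cst].
  - exact: itgD (itgB (itgZ 2 Ig) IN) (itgZ 4 IF).
  move=> x; have := sqdq_le x l0; have := g0 x; rewrite /g => h1 h2.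
  by rewrite ler_norml; apply/andP; split; lra.
rewrite (ExD (itgB (itgZ 2 Ig) IN) (itgZ 4 IF)) (ExB (itgZ 2 Ig) IN) (ExZ _ Ig) (ExZ _ IF).
rewrite /g (ExD Ig1 (itgZ (1 + l^-1) Im)) (ExD (itgZ (4 * l) IF) (Ic _)) (ExZ _ IF) (ExZ _ Im).
by rewrite Ex_cst Ex_sqdq Ex_mlinerr.
Qed.

(** The mean square in the first variable; it is compared with the mean square in
the second through the near symmetry of [dquot]. *)
Definition sqdqT x := Ex gauss (fun y => dquot y x ^+ 2).
Local Notation N' := sqdqT.

Lemma bm_dquotT : bm (fun p : T * T => dquot p.2 p.1).
Proof.
apply: (bm_comp (f := fun p : T * T => dquot p.1 p.2) bm_dquot (h := fun p : T * T => (p.2, p.1))).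
exact: measurable_fun_pair measurable_snd measurable_fst.
Qed.

Lemma bm_sqdqT : bm N'.
Proof. exact: (bm_Exl gauss (bmX 2 bm_dquotT)). Qed.

Lemma E_dquotT : E (fun p => dquot p.2 p.1 ^+ 2) = B2.
Proof.
by rewrite (Ex_fubini1 gauss gauss (bmX 2 bm_dquotT)) (Ex_fubini2 gauss gauss (bmX 2 bm_dquot)).
Qed.

Lemma Ex_sqdqT : Ex gauss N' = B2.
Proof. by rewrite -E_dquotT (Ex_fubini1 gauss gauss (bmX 2 bm_dquotT)). Qed.

Lemma sqdqT_close (l : R) : 0 < l ->
  Ex gauss (fun x => `|N' x - N x|) <=
  E (fun p => (dquot p.1 p.2 - dquot p.2 p.1) ^+ 2) / (2 * l) + 2 * l * B2.
Proof.
move=> l0; pose A (p : T * T) := `|dquot p.2 p.1 ^+ 2 - dquot p.1 p.2 ^+ 2|.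
have b1 := bmX 2 bm_dquot; have b2 := bmX 2 bm_dquotT.
have bA : bm A by apply: bm_norm; exact: bmB.
have bd : bm (fun p : T * T => (dquot p.1 p.2 - dquot p.2 p.1) ^+ 2).
  by apply: bmX; apply: bmB; [exact: bm_dquot|exact: bm_dquotT].
apply: (@le_trans _ _ (E A)).
  rewrite (Ex_fubini1 gauss gauss bA); apply: le_Ex.
  - by apply: bm_itg; apply: bm_norm; apply: bmB; [exact: bm_sqdqT|exact: bm_sqdq].
  - exact: bm_itg (bm_Exl gauss bA).
  move=> x; rewrite /N' /N -ExB; [|exact: bm_itg (bm_sectl x b2)|exact: bm_itg (bm_sectl x b1)].
  by apply: Ex_norm_le; exact: bm_itg (bmB (bm_sectl x b2) (bm_sectl x b1)).
apply: (@le_trans _ _ (E (fun p => (2 * l)^-1 * (dquot p.1 p.2 - dquot p.2 p.1) ^+ 2 +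
    l * (dquot p.2 p.1 ^+ 2 + dquot p.1 p.2 ^+ 2)))).
  apply: le_Ex; [exact: bm_itg|exact: bm_itg (bmD (bmM (bm_cst _ _) bd) (bmM (bm_cst _ _) (bmD b2 b1)))|].
  move=> p; apply: le_trans (young_sqr _ _ l0) _.
  by rewrite lerD2r mulrC -sqrrN opprB.
have I1 := bm_itg PP bd; have I2 := itgD (bm_itg PP b2) (bm_itg PP b1).
rewrite (ExD (itgZ _ I1) (itgZ _ I2)) (ExZ _ I1) (ExZ _ I2) (ExD (bm_itg PP b2) (bm_itg PP b1)).
by rewrite E_dquotT mulrC; lra.
Qed.

End linearization.

Section polarization.
Context {R : realType} (n : nat).
Local Notation T := (n.-tuple (measurableTypeR R)).
Local Notation gauss := (@gauss_tuple R n).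
Local Notation PP := (prod_prob gauss gauss).
Local Notation E := (Ex PP).
Local Notation mom4 := (@mom4 R n).

Variables (F : T -> R) (K c s : R).
Hypothesis bF : bm F.
Hypothesis Kstep : affine_bound F K.
Hypotheses (c0 : 0 <= c) (s0 : 0 < s) (cs : c ^+ 2 + s ^+ 2 = 1).

Local Notation dq := (dquot F c s).
Local Notation N' := (sqdqT F c s).
Local Notation B2 := (E (fun p => dq p.1 p.2 ^+ 2)).
Local Notation TH := (tlinerr F K c s).
Local Notation Kq := (6 * s ^+ 2 * K ^+ 2).

(** The Gram kernel of the functions dquot (., x). *)
Definition dqinner (p : T * T) := Ex gauss (fun y => dq y p.1 * dq y p.2).

Let q4 : R := pi / 4.
Let r := cos q4.
Let xp (p : T * T) : T := (rot q4 p).1.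
Let xm (p : T * T) : T := (rot (- q4) p).1.

Let sr : sin q4 = r.
Proof. rewrite /r; have -> : q4 = pi / 2 - q4 by rewrite /q4; field.
by rewrite {1}sinB sin_pihalf cos_pihalf mul0r mul1r subr0 /q4; congr cos; field. Qed.

Let r2 : r ^+ 2 = 2^-1.
Proof. by have := cos2Dsin2 q4; rewrite sr -/r; lra. Qed.

Let mxp : measurable_fun [set: T * T] xp.
Proof. exact: measurableT_comp measurable_fst (measurable_rotT q4). Qed.

Let mxm : measurable_fun [set: T * T] xm.
Proof. exact: measurableT_comp measurable_fst (measurable_rotT (- q4)). Qed.

Let bdq (h : T * T -> T) : measurable_fun [set: T * T] h ->
  bm (fun q : (T * T) * T => dq q.2 (h q.1)).
Proof.
move=> mh; apply: (bm_comp (f := fun p : T * T => dq p.1 p.2) (bm_dquot c s bF)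
  (h := fun q : (T * T) * T => (q.2, h q.1))).
apply: measurable_fun_pair; first exact: measurable_snd.
exact: measurableT_comp mh measurable_fst.
Qed.

Let dot_xp (p : 'I_n -> R) q : dot p (xp q) = r * (dot p q.1 + dot p q.2).
Proof.
rewrite /dot mulrDr !mulr_sumr -big_split/=; apply: eq_bigr => i _.
by rewrite tnth_comb sr -/r; ring.
Qed.

Let dot_xm (p : 'I_n -> R) q : dot p (xm q) = r * (dot p q.1 - dot p q.2).
Proof.
rewrite /dot mulrBr !mulr_sumr -sumrB/=; apply: eq_bigr => i _.
by rewrite tnth_comb cosN sinN sr -/r; ring.
Qed.

Let sqn_pm q : sqn (xp q) + sqn (xm q) = sqn q.1 + sqn q.2.
Proof.
rewrite /sqn -!big_split/=; apply: eq_bigr => i _.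
rewrite !tnth_comb cosN sinN sr -/r; move: (tnth _ _) (tnth _ _) => a b.
by transitivity (2 * r ^+ 2 * (a ^+ 2 + b ^+ 2)); [ring|rewrite r2; field].
Qed.

Let dev (p : T * T) (y : T) :=
  (dq y (xp p) - r * (dq y p.1 + dq y p.2)) ^+ 2 + (dq y (xm p) - r * (dq y p.1 - dq y p.2)) ^+ 2.

Let b1 := bdq measurable_fst.
Let b2 := bdq measurable_snd.
Let bp := bdq mxp.
Let bmn := bdq mxm.

Let bdev : bm (fun q : (T * T) * T => dev q.1 q.2).
Proof.
have br : bm (fun _ : (T * T) * T => r) by exact: bm_cst.
by rewrite /dev; bm_tac.
Qed.

Let kap y x := (sdiff F c s y x / s) ^+ 2 / 2.

Let kq0 : 0 <= Kq.
Proof. by apply: mulr_ge0; [apply: mulr_ge0 => //|]; exact: sqr_ge0. Qed.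

Let dev_le p y : dev p y <= 3 * (kap y (xp p) + kap y (xm p) + kap y p.1 + kap y p.2) +
  3 * Kq * (4 * (1 + sqn y ^+ 2) + 3 * (sqn p.1 ^+ 2 + sqn p.2 ^+ 2)).
Proof.
have [v _ H] := linerr_dquot Kstep c0 s0 cs y.
have := H (xp p); have := H (xm p); have := H p.1; have := H p.2.
rewrite dot_xp dot_xm /linerr -!/(kap _ _) /dev.
have : sqn (xp p) ^+ 2 + sqn (xm p) ^+ 2 <= 2 * (sqn p.1 ^+ 2 + sqn p.2 ^+ 2).
  have h0 := sqn_ge0 (xp p); have h1 := sqn_ge0 (xm p); have := sqn_pm p.
  by have := sqr_ge0 (sqn p.1 - sqn p.2); nra.
move=> /(ler_wpM2l kq0).
move: (dq y (xp p)) (dq y (xm p)) (dq y p.1) (dq y p.2) (dot v p.1) (dot v p.2).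
move=> wp wm x z l k h0 h1 h2 h3 h4.
have t3 (a b d : R) : (a + b + d) ^+ 2 <= 3 * (a ^+ 2 + b ^+ 2 + d ^+ 2).
  by have := sqr_ge0 (a - b); have := sqr_ge0 (a - d); have := sqr_ge0 (b - d); nra.
have e1 : (wp - r * (x + z)) ^+ 2 <= 3 * ((wp - r * (l + k)) ^+ 2 + 2^-1 * (x - l) ^+ 2 + 2^-1 * (z - k) ^+ 2).
  rewrite -r2; have := t3 (wp - r * (l + k)) (- (r * (x - l))) (- (r * (z - k))).
  by rewrite !sqrrN !exprMn; congr (_ ^+ 2 <= _); ring.
have e2 : (wm - r * (x - z)) ^+ 2 <= 3 * ((wm - r * (l - k)) ^+ 2 + 2^-1 * (x - l) ^+ 2 + 2^-1 * (z - k) ^+ 2).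
  rewrite -r2; have := t3 (wm - r * (l - k)) (- (r * (x - l))) (r * (z - k)).
  by rewrite !sqrrN !exprMn; congr (_ ^+ 2 <= _); ring.
lra.
Qed.

Let IQ := itg_sqn2 (R := R) n.

Let Ex_fst (f : T -> R) : bm f -> Ex gauss f = E (fun p => f p.1).
Proof.
move=> bf; rewrite (Ex_fubini1 gauss gauss (bm_comp bf measurable_fst)).
by apply: eq_Ex => x /=; rewrite Ex_cst.
Qed.

Let Ex_snd (f : T -> R) : bm f -> Ex gauss f = E (fun p => f p.2).
Proof.
move=> bf; rewrite (Ex_fubini1 gauss gauss (bm_comp bf measurable_snd)).
by rewrite /= Ex_cst.
Qed.

Let E_rot1 t (f : T -> R) : bm f -> E (fun p => f (rot t p).1) = Ex gauss f.
Proof.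
by move=> bf; rewrite (E_rot t (bm_comp bf measurable_fst)) (Ex_fst bf).
Qed.

Let m4_ge0 : 0 <= mom4 := mom4_ge0 n.

Let Ex_dev y : E (fun p => dev p y) <= 12 * mlinerr F K c s y + 6 * Kq * mom4.
Proof.
have bk : bm (kap y) := bm_sectl y (bm_sdiff2 c s bF).
have bk1 := bm_comp bk mxp; have bk2 := bm_comp bk mxm.
have bk3 := bm_comp bk (@measurable_fst _ _ T T); have bk4 := bm_comp bk (@measurable_snd _ _ T T).
have mQ : measurable_fun [set: T] (fun x => sqn x ^+ 2).
  by apply: measurable_funX; exact: measurable_sqn.
have I1 : itg PP (fun p => sqn p.1 ^+ 2) := itg_pull measurable_fst Ex_fst mQ IQ.
have I2 : itg PP (fun p => sqn p.2 ^+ 2) := itg_pull measurable_snd Ex_snd mQ IQ.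
have Ik := bm_itg PP (bmD (bmD (bmD bk1 bk2) bk3) bk4).
have I12 := itgD I1 I2; have I3 := itgD (itg_cst PP (4 * (1 + sqn y ^+ 2))) (itgZ 3 I12).
apply: (le_trans (le_Ex _ _ (dev_le ^~ y))).
- exact: bm_itg (bm_sectr y bdev).
- exact: itgD (itgZ _ Ik) (itgZ _ I3).
rewrite (ExD (itgZ _ Ik) (itgZ _ I3)) (ExZ _ Ik) (ExZ _ I3).
rewrite (ExD (itg_cst _ _) (itgZ 3 I12)) (ExZ _ I12) (ExD I1 I2) Ex_cst.
rewrite -(Ex_pull measurable_fst Ex_fst mQ IQ) -(Ex_pull measurable_snd Ex_snd mQ IQ).
rewrite (ExD (bm_itg PP (bmD (bmD bk1 bk2) bk3)) (bm_itg PP bk4)).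
rewrite (ExD (bm_itg PP (bmD bk1 bk2)) (bm_itg PP bk3)).
rewrite (ExD (bm_itg PP bk1) (bm_itg PP bk2)).
have -> : E (fun p => kap y (xp p)) = Ex gauss (kap y) by exact: (E_rot1 q4 bk).
have -> : E (fun p => kap y (xm p)) = Ex gauss (kap y) by exact: (E_rot1 (- q4) bk).
have -> : E (fun p => kap y p.1) = Ex gauss (kap y) by exact/esym/(Ex_fst bk).
have -> : E (fun p => kap y p.2) = Ex gauss (kap y) by exact/esym/(Ex_snd bk).
rewrite /mlinerr -/(kap y) -/mom4.
by rewrite le_eqVlt; apply/orP; left; apply/eqP; ring.
Qed.

Let bN := bm_sqdqT c s bF.

Lemma bm_dqinner : bm dqinner.
Proof. exact: (bm_Exl gauss (bmM b1 b2)). Qed.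

(** Polarization: where dquot y is linear, its values at (x + z)/sqrt 2 and
(x - z)/sqrt 2 are those of the sum and the difference divided by sqrt 2, and the
product is half the difference of the squares of these values. *)
Lemma dqinner_close (l : R) : 0 < l ->
  E (fun p => `|dqinner p - (N' (xp p) - N' (xm p)) / 2|) <=
  15 * TH / (4 * l) + 2 * l * B2.
Proof.
move=> l0; have li : 0 < l^-1 by rewrite invr_gt0.
pose edev p := Ex gauss (fun y => dev p y).
have bedev : bm edev := bm_Exl gauss bdev.
have bNp := bm_comp bN mxp; have bNm := bm_comp bN mxm.
have bN1 := bm_comp bN (@measurable_fst _ _ T T); have bN2 := bm_comp bN (@measurable_snd _ _ T T).
have bNN := bmD (bmD (bmD bN1 bN2) bNp) bNm.
apply: (@le_trans _ _ (E (fun p => (4 * l)^-1 * edev p + l / 2 *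
     (N' p.1 + N' p.2 + N' (xp p) + N' (xm p))))).
  apply: le_Ex.
  - apply: bm_itg; apply: bm_norm; apply: bmB; first exact: bm_dqinner.
    by apply: bmM; [exact: bmB|exact: bm_cst].
  - exact: itgD (itgZ _ (bm_itg PP bedev)) (itgZ _ (bm_itg PP bNN)).
  move=> p; have c1 := bm_sectl p b1; have c2 := bm_sectl p b2.
  have cp := bm_sectl p bp; have cm := bm_sectl p bmn.
  have J1 := bm_itg gauss (bmX 2 c1); have J2 := bm_itg gauss (bmX 2 c2).
  have Jp := bm_itg gauss (bmX 2 cp); have Jm := bm_itg gauss (bmX 2 cm).
  have J12 := bm_itg gauss (bmM c1 c2).
  have Jd := bm_itg gauss (bm_sectl p bdev).
  have Jpm := itgB Jp Jm; have Jpm2 := itgZ 2^-1 Jpm.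
  have JJ := itgD (itgD (itgD J1 J2) Jp) Jm.
  have -> : dqinner p - (N' (xp p) - N' (xm p)) / 2 =
     Ex gauss (fun y => dq y p.1 * dq y p.2 - 2^-1 * (dq y (xp p) ^+ 2 - dq y (xm p) ^+ 2)).
    by rewrite (ExB J12 Jpm2) (ExZ _ Jpm) (ExB Jp Jm) mulrC.
  have -> : (4 * l)^-1 * edev p + l / 2 * (N' p.1 + N' p.2 + N' (xp p) + N' (xm p)) =
     Ex gauss (fun y => (4 * l)^-1 * dev p y + l / 2 *
       (dq y p.1 ^+ 2 + dq y p.2 ^+ 2 + dq y (xp p) ^+ 2 + dq y (xm p) ^+ 2)).
    rewrite (ExD (itgZ _ Jd) (itgZ _ JJ)) (ExZ _ Jd) (ExZ _ JJ).
    by rewrite (ExD (itgD (itgD J1 J2) Jp) Jm) (ExD (itgD J1 J2) Jp) (ExD J1 J2).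
  apply: (le_trans (Ex_norm_le (itgB J12 Jpm2))); apply: le_Ex.
  - apply: bm_itg; apply: bm_norm; apply: bmB; first exact: bmM.
    by apply: bmM; [exact: bm_cst|apply: bmB; exact: bmX].
  - exact: itgD (itgZ _ Jd) (itgZ _ JJ).
  move=> y; rewrite /dev; move: (dq y p.1) (dq y p.2) (dq y (xp p)) (dq y (xm p)) => x z wp wm.
  have h1 := young_sqr (r * (x + z)) wp l0; have h2 := young_sqr (r * (x - z)) wm l0.
  have -> : x * z - 2^-1 * (wp ^+ 2 - wm ^+ 2) =
    2^-1 * (((r * (x + z)) ^+ 2 - wp ^+ 2) - ((r * (x - z)) ^+ 2 - wm ^+ 2)).
    by rewrite !exprMn r2; field.
  rewrite normrM ger0_norm//; apply: (le_trans (ler_wpM2l _ (ler_normB _ _))) => //.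
  apply: (le_trans (ler_wpM2l _ (lerD h1 h2))) => //.
  rewrite !exprMn r2 le_eqVlt; apply/orP; left; apply/eqP.
  by field; rewrite gt_eqF.
have Ie := bm_itg PP bedev; have IN := bm_itg PP bNN.
rewrite (ExD (itgZ _ Ie) (itgZ _ IN)) (ExZ _ Ie) (ExZ _ IN).
rewrite (ExD (bm_itg PP (bmD (bmD bN1 bN2) bNp)) (bm_itg PP bNm)).
rewrite (ExD (bm_itg PP (bmD bN1 bN2)) (bm_itg PP bNp)).
rewrite (ExD (bm_itg PP bN1) (bm_itg PP bN2)).
have -> : E (fun p => N' (xp p)) = B2.
  by rewrite -(Ex_sqdqT c s bF); exact: (E_rot1 q4 bN).
have -> : E (fun p => N' (xm p)) = B2.
  by rewrite -(Ex_sqdqT c s bF); exact: (E_rot1 (- q4) bN).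
have -> : E (fun p => N' p.1) = B2 by rewrite -(Ex_sqdqT c s bF); exact/esym/(Ex_fst bN).
have -> : E (fun p => N' p.2) = B2 by rewrite -(Ex_sqdqT c s bF); exact/esym/(Ex_snd bN).
apply: lerD; last by rewrite le_eqVlt; apply/orP; left; apply/eqP; field.
rewrite mulrC ler_wpM2r//; first by rewrite invr_ge0; lra.
rewrite /edev (Ex_swap PP gauss bdev).
have Im := itg_mlinerr K c s bF; have Ic := itg_cst gauss (6 * Kq * mom4).
apply: (@le_trans _ _ (Ex gauss (fun y => 12 * mlinerr F K c s y + 6 * Kq * mom4))).
  apply: le_Ex; [exact: bm_itg (bm_Exr PP bdev)|exact: itgD (itgZ _ Im) Ic|exact: Ex_dev].
rewrite (ExD (itgZ _ Im) Ic) (ExZ _ Im) Ex_cst (Ex_mlinerr K c s bF).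
have : Kq * (1 + 2 * mom4) <= TH.
  by rewrite /tlinerr lerDr; apply: Ex_ge0 => p; apply: mulr_ge0 => //; exact: sqr_ge0.
have := kq0.
by have := mulr_ge0 kq0 m4_ge0; lra.
Qed.

End polarization.

(** * Bessel inequality and the contradiction *)

Lemma eq_opp0 (R : numDomainType) (v : R) : v = - v -> v = 0.
Proof. by move/eqP; rewrite -addr_eq0 -mulr2n mulrn_eq0 => /eqP. Qed.

Section bessel.
Context {R : realType} d (T : measurableType d) (P : probability T R).

(** The projection of g to the span of f1 and f2 has norm at most that of g. *)
Lemma bessel2 (f1 f2 g : T -> R) (A : R) : bm f1 -> bm f2 -> bm g ->
  Ex P (fun x => f1 x ^+ 2) = A -> Ex P (fun x => f2 x ^+ 2) = A ->
  Ex P (fun x => f1 x * f2 x) = 0 ->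
  Ex P (fun x => f1 x * g x) ^+ 2 + Ex P (fun x => f2 x * g x) ^+ 2 <=
  A * Ex P (fun x => g x ^+ 2).
Proof.
move=> b1 b2 bg A1 A2 o12.
set u := Ex P (fun x => f1 x * g x); set v := Ex P (fun x => f2 x * g x).
set S := u ^+ 2 + v ^+ 2.
have bc (k : R) : bm (fun _ : T => k) by exact: bm_cst.
have bh : bm (fun x => u * f1 x + v * f2 x) by bm_tac.
have I1 := bm_itg P (bmX 2 b1); have I2 := bm_itg P (bmX 2 b2).
have I12 := bm_itg P (bmM b1 b2).
have J1 := bm_itg P (bmM b1 bg); have J2 := bm_itg P (bmM b2 bg).
have := Ex_CS P bh bg.
have -> : Ex P (fun x => (u * f1 x + v * f2 x) * g x) = S.
  transitivity (Ex P (fun x => u * (f1 x * g x) + v * (f2 x * g x))).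
    by apply: eq_Ex => x; ring.
  by rewrite (ExD (itgZ _ J1) (itgZ _ J2)) (ExZ _ J1) (ExZ _ J2) -/u -/v /S; ring.
have -> : Ex P (fun x => (u * f1 x + v * f2 x) ^+ 2) = A * S.
  transitivity (Ex P (fun x => u ^+ 2 * f1 x ^+ 2 + 2 * u * v * (f1 x * f2 x) + v ^+ 2 * f2 x ^+ 2)).
    by apply: eq_Ex => x; ring.
  rewrite (ExD (itgD (itgZ _ I1) (itgZ _ I12)) (itgZ _ I2)) (ExD (itgZ _ I1) (itgZ _ I12)).
  by rewrite (ExZ _ I1) (ExZ _ I12) (ExZ _ I2) A1 A2 o12 /S; ring.
have S0 : 0 <= S by rewrite addr_ge0 ?sqr_ge0.
have [->|Sn] := eqVneq S 0.
  move=> _; apply: mulr_ge0; last by apply: Ex_ge0 => x; exact: sqr_ge0.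
  by rewrite -A1; apply: Ex_ge0 => x; exact: sqr_ge0.
have Sp : 0 < S by rewrite lt_neqAle eq_sym Sn.
by rewrite expr2 mulrAC ler_pM2r.
Qed.

End bessel.

Section complex_bessel.
Context {R : realType} (n : nat).
Local Notation T := ((n + n).-tuple (measurableTypeR R)).
Local Notation gauss := (@gauss_tuple R (n + n)).
Local Notation PP := (prod_prob gauss gauss).
Local Notation E := (Ex PP).
Variables (F : T -> R) (c s : R).
Hypothesis bF : bm F.
Hypothesis FJ : forall x, F (rotJ x) = F x.

Local Notation dq := (dquot F c s).

Lemma rotJK (x : T) : rotJ (rotJ x) = oppt x.
Proof.
apply: eq_from_tnth => i; rewrite tnth_oppt; case: (split_ordP i) => j ->.
  by rewrite tnth_rotJl tnth_rotJr.
by rewrite tnth_rotJr tnth_rotJl.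
Qed.

Lemma rotJ_opp x : F (oppt x) = F x.
Proof. by rewrite -rotJK !FJ. Qed.

Lemma comb_rotJ a b (x y : T) : comb a b (rotJ x) (rotJ y) = rotJ (comb a b x y).
Proof.
apply: eq_from_tnth => i; rewrite tnth_comb; case: (split_ordP i) => j ->.
  by rewrite !tnth_rotJl tnth_comb; ring.
by rewrite !tnth_rotJr tnth_comb.
Qed.

Lemma dquot_rotJ x y : dq (rotJ x) (rotJ y) = dq x y.
Proof. by rewrite /dquot !comb_rotJ !FJ. Qed.

Lemma dquot_oppl x y : dq (oppt x) y = - dq x y.
Proof.
have e a b : F (comb a b (oppt x) y) = F (comb a (- b) x y).
  rewrite -rotJ_opp oppt_comb; congr F; apply: eq_from_tnth => i.
  by rewrite !tnth_comb tnth_oppt; ring.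
by rewrite /dquot !e opprK -mulNr opprB.
Qed.

(** For fixed x the functions dquot (., x) and dquot (., i x) are orthogonal of equal
norm, because dquot is invariant under the simultaneous multiplication by i and
odd in its first argument.  Bessel's inequality against dquot (., z) bounds
a(x, z)^2 + a(i x, z)^2 by N(x) N(z); both squares have the same mean. *)
Lemma dqinner_sqr : 2 * E (fun p => dqinner F c s p ^+ 2) <= E (fun p => dq p.1 p.2 ^+ 2) ^+ 2.
Proof.
pose a (p : T * T) := dqinner F c s p.
have ba : bm a := bm_dqinner c s bF.
pose N := sqdqT F c s; have bN : bm N := bm_sqdqT c s bF.
have bj : bm (fun p : T * T => a (rotJ p.1, p.2)).
  apply: (bm_comp (f := a) ba (h := fun p => (rotJ p.1, p.2))).
  apply: measurable_fun_pair; last exact: measurable_snd.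
  exact: measurableT_comp (@measurable_rotJ R n) measurable_fst.
have e1 : E (fun p : T * T => a (rotJ p.1, p.2) ^+ 2) = E (fun p => a p ^+ 2).
  rewrite (Ex_fubini2 gauss gauss (bmX 2 bj)) (Ex_fubini2 gauss gauss (bmX 2 ba)).
  by apply: eq_Ex => y; exact: (Ex_rotJ (bm_sectr y (bmX 2 ba))).
have bN12 : bm (fun p : T * T => N p.1 * N p.2).
  by apply: bmM; [exact: bm_comp bN measurable_fst|exact: bm_comp bN measurable_snd].
have e2 : E (fun p => N p.1 * N p.2) = E (fun p => dq p.1 p.2 ^+ 2) ^+ 2.
  have IN := bm_itg gauss bN.
  rewrite (Ex_fubini1 gauss gauss bN12) -(Ex_sqdqT c s bF) -/N expr2 -(ExZ _ IN).
  by apply: eq_Ex => x; apply: etrans (ExZ (N x) IN) _; exact: mulrC.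
have ba2 := bmX 2 ba; have bj2 := bmX 2 bj.
rewrite -e2 mulr_natl mulr2n -{1}e1 -ExD; [|exact: bm_itg|exact: bm_itg].
apply: le_Ex; [exact: bm_itg (bmD bj2 ba2)|exact: bm_itg|].
move=> [x z]; rewrite addrC /a /dqinner /=.
have b1 (w : T) : bm (fun y => dq y w) := bm_sectr w (bm_dquot c s bF).
have A2 : Ex gauss (fun y => dq y (rotJ x) ^+ 2) = N x.
  apply: etrans (esym (Ex_rotJ (bmX 2 (b1 (rotJ x))))) _.
  by apply: eq_Ex => y; rewrite dquot_rotJ.
have o12 : Ex gauss (fun y => dq y x * dq y (rotJ x)) = 0.
  apply: eq_opp0; have b2 := bmM (b1 x) (b1 (rotJ x)).
  apply: etrans (esym (Ex_rotJ b2)) _; rewrite -(ExN (bm_itg gauss b2)).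
  apply: eq_Ex => y; rewrite dquot_rotJ -(dquot_rotJ (rotJ y)) rotJK dquot_oppl.
  by rewrite mulNr mulrC.
exact: (bessel2 (b1 x) (b1 (rotJ x)) (b1 z) (erefl (N x)) A2 o12).
Qed.

End complex_bessel.

Lemma sqr_sin_dyadic_le (R : realType) (m : nat) :
  [/\ 0 <= cos (pi / 2 ^+ m.+3 : R), 0 < sin (pi / 2 ^+ m.+3 : R) &
      sin (pi / 2 ^+ m.+3 : R) ^+ 2 <= 2^-1 ^+ m].
Proof.
have pos k : 0 < pi / 2 ^+ k.+3 :> R by rewrite divr_gt0 ?pi_gt0 ?exprn_gt0.
have le k : pi / 2 ^+ k.+3 <= pi / 4 / 2 :> R.
  have -> : pi / 4 / 2 = pi / 2 ^+ 3 :> R by field.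
  rewrite ler_pM2l ?pi_gt0// lef_pV2 ?posrE ?exprn_gt0//.
  by apply: ler_weXn2l => //; rewrite ler1n.
have p0 := pi_gt0 R.
split.
- by apply: cos_ge0_pihalf; have := pos m; have := le m; lra.
- by apply: sin_gt0_pihalf; have := pos m; have := le m; lra.
elim: m => [|m IH].
  by rewrite expr0 sin2cos2 lerBlDr lerDl sqr_ge0.
set h := pi / 2 ^+ m.+4; have h2 : h *+ 2 = pi / 2 ^+ m.+3.
  by rewrite /h -mulr_natl [2 ^+ m.+4]exprS; field; rewrite expf_neq0.
have c2 : 0 <= cos (h *+ 2).
  by apply: cos_ge0_pihalf; rewrite h2; have := pos m; have := le m; lra.
rewrite -h2 sin_mulr2n in IH; rewrite cos_mulr2n cos2sin2 in c2.
have s2 : sin h ^+ 2 <= 2^-1 by lra.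
have IH' : 4 * (sin h ^+ 2 * (1 - sin h ^+ 2)) <= 2^-1 ^+ m.
  by apply: le_trans IH; rewrite -cos2sin2 le_eqVlt; apply/orP; left; apply/eqP; ring.
rewrite [2^-1 ^+ m.+1]exprS; move: (sqr_ge0 (sin h)) s2 IH'.
move: (sin h ^+ 2) (2^-1 ^+ m) => u q u0 u2 H.
by have := mulr_ge0 u0 (_ : 0 <= 2^-1 - u); rewrite subr_ge0 => /(_ u2); lra.
Qed.

(** With t = l^2 the excess over the equality case is O(t).  Weighted Young
inequalities with weight l turn it into an error of order l, which the last
assumption on L l makes small against the gap between 2 VF, about 4, and B2^2 / 8,
about 2.  Here s2 stands for sin^2 h, B2 for E b^2, SY for the asymmetry and TH
for the linearization error. *)
Lemma closing_estimates (R : realFieldType) (l t s2 Z Y EF VF e B2 SY TH : R) :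
  0 < l -> l <= 4000^-1 -> t = l ^+ 2 ->
  0 <= s2 -> 0 <= Y -> Y <= Z -> (200 + Z) * s2 <= t ->
  0 <= EF -> EF <= 1 + t -> 2 - t <= VF ->
  e <= 4 * (1 + t) * (EF + s2) + Z * s2 -> 2 * VF <= e ->
  2 * VF * (1 - s2) <= B2 -> B2 <= e ->
  SY <= 4 * e - 8 * VF ->
  TH <= (18 * e - 24 * VF * (1 - s2) - 12 * VF) / 2 + s2 * Y ->
  (2 * (4 * l * EF + 4 * (1 + l) * s2 + (1 + l^-1) * TH) - B2 + 4 * EF) +
  (SY / (2 * l) + 2 * l * B2) + (15 * TH / (4 * l) + 2 * l * B2) <= 1200 * l /\
  (forall L, L * l <= 4000^-1 -> 2 * VF <= B2 ^+ 2 / 8 + L * (1200 * l) -> False).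
Proof.
move=> l0 l1 tE s20 Y0 YZ sZ EF0 EF1 VF2 e_le e_ge B2_ge B2_le SY_le TH_le.
have t0 : 0 < t by rewrite tE exprn_gt0.
have tl : t <= l / 4000 by rewrite tE expr2 ler_wpM2l// ltW.
have lt : l^-1 * t = l by rewrite tE; field; rewrite gt_eqF.
have t1 : t <= 1000^-1 by clear - l1 l0 tl; lra.
have Zs : 200 * s2 + Z * s2 <= t by rewrite -mulrDl.
have Zs0 : 0 <= Z * s2 by rewrite mulr_ge0// (le_trans Y0).
have e4 : e <= 4 + 13 * t.
  apply: (le_trans e_le).
  have h1 : (1 + t) * (EF + s2) <= (1 + t) * (1 + t + s2).
    by rewrite ler_wpM2l//; [clear - t0; lra|rewrite lerD2r].
  have h2 : t * t <= t * 1000^-1 by rewrite ler_wpM2l// ltW.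
  have h3 : t * s2 <= 1000^-1 * s2 by rewrite ler_wpM2r.
  by move: (Z * s2) Zs Zs0 => q q1 q2; clear - h1 h2 h3 s20 t0 q1 q2; lra.
have VF3 : VF <= 3 by clear - e4 e_ge t1; lra.
have VFs : VF * s2 <= 3 * s2 by rewrite ler_wpM2r.
have TH136 : TH <= 136 * t.
  have h1 : s2 * Y <= Z * s2 by rewrite mulrC ler_wpM2r.
  move: (Z * s2) (s2 * Y) h1 Zs TH_le => q q' h1 hZ h2.
  by clear - h1 hZ h2 VFs e4 VF2 s20 t0; lra.
have li : 0 < l^-1 by rewrite invr_gt0.
split.
  have -> : SY / (2 * l) = l^-1 * SY / 2 by field; rewrite gt_eqF.
  have -> : 15 * TH / (4 * l) = 15 / 4 * (l^-1 * TH) by field; rewrite gt_eqF.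
  have h1 : l^-1 * TH <= 136 * l.
    by rewrite -[X in 136 * X]lt mulrCA ler_wpM2l// ltW.
  have h2 : l^-1 * SY <= 60 * l.
    rewrite -[X in 60 * X]lt mulrCA; apply: ler_wpM2l; first exact: ltW.
    by clear - SY_le e4 VF2; lra.
  have h3 : l * B2 <= l * 5.
    by apply: ler_wpM2l; [exact: ltW|clear - B2_le e4 t1; lra].
  have h4 : l * EF <= l * 2 by apply: ler_wpM2l; [exact: ltW|clear - EF1 t1; lra].
  have h5 : l * s2 <= 1 * s2 by rewrite ler_wpM2r//; clear - l1; lra.
  have h6 : 200 * s2 <= t by clear - Zs Zs0; lra.
  have -> : (1 + l^-1) * TH = TH + l^-1 * TH by ring.
  move: (l^-1 * TH) (l^-1 * SY) h1 h2 => x y h1 h2.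
  by clear - h1 h2 h3 h4 h5 h6 tl TH136 B2_ge VF2 EF1 VFs l0 t0 s20; lra.
move=> L Ll H.
have B24 : B2 <= 4 + 13 / 1000 by clear - B2_le e4 t1; lra.
have B20 : 0 <= B2.
  have h : 0 <= 1 - s2 by clear - Zs Zs0 t1 s20; lra.
  by apply: le_trans B2_ge; rewrite mulr_ge0//; clear - VF2 t1; lra.
have B22 := ler_wpM2r B20 B24; rewrite -expr2 in B22.
by clear - H Ll VF2 t1 B24 B22; lra.
Qed.

Section numeric_closing.
Context {R : realFieldType}.

(** The form in which the approximation of a by 2 v is used: v^2 is compared with
u^2 / 4 through their difference times v, so that only a bound on |2 v - u| in
mean is required. *)
Lemma half_sqr_le (u v q : R) : (2 * v - u) * v <= q -> v ^+ 2 <= 4^-1 * u ^+ 2 + q.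
Proof. by move=> h; have := sqr_ge0 (u / 2 - v); lra. Qed.

Lemma quarter_le (u v : R) : 2 * u <= v -> 4^-1 * u <= v / 8.
Proof. by lra. Qed.

Lemma sum3_le (u w x y z : R) : u <= w -> x <= y + z ->
  u + (2^-1 * x + 2^-1 * x) <= y + z + w.
Proof. by lra. Qed.

End numeric_closing.

Section core.
Context {R : realType} (n : nat).
Local Notation T := ((n + n).-tuple (measurableTypeR R)).
Local Notation gauss := (@gauss_tuple R (n + n)).
Local Notation PP := (prod_prob gauss gauss).
Local Notation E := (Ex PP).

(** A function invariant under i with the gradient bound of a squared
1-Lipschitz function cannot have the mean and the variance of the square of a
standard Gaussian variable.  The angle h is taken small after K, so that the
second-order terms do not matter. *)
Theorem no_chi_square_profile (F : T -> R) (L l : R) :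
  bm F -> (forall x, 0 <= F x) -> (forall x, F x <= L) ->
  (forall x, F (rotJ x) = F x) -> semiconcave F ->
  0 < l -> 1 <= L -> L * l <= 4000^-1 ->
  Ex gauss F <= 1 + l ^+ 2 -> 2 - l ^+ 2 <= variance_of F -> False.
Proof.
move=> bF F0 FL FJ Fsc l0 L1 Ll EF1 VF2.
have Fopp := rotJ_opp FJ.
have [K K0 Kstep] := semiconcave_affine_bound F0 FL Fsc.
have l1 : l <= 4000^-1 by apply: le_trans Ll; rewrite ler_peMl// ltW.
set t := l ^+ 2 in EF1 VF2.
have t0 : 0 < t by rewrite exprn_gt0.
have tl : t <= l / 4000 by rewrite /t expr2 ler_wpM2l// ltW.
have ti : 0 < t^-1 by rewrite invr_gt0.
have m0 := mom4_ge0 (R := R) (n + n).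
set m4 := mom4 (n + n) in m0.
pose Z := 6 * (1 + t^-1) * K ^+ 2 * (1 + 2 * m4).
pose Y := 6 * K ^+ 2 * (1 + 2 * m4).
have K2 : 0 <= K ^+ 2 by exact: sqr_ge0.
have m41 : 0 <= 1 + 2 * m4 by rewrite addr_ge0// mulr_ge0.
have Y0 : 0 <= Y by rewrite /Y mulr_ge0// mulr_ge0.
have Z0 : 0 <= Z.
  have -> : Z = (1 + t^-1) * Y by rewrite /Z /Y; ring.
  by rewrite mulr_ge0// addr_ge0// ltW.
have YZ : Y <= Z.
  have -> : Z = (1 + t^-1) * Y by rewrite /Z /Y; ring.
  by rewrite ler_peMl// lerDl ltW.
(* h is so small that the second-order terms are below the tolerance t *)
have [m sm] : exists m, (200 + Z) * sin (pi / 2 ^+ m.+3 : R) ^+ 2 <= t.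
  have [k _ /(_ k (leqnn k)) /= hk] := half_lt (200 + Z) t0.
  exists k; apply: le_trans (ltW hk).
  have [_ _ H] := sqr_sin_dyadic_le R k.
  by apply: ler_wpM2l H; exact: addr_ge0.
have [c0 s0 _] := sqr_sin_dyadic_le R m.
have cs := cos2Dsin2 (pi / 2 ^+ m.+3 : R).
set h := pi / 2 ^+ m.+3 in sm c0 s0 cs.
set c := cos h in c0 cs; set s := sin h in sm s0 cs.
have s20 : 0 < s ^+ 2 by rewrite exprn_gt0.
have sn0 : s != 0 by rewrite gt_eqF.
have EF0 : 0 <= Ex gauss F by exact: Ex_ge0.
set VF := variance_of F in VF2.
pose e := E (fun p => (F (comb c s p.1 p.2) - F p.1) ^+ 2).
have c2 : c ^+ 2 = 1 - s ^+ 2 by rewrite -cs addrK.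
have e_le : e / s ^+ 2 <= 4 * (1 + t) * (Ex gauss F + s ^+ 2) + Z * s ^+ 2.
  rewrite ler_pdivrMr// mulrC; apply: le_trans (sqr_incr_le bF K0 Kstep t0 c0 s0 cs) _.
  rewrite -/m4 le_eqVlt; apply/orP; left; apply/eqP.
  by rewrite /Z; ring.
have e_ge : 8 * VF * s ^+ 2 <= 4 * e.
  apply: le_trans (incr_diff_ge m bF Fopp) _; exact: incr_diff_le.
pose B2 := E (fun p => dquot F c s p.1 p.2 ^+ 2).
have rotm p : rot (- h) p = (comb c (- s) p.1 p.2, comb s c p.1 p.2).
  by rewrite /rot cosN sinN opprK.
have bch : bm (fun p => (F (rot h p).1 - F (rot (- h) p).1) ^+ 2).
  by apply: bmX; apply: bmB; apply: (bm_comp (bm_comp bF measurable_fst) (measurable_rotT _)).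
have B2E : B2 = (4 * s ^+ 2)^-1 * E (fun p => (F (rot h p).1 - F (rot (- h) p).1) ^+ 2).
  rewrite -(ExZ _ (bm_itg PP bch)); apply: eq_Ex => p.
  by rewrite rotm /dquot /rot /=; field.
have B2_ge : 2 * VF * (1 - s ^+ 2) <= B2.
  have := chord_ge m bF Fopp; rewrite -/h -/s -/c c2 -/VF B2E => H.
  rewrite -ler_pdivrMl ?invr_gt0 ?mulr_gt0// invrK; apply: le_trans H.
  by rewrite le_eqVlt; apply/orP; left; apply/eqP; ring.
have B2_le : B2 <= e / s ^+ 2.
  rewrite B2E mulrC ler_pdivrMr ?mulr_gt0//; apply: le_trans (chord_le m bF) _.
  by rewrite -/e le_eqVlt; apply/orP; left; apply/eqP; field.
pose SY := E (fun p => (dquot F c s p.1 p.2 - dquot F c s p.2 p.1) ^+ 2).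
have SY_le : SY <= 4 * (e / s ^+ 2) - 8 * VF.
  have bM : bm (fun p => ((F (rot h p).1 + F (rot h p).2) - (F (rot (- h) p).1 + F (rot (- h) p).2)) ^+ 2).
    apply: bmX; apply: bmB; apply: bmD; apply: (bm_comp bF);
    by [exact: measurableT_comp measurable_fst (measurable_rotT _)|
        exact: measurableT_comp measurable_snd (measurable_rotT _)].
  have -> : SY = (4 * s ^+ 2)^-1 *
      E (fun p => ((F (rot h p).1 + F (rot h p).2) - (F (rot (- h) p).1 + F (rot (- h) p).2)) ^+ 2).
    rewrite -(ExZ _ (bm_itg PP bM)); apply: eq_Ex => p.
    have e1 : comb (- s) c p.1 p.2 = comb c (- s) p.2 p.1.
      by apply: eq_from_tnth => i; rewrite !tnth_comb addrC.
    have e2 : comb s c p.1 p.2 = comb c s p.2 p.1.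
      by apply: eq_from_tnth => i; rewrite !tnth_comb addrC.
    by rewrite rotm /dquot /rot /= -/s -/c e1 e2; field.
  rewrite mulrC ler_pdivrMr ?mulr_gt0//; apply: le_trans (sum_chord_le m bF Fopp) _.
  rewrite -/h -/s -/VF -/e le_eqVlt; apply/orP; left; apply/eqP.
  by field.
pose TH := tlinerr F K c s.
have TH_le : TH <= (18 * (e / s ^+ 2) - 24 * VF * (1 - s ^+ 2) - 12 * VF) / 2 + s ^+ 2 * Y.
  have bV : bm (fun p => ((F (rot h p).1 + F (rot (- h) p).1) - 2 * F p.1) ^+ 2).
    apply: bmX; apply: bmB; [apply: bmD; apply: (bm_comp bF)|apply: bmM; first exact: bm_cst].
    - exact: measurableT_comp measurable_fst (measurable_rotT _).
    - exact: measurableT_comp measurable_fst (measurable_rotT _).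
    - exact: bm_comp bF measurable_fst.
  rewrite /TH /tlinerr -/m4.
  have -> : E (fun p => (sdiff F c s p.1 p.2 / s) ^+ 2 / 2) =
      (2 * s ^+ 2)^-1 * E (fun p => ((F (rot h p).1 + F (rot (- h) p).1) - 2 * F p.1) ^+ 2).
    rewrite -(ExZ _ (bm_itg PP bV)); apply: eq_Ex => p.
    by rewrite rotm /sdiff /rot /= -/s -/c; field.
  have -> : 6 * s ^+ 2 * K ^+ 2 * (1 + 2 * m4) = s ^+ 2 * Y by rewrite /Y; ring.
  rewrite lerD2r mulrC ler_pdivrMr ?mulr_gt0//.
  apply: le_trans (second_diff_le m bF Fopp) _.
  rewrite -/h -/s -/c c2 -/VF -/e le_eqVlt; apply/orP; left; apply/eqP.
  by field.
have e_ge' : 2 * VF <= e / s ^+ 2.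
  have e84 : 8 * VF * s ^+ 2 = 4 * (2 * VF * s ^+ 2) by ring.
  by rewrite ler_pdivlMr//; move: e_ge; rewrite e84 ler_pM2l.
have [W_le] := closing_estimates l0 l1 (erefl t) (ltW s20) Y0 YZ sm EF0 EF1 VF2 e_le e_ge'
  B2_ge B2_le SY_le TH_le.
apply; first exact: Ll.
pose q4 : R := pi / 4.
pose xp (p : T * T) : T := (rot q4 p).1; pose xm (p : T * T) : T := (rot (- q4) p).1.
have mxp : measurable_fun [set: T * T] xp := measurableT_comp measurable_fst (measurable_rotT q4).
have mxm : measurable_fun [set: T * T] xm := measurableT_comp measurable_fst (measurable_rotT (- q4)).
pose a := dqinner F c s; have ba : bm a := bm_dqinner c s bF.
pose N' := sqdqT F c s; have bN : bm N' := bm_sqdqT c s bF.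
pose Bf p := F (xp p) - F (xm p).
have bBf : bm Bf := bmB (bm_comp bF mxp) (bm_comp bF mxm).
have bG : bm (fun p : T * T => F p.1) := bm_comp bF measurable_fst.
have EBf : E (fun p => Bf p ^+ 2) = 2 * VF.
  rewrite -(cov_diff0 bF) [LHS](E_incr q4 (- q4) bG).
  rewrite (_ : - q4 - q4 = - (pi / 2)); last by rewrite /q4; field.
  rewrite covN// -[pi / 2]subr0 -(E_incr 0 (pi / 2) bG) /cov.
  by apply: eq_Ex => p; rewrite !rot0 rot_pihalf expr2.
pose dN x := `|N' x - 4 * F x|.
have b4F : bm (fun x => 4 * F x) := bmM (bm_cst _ 4) bF.
have bdN : bm dN := bm_norm (bmB bN b4F).
have EdN : Ex gauss dN <= (2 * (4 * l * Ex gauss F + 4 * (1 + l) * s ^+ 2 + (1 + l^-1) * TH) - B2 + 4 * Ex gauss F)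
    + (SY / (2 * l) + 2 * l * B2).
  have bN0 : bm (sqdq F c s) := bm_sqdq c s bF.
  have i1 := bm_itg gauss (bm_norm (bmB bN0 b4F)).
  have i2 := bm_itg gauss (bm_norm (bmB bN bN0)).
  apply: le_trans (lerD (sqdq_close bF F0 Kstep c0 s0 cs l0) (sqdqT_close c s bF l0)).
  rewrite -(ExD i1 i2); apply: le_Ex; [exact: bm_itg|exact: itgD|].
  move=> x; rewrite /dN [leRHS]addrC; apply: le_trans (ler_normD _ _).
  by rewrite -/(N' x) subrKA.
have Edp : E (fun p => dN (xp p)) = Ex gauss dN.
  have b1 := bm_comp bdN (@measurable_fst _ _ T T).
  rewrite [LHS](E_rot q4 b1) (Ex_fubini1 gauss gauss b1).
  by apply: eq_Ex => x /=; rewrite Ex_cst.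
have Edm : E (fun p => dN (xm p)) = Ex gauss dN.
  have b1 := bm_comp bdN (@measurable_fst _ _ T T).
  rewrite [LHS](E_rot (- q4) b1) (Ex_fubini1 gauss gauss b1).
  by apply: eq_Ex => x /=; rewrite Ex_cst.
pose dA p := `|a p - (N' (xp p) - N' (xm p)) / 2|.
have EdA : E dA <= 15 * TH / (4 * l) + 2 * l * B2 := dqinner_close bF Kstep c0 s0 cs l0.
have bdA : bm dA.
  exact: bm_norm (bmB ba (bmM (bmB (bm_comp bN mxp) (bm_comp bN mxm)) (bm_cst _ _))).
have iA := bm_itg PP bdA; have ip := bm_itg PP (bm_comp bdN mxp).
have im := bm_itg PP (bm_comp bdN mxm); have ia := bm_itg PP (bmX 2 ba).
have iW := itgD iA (itgD (itgZ 2^-1 ip) (itgZ 2^-1 im)).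
rewrite -EBf.
apply: (@le_trans _ _ (E (fun p => 4^-1 * a p ^+ 2 +
    L * (dA p + (2^-1 * dN (xp p) + 2^-1 * dN (xm p)))))).
  apply: le_Ex; [exact: bm_itg (bmX 2 bBf)|exact: itgD (itgZ _ ia) (itgZ _ iW)|].
  move=> p; have BL : `|Bf p| <= L.
    have := F0 (xp p); have := F0 (xm p); have := FL (xp p); have := FL (xm p).
    rewrite /Bf; move: (F _) (F _) => u v h1 h2 h3 h4; clear - h1 h2 h3 h4.
    by rewrite ler_norml; apply/andP; split; lra.
  have dev : `|2 * Bf p - a p| <= dA p + (2^-1 * dN (xp p) + 2^-1 * dN (xm p)).
    rewrite /dA /dN /Bf; move: (F (xp p)) (F (xm p)) (N' (xp p)) (N' (xm p)) (a p) => u v x y w.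
    have -> : 2 * (u - v) - w = - ((w - (x - y) / 2) + (2^-1 * (x - 4 * u) - 2^-1 * (y - 4 * v))).
      by field.
    rewrite normrN; apply: le_trans (ler_normD _ _) _; rewrite lerD2l.
    have h2 : `|2^-1| = 2^-1 :> R by rewrite ger0_norm.
    by apply: le_trans (ler_normB _ _) _; rewrite !normrM h2.
  have L0 : 0 <= L by apply: le_trans L1.
  apply: le_trans (lerD (lexx _) (ler_wpM2l L0 dev)).
  have : (2 * Bf p - a p) * Bf p <= L * `|2 * Bf p - a p|.
    rewrite mulrC; apply: le_trans (ler_norm _) _; rewrite normrM.
    exact: ler_wpM2r.
  by move=> hb; exact: half_sqr_le.
rewrite (ExD (itgZ _ ia) (itgZ _ iW)) (ExZ _ ia) (ExZ _ iW).
rewrite (ExD iA (itgD (itgZ 2^-1 ip) (itgZ 2^-1 im))) (ExD (itgZ 2^-1 ip) (itgZ 2^-1 im)).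
rewrite (ExZ _ ip) (ExZ _ im) Edp Edm.
apply: lerD.
  have hq := dqinner_sqr c s bF FJ.
  exact: quarter_le hq.
apply: ler_wpM2l; first exact: le_trans L1.
apply: le_trans W_le.
exact: sum3_le EdA EdN.
Qed.

End core.

(** * Regularization by inf-convolution *)

Section moreau.
Context {R : realType} (X : metricType R) (v : X -> R) (e : R).
Hypothesis v0 : forall x, 0 <= v x.
Hypothesis vlip : forall x y, v x - v y <= mdist x y.
Hypothesis e0 : 0 < e.

(** A smooth substitute for the distance: the inf-convolution with it keeps Lipschitz
functions Lipschitz, moves them by at most e, and has bounded second
differences from above. *)
Definition soft_mdist (x y : X) : R := Num.sqrt (e ^+ 2 + mdist x y ^+ 2).

Definition softconv (x : X) : R := inf (range (fun y => v y + soft_mdist x y)).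

Lemma soft_arg_gt0 (x y : X) : 0 < e ^+ 2 + mdist x y ^+ 2.
Proof. by rewrite ltr_wpDr ?sqr_ge0// exprn_gt0. Qed.

Lemma sqr_soft_mdist (x y : X) : soft_mdist x y ^+ 2 = e ^+ 2 + mdist x y ^+ 2.
Proof. by rewrite sqr_sqrtr// ltW// soft_arg_gt0. Qed.

Lemma soft_mdist_ge_e (x y : X) : e <= soft_mdist x y.
Proof.
rewrite -{1}(gtr0_norm e0) -sqrtr_sqr; apply: ler_wsqrtr.
by rewrite lerDl sqr_ge0.
Qed.

Lemma soft_mdist_ge (x y : X) : mdist x y <= soft_mdist x y.
Proof.
rewrite -{1}(ger0_norm (mdist_ge0 x y)) -sqrtr_sqr; apply: ler_wsqrtr.
by rewrite lerDr sqr_ge0.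
Qed.

Lemma soft_mdist_lip (x x' y : X) : soft_mdist x y <= soft_mdist x' y + mdist x x'.
Proof.
have h0 : 0 <= soft_mdist x' y + mdist x x'.
  by apply: addr_ge0; [exact: sqrtr_ge0|exact: mdist_ge0].
rewrite -(@ler_pXn2r _ 2)// ?nnegrE ?sqrtr_ge0//.
rewrite sqr_soft_mdist sqrrD sqr_soft_mdist.
have h1 := metric_triangle x x' y; have h2 := soft_mdist_ge x' y.
have h3 := mdist_ge0 x x'; have h4 := mdist_ge0 x' y; have h5 := mdist_ge0 x y.
have h6 : mdist x y ^+ 2 <= (mdist x x' + mdist x' y) ^+ 2.
  by rewrite ler_pXn2r// nnegrE addr_ge0.
have h7 := ler_wpM2r h3 h2.
by move: h6 h7; clear; nra.
Qed.

Lemma softconv_has_inf x : has_inf (range (fun y => v y + soft_mdist x y)).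
Proof.
split; first by exists (v x + soft_mdist x x), x.
by exists 0 => _ [y _ <-]; rewrite addr_ge0// sqrtr_ge0.
Qed.

Lemma softconv_le x y : softconv x <= v y + soft_mdist x y.
Proof. by apply: ge_inf; [exact: (softconv_has_inf x).2|exists y]. Qed.

Lemma softconv_ge x c : (forall y, c <= v y + soft_mdist x y) -> c <= softconv x.
Proof.
move=> h; apply: lb_le_inf; first exact: (softconv_has_inf x).1.
by move=> _ [y _ <-].
Qed.

Lemma le_softconv x : v x <= softconv x.
Proof.
apply: softconv_ge => y; have := vlip x y; have := soft_mdist_ge x y.
by rewrite -lerBlDl => h1 h2; apply: le_trans h2 h1.
Qed.

Lemma softconv_le_eps x : softconv x <= v x + e.
Proof.
apply: le_trans (softconv_le x x) _; rewrite lerD2l /soft_mdist mdistxx.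
by rewrite expr0n addr0 sqrtr_sqr gtr0_norm.
Qed.

Lemma softconv_ge0 x : 0 <= softconv x.
Proof. exact: le_trans (v0 x) (le_softconv x). Qed.

Lemma softconv_lip x x' : softconv x <= softconv x' + mdist x x'.
Proof.
rewrite -lerBlDr; apply: softconv_ge => y; rewrite lerBlDr.
by apply: le_trans (softconv_le x y) _; rewrite -addrA lerD2l soft_mdist_lip.
Qed.

Lemma softconv_near x d : 0 < d -> exists y, v y + soft_mdist x y < softconv x + d.
Proof.
move=> d0.
have [_ [y _ <-] h] := inf_adherent d0 (softconv_has_inf x).
by exists y.
Qed.

End moreau.

Lemma continuous_borel_real {R : realType} (T : ptopologicalType) (f : T -> R) :
  continuous f -> measurable_fun [set: borel T] (f : borel T -> measurableTypeR R).
Proof.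
move=> /continuousP cf; apply: (measurability _ (RGenOpens.measurableE R)).
move=> _ [_ [a [b ->] <-]]; rewrite setTI; apply: sub_sigma_algebra.
exact/cf/interval_open.
Qed.

Lemma lip_continuous_real {R : realType} (X : metricType R) (f : X -> R) :
  (forall x y, f x - f y <= mdist x y) -> continuous f.
Proof.
move=> fl x; apply/cvgrPdist_lt => e e0; near=> y.
have xy : mdist x y < e by rewrite -ball_mdist; near: y; exact: nbhsx_ballx.
apply: le_lt_trans xy; rewrite ler_norml fl andbT lerNl opprB metric_sym.
exact: fl.
Unshelve. all: by end_near. Qed.

Section clipped_square.
Context {R : realType} (n : nat).
Local Notation T := (n.-tuple (measurableTypeR R)).
Local Notation vec := (@euclid_of_tuple R n).
Variables (v : euclid R n -> R) (e K : R).
Hypothesis v0 : forall x, 0 <= v x.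
Hypothesis vlip : forall x y, v x - v y <= mdist x y.
Hypothesis e0 : 0 < e.
Hypothesis K1 : 1 <= K.

Local Notation u := (softconv v e).

(** Clipping at K keeps the function bounded and, being a minimum, semiconcave. *)
Definition clip_sqr (t : T) : R := Num.min (u (vec t)) K ^+ 2.

Lemma clip_ge0 t : 0 <= Num.min (u (vec t)) K.
Proof. by rewrite le_min (softconv_ge0 e v0 vlip) (le_trans _ K1). Qed.

Lemma clip_sqr_ge0 t : 0 <= clip_sqr t.
Proof. exact: sqr_ge0. Qed.

Lemma clip_sqr_le t : clip_sqr t <= K ^+ 2.
Proof.
rewrite ler_pXn2r// ?nnegrE ?clip_ge0//; last exact: le_trans K1.
by rewrite ge_min lexx orbT.
Qed.

Lemma clip_sqr_le_u t : clip_sqr t <= u (vec t) ^+ 2.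
Proof.
rewrite ler_pXn2r// ?nnegrE ?clip_ge0 ?softconv_ge0//.
by rewrite ge_min lexx.
Qed.

Lemma bm_clip_sqr : bm clip_sqr.
Proof.
split; last first.
  by exists (K ^+ 2) => t; rewrite ger0_norm ?clip_sqr_le// clip_sqr_ge0.
apply: measurable_funX; apply: measurable_minr => //.
apply: (measurableT_comp (f := (u : borel (euclid R n) -> measurableTypeR R))); last exact: measurable_euclid_of_tuple.
apply: continuous_borel_real; apply: lip_continuous_real => x y.
by rewrite lerBlDl; exact: (softconv_lip v0 e0).
Qed.

Lemma mdist_vec (x y : T) : mdist (vec x) (vec y) ^+ 2 =
  \sum_(i < n) (tnth x i - tnth y i) ^+ 2.
Proof.
rewrite euclid_mdistE sqr_norm2; apply: eq_bigr => i _.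
by rewrite !mxE.
Qed.

(** For u x < K take y almost minimizing v y + soft_mdist x y =: q, and compare with the
value of the same y at other points z.  The square of soft_mdist (z, y) is exactly
quadratic in z and soft_mdist itself lies below its tangent parabola, so that
(v y + soft_mdist z y)^2 is bounded by a quadratic
polynomial in z whose gradient at x has norm at most 2 q. *)
Lemma semiconcave_clip_sqr : semiconcave clip_sqr.
Proof.
exists ((K + 1) / e).
  by rewrite divr_ge0 ?ltW// ltr_wpDl// (le_trans _ K1).
move=> x d d0 d1; have K0 : 0 <= K by apply: le_trans K1.
have [uK|uK] := leP K (u (vec x)).
  exists (fun=> 0).
    rewrite big1 ?mulr_ge0// ?addr_ge0 ?clip_sqr_ge0// ?ltW// => i _.
    by rewrite expr0n.
  move=> y; rewrite [X in _ + X + _]big1 => [|i _]; last by rewrite mul0r.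
  have Fx : clip_sqr x = K ^+ 2 by rewrite /clip_sqr min_r.
  rewrite Fx addr0 -addrA; apply: le_trans (clip_sqr_le y) _.
  rewrite lerDl; apply: addr_ge0; first exact: ltW.
  apply: mulr_ge0; first by rewrite divr_ge0 ?ltW// ltr_wpDl.
  by apply: sumr_ge0 => i _; exact: sqr_ge0.
have Fx : clip_sqr x = u (vec x) ^+ 2 by rewrite /clip_sqr min_l// ltW.
have u0 : 0 <= u (vec x) := softconv_ge0 e v0 vlip (vec x).
have D0 : 0 < 2 * K + 1 by lra.
(* this slack, at most 1, changes u^2 by at most d since u x < K *)
have [y hy] := softconv_near e v0 (vec x) (divr_gt0 d0 D0).
pose q := v y + soft_mdist e (vec x) y; pose r := soft_mdist e (vec x) y.
have r_ge : e <= r := soft_mdist_ge_e e0 _ _.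
have r0 : 0 < r := lt_le_trans e0 r_ge.
have q0 : 0 <= q by rewrite addr_ge0// ltW.
have qd : q ^+ 2 <= u (vec x) ^+ 2 + d.
  have h : d / (2 * K + 1) * (2 * K + 1) = d by rewrite divfK// gt_eqF.
  have h1 : d / (2 * K + 1) <= 1 by rewrite ler_pdivrMr//; lra.
  have h0 : 0 < d / (2 * K + 1) by rewrite divr_gt0.
  move: hy h h1 h0; rewrite -/q; move: (d / _) => w hy h h1 h0.
  apply: (@le_trans _ _ ((u (vec x) + w) ^+ 2)).
    by rewrite ler_pXn2r ?nnegrE ?ltW// ltr_wpDl// ?addr_ge0// ltW.
  by move: u0 uK h h1 h0; clear; nra.
have qK : q <= K + 1.
  rewrite -(@ler_pXn2r _ 2)// ?nnegrE ?addr_ge0//.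
  by move: qd u0 uK d1 K0; clear; nra.
pose y' := [tuple ((y : 'rV[R]_n) ord0 i : measurableTypeR R) | i < n].
have yE : y = vec y' by apply/rowP => i; rewrite mxE tnth_mktuple.
exists (fun i => 2 * q / r * (tnth x i - tnth y' i)).
  rewrite (eq_bigr (fun i => (2 * q / r) ^+ 2 * (tnth x i - tnth y' i) ^+ 2)); last first.
    by move=> i _; rewrite exprMn.
  rewrite -mulr_sumr -mdist_vec -yE.
  apply: (@le_trans _ _ ((2 * q / r) ^+ 2 * r ^+ 2)).
    by rewrite ler_wpM2l ?sqr_ge0// sqr_soft_mdist// lerDr sqr_ge0.
  rewrite -exprMn divfK ?gt_eqF// Fx exprMn.
  by move: qd; clear; lra.
move=> z; pose r' := soft_mdist e (vec z) y.
have r'0 : 0 <= r' by exact: sqrtr_ge0.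
apply: le_trans (clip_sqr_le_u z) _.
apply: (@le_trans _ _ ((v y + r') ^+ 2)).
  by rewrite ler_pXn2r ?nnegrE ?addr_ge0 ?softconv_ge0//; exact: softconv_le.
pose S1 := \sum_(i < n) (tnth x i - tnth y' i) * (tnth z i - tnth x i).
pose S2 := \sum_(i < n) (tnth z i - tnth x i) ^+ 2.
have S20 : 0 <= S2 by apply: sumr_ge0 => i _; exact: sqr_ge0.
have -> : \sum_(i < n) 2 * q / r * (tnth x i - tnth y' i) * (tnth z i - tnth x i) = 2 * q / r * S1.
  by rewrite mulr_sumr; apply: eq_bigr => i _; rewrite mulrA.
rewrite -/S2.
have r'E : r' ^+ 2 = r ^+ 2 + 2 * S1 + S2.
  rewrite !sqr_soft_mdist// yE !mdist_vec -!addrA; congr (_ + _).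
  by rewrite mulr_sumr -!big_split/=; apply: eq_bigr => i _; ring.
have r'_le : r' <= r + (2 * S1 + S2) / (2 * r).
  have h : (2 * S1 + S2) / (2 * r) * (2 * r) = 2 * S1 + S2.
    by rewrite divfK// gt_eqF// mulr_gt0.
  move: h; move: (_ / _) => w h.
  rewrite -(ler_pM2r r0); have := sqr_ge0 (r' - r).
  by move: r'E h; clear; nra.
have step : (v y + r') ^+ 2 <= q ^+ 2 + 2 * q / r * S1 + q / r * S2.
  have -> : q ^+ 2 + 2 * q / r * S1 + q / r * S2 =
     q ^+ 2 + 2 * q * ((2 * S1 + S2) / (2 * r)).
    by field; rewrite gt_eqF.
  have h : 2 * r * ((2 * S1 + S2) / (2 * r)) = 2 * S1 + S2.
    by rewrite mulrC divfK// gt_eqF// mulr_gt0.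
  move: r'_le h; move: (_ / (2 * r)) => w r'_le h.
  have h2 := ler_wpM2l (v0 y) r'_le.
  by move: h2 h r'E; rewrite /q -/r; clear; nra.
apply: le_trans step _; rewrite Fx; apply: lerD.
  by rewrite lerD2r.
apply: ler_wpM2r => //; apply: (@ler_pM _ q _ r^-1) => //.
  by rewrite invr_ge0 ltW.
by rewrite lef_pV2 ?posrE.
Qed.

End clipped_square.

Section clipped_square_rotJ.
Context {R : realType} (n : nat).
Local Notation T := ((n + n).-tuple (measurableTypeR R)).
Local Notation vec := (@euclid_of_tuple R (n + n)).
Variables (v : euclid R (n + n) -> R) (e : R).
Hypothesis v0 : forall x, 0 <= v x.
Hypothesis vJ : forall t : T, v (vec (rotJ t)) = v (vec t).

Lemma mdist_rotJ (x y : T) : mdist (vec (rotJ x)) (vec (rotJ y)) = mdist (vec x) (vec y).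
Proof.
apply/eqP; rewrite -(@eqrXn2 _ 2)// ?mdist_ge0// !mdist_vec.
rewrite !big_split_ord/= addrC; apply/eqP; congr (_ + _); apply: eq_bigr => i _.
  by rewrite !tnth_rotJr.
by rewrite !tnth_rotJl -opprD sqrrN.
Qed.

Lemma softconv_rotJ (t : T) : softconv v e (vec (rotJ t)) = softconv v e (vec t).
Proof.
have Hle (x : T) : softconv v e (vec (rotJ x)) <= softconv v e (vec x).
  apply: (softconv_ge (v := v) (e := e)) => [|y]; first exact: v0.
  pose y' := [tuple ((y : 'rV[R]_(n + n)) ord0 i : measurableTypeR R) | i < (n + n)%N].
  have yE : y = vec y' by apply/rowP => i; rewrite mxE tnth_mktuple.
  have := softconv_le e v0 (vec (rotJ x)) (vec (rotJ y')).
  by rewrite vJ /soft_mdist mdist_rotJ -yE.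
apply/eqP; rewrite eq_le; apply/andP; split; first exact: Hle.
(* the inverse of rotJ is its third power *)
have J4 : rotJ (rotJ (rotJ (rotJ t))) = t.
  rewrite !rotJK; apply: eq_from_tnth => i.
  by rewrite !tnth_oppt opprK.
have h := le_trans (Hle (rotJ (rotJ (rotJ t)))) (le_trans (Hle _) (Hle (rotJ t))).
by rewrite J4 in h.
Qed.

End clipped_square_rotJ.

(** * From the box distance to a Lipschitz profile *)

Section uniform.
Context {R : realType}.
Local Notation TR := (measurableTypeR R).

Lemma measurable_unitI : measurable (@unitI R : set TR).
Proof. exact: measurable_itv. Qed.

Definition unif01 : set TR -> \bar R := mrestr lebesgue_measure measurable_unitI.

HB.instance Definition _ := Measure.on unif01.

Let unif01T : unif01 [set: TR] = 1%E.
Proof.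
by rewrite /unif01 /mrestr setTI lebesgue_measure_itv/= lte_fin ltr01 sube0.
Qed.

HB.instance Definition _ := Measure_isProbability.Build _ _ _ unif01 unif01T.

(** A parameter is only measurable on [0, 1); making it constant elsewhere turns
it into a random variable with law mm_meas X. *)
Lemma parameter_prob (X : mmSpace R) (phi : R -> X) : parameter phi ->
  exists phi' : TR -> borel X,
   [/\ measurable_fun [set: TR] phi',
    (forall s, unitI s -> phi' s = phi s) &
    forall A, measurable A -> mm_meas X A = unif01 (phi' @^-1` A)].
Proof.
move=> [mphi pphi].
pose phi' (s : TR) : borel X := if s \in (@unitI R) then phi s else phi 0.
have phi'E s : unitI s -> phi' s = phi s by move=> us; rewrite /phi' mem_set.
exists phi'; split => //.
  apply: measurable_fun_if => //.
  - apply: (measurable_fun_bool true); rewrite setTI preimage_mem_true.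
    exact: measurable_unitI.
  - by rewrite setTI preimage_mem_true.
move=> A mA; rewrite -(pphi _ mA) /unif01 /mrestr; congr (lebesgue_measure _).
rewrite setIC; apply/seteqP; split=> s [h1 h2]; split=> //; move: h1 h2 => /=.
  by move=> h us; rewrite phi'E.
by move=> h us; rewrite -phi'E.
Qed.

End uniform.

Section lipschitz_extension.
Context {R : realType} (Y : metricType R) (S : Type) (D : set S).
Context (w : S -> R) (psi : S -> Y).
Hypothesis D0 : D !=set0.
Hypothesis w0 : forall s, D s -> 0 <= w s.

(** McShane's extension of the function psi s |-> w s, which is defined on a subset
only and Lipschitz up to an error. *)
Definition lip_ext (y : Y) : R := inf [set w s + mdist y (psi s) | s in D].

Lemma lip_ext_has_inf y : has_inf [set w s + mdist y (psi s) | s in D].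
Proof.
split; first by have [s Ds] := D0; exists (w s + mdist y (psi s)), s.
by exists 0 => _ [s Ds <-]; rewrite addr_ge0 ?w0// mdist_ge0.
Qed.

Lemma lip_ext_le y s : D s -> lip_ext y <= w s + mdist y (psi s).
Proof. by move=> Ds; apply: ge_inf; [exact: (lip_ext_has_inf y).2|exists s]. Qed.

Lemma lip_ext_ge y c : (forall s, D s -> c <= w s + mdist y (psi s)) -> c <= lip_ext y.
Proof.
move=> h; apply: lb_le_inf; first exact: (lip_ext_has_inf y).1.
by move=> _ [s Ds <-]; exact: h.
Qed.

Lemma lip_ext_ge0 y : 0 <= lip_ext y.
Proof. by apply: lip_ext_ge => s Ds; rewrite addr_ge0 ?w0// mdist_ge0. Qed.

Lemma lip_ext_lip x y : lip_ext x - lip_ext y <= mdist x y.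
Proof.
rewrite lerBlDr addrC -lerBlDr; apply: lip_ext_ge => s Ds; rewrite lerBlDr.
apply: le_trans (lip_ext_le x Ds) _; rewrite -addrA lerD2l addrC.
exact: metric_triangle.
Qed.

Lemma lip_ext_close a : 0 <= a ->
  (forall s t, D s -> D t -> w s - w t <= mdist (psi s) (psi t) + a) ->
  forall s, D s -> `|lip_ext (psi s) - w s| <= a.
Proof.
move=> a0 h s Ds; rewrite ler_distl; apply/andP; split.
  apply: lip_ext_ge => t Dt; have := h s t Ds Dt.
  by rewrite !lerBlDr addrC addrA.
by apply: le_trans (lip_ext_le _ Ds) _; rewrite mdistxx addr0 lerDl.
Qed.

End lipschitz_extension.

Section u1_orbit.
Context {R : realType} (n : nat).
Local Notation T := ((n + n).-tuple (measurableTypeR R)).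

Definition u1_class (x : euclid R (n + n)) : orbit_space (U1_action R n) :=
  orbit_pi (U1_action R n) (ceuclid_of_euclid x).

(** The multiplication by i is an element of U(1). *)
Lemma u1_class_rotJ (t : T) :
  u1_class (euclid_of_tuple (rotJ t)) = u1_class (euclid_of_tuple t).
Proof.
apply/esym/orbit_piP.
have i1 : `|('i)%C : R[i]| == 1 by rewrite normc_def /= expr0n expr1n add0r sqrtr1.
exists (exist (fun u : R[i] => `|u| == 1) ('i)%C i1).
apply/rowP => j; rewrite /= /U1_scale /ceuclid_of_euclid !mxE tnth_rotJl tnth_rotJr /=.
by apply/eqP; rewrite eq_complex /=; apply/andP; split; apply/eqP; ring.
Qed.

Lemma u1_class_lip x y : mdist (u1_class x) (u1_class y) <= mdist x y.
Proof.
rewrite orbit_piE; apply: le_trans (orbit_mdist_le 1%g _ _) _.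
by rewrite act1x ceuclid_of_euclid_isom.
Qed.

End u1_orbit.

Lemma dist_le_of {R : realDomainType} (x y M : R) :
  0 <= x -> x <= M -> 0 <= y -> y <= M -> `|x - y| <= M.
Proof. by move=> *; rewrite ler_norml; apply/andP; split; lra. Qed.

Section link.
Context {R : realType}.
Local Notation TR := (measurableTypeR R).
Local Notation g1 := (@normal_prob R 0 1).
Local Notation gauss := (@gauss_tuple R).

Lemma measurable_lip (X : mmSpace R) (f : X -> R) :
  (forall x y, f x - f y <= mdist x y) ->
  measurable_fun [set: borel X] (f : borel X -> TR).
Proof. by move=> h; apply: continuous_borel_real; exact: lip_continuous_real. Qed.

(** On the common set of parameters where the two distances agree, the distance to
the origin of the half-line is transported to Y and extended by McShane's
formula; the composition with the map from C^n / U(1) to Y is v.  Expectations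
of functions of v and of the half-normal variable are both integrals over the
parameter interval, and the integrands differ by at most A e on the common set
and by at most M on its complement. *)
Lemma profile_of_GammaInfU1 (e : R) : GammaInfU1 (H1 R) -> 0 < e -> e < 1 ->
  exists n (v : euclid R (n + n) -> R), [/\ forall x, 0 <= v x,
    forall x y, v x - v y <= mdist x y,
    forall t, v (euclid_of_tuple (rotJ t)) = v (euclid_of_tuple t) &
    forall (G : TR -> TR) (M A : R), measurable_fun [set: TR] G ->
      (forall x, 0 <= x -> 0 <= G x <= M) ->
      (forall x y, 0 <= x -> 0 <= y -> `|G x - G y| <= A * `|x - y|) ->
      `|Ex (gauss (n + n)) (fun t => G (v (euclid_of_tuple t))) -
        Ex g1 (fun x => G `|x|)| <= (A + M) * e].
Proof.
move=> HU e0 e1; have [Y [n n0 [g [glip gm]]]] := HU _ e0.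
move=> /ereal_inf_lt[_ [a [a0 [phi [psi [I0 [pphi ppsi [mI0 I0s] I0a I0P]]]]] <-]].
rewrite lte_fin => ae.
pose w s := val (phi s); have w0 s : I0 s -> 0 <= w s by move=> _; exact: valP (phi s).
have I00 : I0 !=set0.
  apply/set0P/negP => /eqP I0E; move: I0a; rewrite I0E measure0 lee_fin.
  by rewrite leNgt subr_gt0 (lt_trans ae e1).
pose vt := lip_ext I0 w psi.
have vt0 y : 0 <= vt y := lip_ext_ge0 psi I00 w0 y.
have vtlip x y : vt x - vt y <= mdist x y := lip_ext_lip psi I00 w0 x y.
have vtclose : forall s, I0 s -> `|vt (psi s) - w s| <= a.
  apply: lip_ext_close => // s t Is It.
  have := I0P s t Is It; rewrite half_line_mdistE ler_norml => /andP[_].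
  by rewrite lerBlDl addrC; apply: le_trans; exact: ler_norm.
pose v (x : euclid R (n + n)) := vt (g (u1_class x)).
exists n, v; split=> [x|x y|t|G M A mG G0M GA]; first exact: vt0.
- by apply: le_trans (vtlip _ _) (le_trans (glip _ _) (u1_class_lip _ _)).
- by rewrite /v u1_class_rotJ.
have [phi' [mphi' phi'E phi'P]] := parameter_prob pphi.
have [psi' [mpsi' psi'E psi'P]] := parameter_prob ppsi.
have bG (X : mmSpace R) (f : X -> R) : (forall x, 0 <= f x) ->
    (forall x y, f x - f y <= mdist x y) -> bm (G \o f : borel X -> R).
  move=> f0 fl; split.
    exact: (measurableT_comp mG (measurable_lip fl)).
  by exists M => x; have /andP[h1 h2] := G0M _ (f0 x); rewrite ger0_norm.
have bGv := bG _ _ vt0 vtlip.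
have bGw : bm (G \o val : borel (H1 R) -> R).
  apply: (bG (H1 R) val) => [x|x y]; first exact: valP x.
  exact: ler_norm.
have E1 : Ex (gauss (n + n)) (fun t => G (v (euclid_of_tuple t))) = Ex unif01 (fun s => G (vt (psi' s))).
  rewrite -[RHS](Ex_pushforward (P2 := mm_meas Y) mpsi' psi'P bGv).
  apply/esym/(Ex_pushforward (P1 := gauss (n + n)) (P2 := mm_meas Y)
    (h := fun t => g (u1_class (euclid_of_tuple t))) _ _ bGv).
    apply: (measurableT_comp (f := fun x : borel (euclid R (n + n)) => g (u1_class x) : borel Y)).
      apply: continuous_borel; apply: lip_continuous => x y.
      exact: le_trans (glip _ _) (u1_class_lip _ _).
    exact: measurable_euclid_of_tuple.
  by move=> B mB; rewrite -(gm B mB).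
have E2 : Ex g1 (fun x => G `|x|) = Ex unif01 (fun s => G (val (phi' s))).
  rewrite -[RHS](Ex_pushforward (P2 := mm_meas (H1 R)) mphi' phi'P bGw).
  apply/esym/(Ex_pushforward (P1 := g1) (P2 := mm_meas (H1 R))
    (h := @half_line_abs R) (@measurable_half_line_abs R) _ bGw).
  by move=> B mB.
rewrite E1 E2.
have A0 : 0 <= A.
  have := le_trans (normr_ge0 _) (GA 1 0 ler01 (lexx _)).
  by rewrite subr0 normr1 mulr1.
have M0 : 0 <= M by have /andP[h1 h2] := G0M 0 (lexx _); apply: le_trans h2.
have b1 : bm (fun s => G (vt (psi' s))) := bm_comp bGv mpsi'.
have b2 : bm (fun s => G (val (phi' s))) := bm_comp bGw mphi'.
rewrite -(ExB (bm_itg unif01 b1) (bm_itg unif01 b2)).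
apply: le_trans (Ex_norm_le (bm_itg unif01 (bmB b1 b2))) _.
have mI0' : measurable (I0 : set TR) by [].
have bI : bm (\1_I0 : TR -> R).
  split; first exact: measurable_indic.
  by exists 1 => s; rewrite indicE; case: (_ \in _); rewrite ?normr1 ?normr0.
have bR : bm (fun s : TR => A * a + M * (1 - \1_I0 s)).
  exact: bmD (bm_cst _ _) (bmM (bm_cst _ _) (bmB (bm_cst _ _) bI)).
apply: (@le_trans _ _ (Ex unif01 (fun s : TR => A * a + M * (1 - \1_I0 s)))).
  apply: le_Ex; [exact: bm_itg (bm_norm (bmB b1 b2))|exact: bm_itg|] => s.
  have x0 := vt0 (psi' s); have y0 : 0 <= val (phi' s) := valP (phi' s).
  rewrite indicE; have [Is|nIs] := boolP (s \in I0); rewrite /= ?subrr ?mulr0 ?subr0 ?mulr1.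
    rewrite addr0; apply: le_trans (GA _ _ x0 y0) _; apply: ler_wpM2l => //.
    have Is' := set_mem Is; have us := I0s _ Is'.
    by rewrite psi'E// phi'E//; exact: vtclose.
  have /andP[h1 h2] := G0M _ x0; have /andP[h3 h4] := G0M _ y0.
  by rewrite ler_wpDl ?mulr_ge0//; apply: (dist_le_of h1 h2 h3 h4).
have ic (k : R) : itg unif01 (fun _ : TR => k) := bm_itg unif01 (bm_cst _ k).
have iI := itgB (ic 1) (bm_itg unif01 bI).
rewrite (ExD (ic _) (itgZ M iI)) (ExZ _ iI) (ExB (ic _) (bm_itg unif01 bI)) !Ex_cst.
have : 1 - a <= Ex unif01 (\1_I0 : TR -> R).
  rewrite -lee_fin Ex_indic//; apply: le_trans I0a _.
  have {1}-> : I0 = I0 `&` @unitI R by rewrite setIidl.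
  exact: lexx.
move: (Ex _ _) => q hq.
rewrite mulrDl; apply: lerD.
  by apply: ler_wpM2l => //; exact: ltW.
apply: ler_wpM2l => //; move: hq ae; clear; lra.
Qed.

End link.

(** * The half-line is not in the U(1) pyramid *)

Section clipping.
Context {R : realType}.
Implicit Types x y K e : R.

Lemma min_dist_le x y K : `|Num.min x K - Num.min y K| <= `|x - y|.
Proof.
by case: (leP x K) => xK; case: (leP y K) => yK;
  rewrite ?subrr ?normr0// ler_norml; have := ler_norm (x - y);
  have := ler_norm (y - x); rewrite (distrC y) => h1 h2; apply/andP; split; lra.
Qed.

Lemma sqr_dist_le K x y : 0 <= x -> x <= K -> 0 <= y -> y <= K ->
  `|x ^+ 2 - y ^+ 2| <= 2 * K * `|x - y|.
Proof.
move=> x0 xK y0 yK; rewrite subr_sqr normrM mulrC; apply: ler_wpM2r => //.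
by rewrite ger0_norm; lra.
Qed.

Lemma min_range x K : 0 <= x -> 0 <= K -> 0 <= Num.min x K <= K.
Proof. by move=> x0 K0; rewrite le_min x0 K0/= ge_min lexx orbT. Qed.

Lemma clip2_lip x y K : 0 <= x -> 0 <= y -> 0 <= K ->
  `|Num.min x K ^+ 2 - Num.min y K ^+ 2| <= 2 * K * `|x - y|.
Proof.
move=> x0 y0 K0; have /andP[h1 h2] := min_range x0 K0; have /andP[h3 h4] := min_range y0 K0.
apply: le_trans (sqr_dist_le h1 h2 h3 h4) _.
by apply: ler_wpM2l; [rewrite mulr_ge0|exact: min_dist_le].
Qed.

Lemma clip4_lip x y K : 0 <= x -> 0 <= y -> 0 <= K ->
  `|(Num.min x K ^+ 2) ^+ 2 - (Num.min y K ^+ 2) ^+ 2| <= 4 * K ^+ 3 * `|x - y|.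
Proof.
move=> x0 y0 K0; have /andP[h1 h2] := min_range x0 K0; have /andP[h3 h4] := min_range y0 K0.
have sq z : 0 <= z -> z <= K -> z ^+ 2 <= K ^+ 2 by move=> *; rewrite ler_pXn2r ?nnegrE.
apply: le_trans (sqr_dist_le (sqr_ge0 _) (sq _ h1 h2) (sqr_ge0 _) (sq _ h3 h4)) _.
have -> : 4 * K ^+ 3 * `|x - y| = 2 * K ^+ 2 * (2 * K * `|x - y|) by ring.
by apply: ler_wpM2l; [rewrite mulr_ge0 ?sqr_ge0|exact: clip2_lip].
Qed.

(** Where |x| > K the ratio (|x| / K)^6 exceeds 1. *)
Lemma clip4_tail x K : 0 < K ->
  (x ^+ 2) ^+ 2 <= (Num.min `|x| K ^+ 2) ^+ 2 + K ^- 6 * x ^+ 10.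
Proof.
move=> K0; have xE k : x ^+ (2 * k) = `|x| ^+ (2 * k).
  by rewrite !exprM real_normK ?num_real.
rewrite -exprM (xE 2%N) (xE 5%N); move: (normr_ge0 x); move: `|x| => z z0.
have z10 : 0 <= K ^- 6 * z ^+ (2 * 5).
  by rewrite mulr_ge0 ?invr_ge0 ?exprn_ge0// ltW.
case: (leP z K) => zK; first by rewrite -!exprM lerDl.
apply: (@le_trans _ _ (K ^- 6 * z ^+ (2 * 5))); last first.
  by rewrite lerDr exprn_ge0// exprn_ge0// ltW.
rewrite mulrC ler_pdivlMr ?exprn_gt0// (_ : z ^+ (2 * 5) = z ^+ (2 * 2) * z ^+ 6).
  by apply: ler_wpM2l; rewrite ?exprn_ge0// ler_pXn2r ?nnegrE// ltW.
by rewrite -exprD.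
Qed.

(** K is chosen after the tenth moment so that the clipping costs at most half of
the tolerance l^2 in the fourth moment, and then e so that the approximations cost
a small multiple of l^2. *)
Lemma clip_constants (c M10 K l e EF EF2 : R) :
  1 <= c -> 0 <= M10 -> K = 1 + 2 * c ^+ 2 * M10 -> l = (c * K ^+ 2)^-1 ->
  e = l ^+ 2 / (100 * K ^+ 4) ->
  0 <= EF -> EF <= 1 + (2 * K + K ^+ 2) * e + 2 * K * e ->
  3 - K ^- 6 * M10 - (4 * K ^+ 3 + K ^+ 4) * e <= EF2 ->
  EF <= 1 + l ^+ 2 /\ 2 - l ^+ 2 <= EF2 - EF ^+ 2.
Proof.
move=> c1 M0 KE lE eE EF0 EFu EFl.
have c0 : 0 < c by lra.
have K1 : 1 <= K by rewrite KE lerDl mulr_ge0// mulr_ge0// sqr_ge0.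
have K0 : 0 < K by lra.
have l0 : 0 < l by rewrite lE invr_gt0 mulr_gt0// exprn_gt0.
have t1 : l ^+ 2 <= 1.
  apply: exprn_ile1; first exact: ltW.
  rewrite lE invf_le1 ?mulr_gt0 ?exprn_gt0//.
  by rewrite -[leLHS](mulr1 1); apply: ler_pM => //; exact: exprn_ege1.
have t0 : 0 < l ^+ 2 by rewrite exprn_gt0.
have tail : K ^- 6 * M10 <= l ^+ 2 / 2.
  have -> : l ^+ 2 / 2 = K ^- 6 * (K ^+ 2 / (2 * c ^+ 2)).
    by rewrite lE; field; rewrite !gt_eqF.
  apply: ler_wpM2l; first by rewrite invr_ge0 exprn_ge0 ?ltW.
  rewrite ler_pdivlMr ?mulr_gt0 ?exprn_gt0//.
  rewrite (mulrC M10); move: KE K1; move: (2 * c ^+ 2 * M10) => q; clear; nra.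
have eK : K ^+ 4 * e = l ^+ 2 / 100.
  by rewrite eE; field; rewrite gt_eqF.
have e0 : 0 <= e by rewrite eE; apply: divr_ge0; [exact: ltW|apply: mulr_ge0 => //; rewrite exprn_ge0// ltW].
have pw (k : nat) : (k <= 4)%N -> K ^+ k * e <= l ^+ 2 / 100.
  move=> k4; rewrite -eK; apply: ler_wpM2r => //.
  exact: ler_weXn2l.
have k1 := pw 1%N isT; have k2 := pw 2%N isT; have k3 := pw 3%N isT.
rewrite expr1 in k1.
have h1 : EF <= 1 + l ^+ 2 / 20.
  apply: le_trans EFu _; move: k1 k2 t0; move: (l ^+ 2) => t; clear; lra.
split; first by move: h1 t0; move: (l ^+ 2) => t; clear; lra.
have h2 : EF ^+ 2 <= 1 + 3 * (l ^+ 2 / 20).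
  apply: (@le_trans _ _ ((1 + l ^+ 2 / 20) ^+ 2)).
    by rewrite ler_pXn2r ?nnegrE// addr_ge0// divr_ge0// ltW.
  by move: t0 t1; move: (l ^+ 2) => t; clear; nra.
by move: EFl tail k3 eK h2 t0; move: (l ^+ 2) => t; clear; lra.
Qed.

End clipping.

Section moment_transfer.
Context {R : realFieldType}.

Lemma first_moment (EF Em Eg t1 t2 e : R) : EF <= Em + t1 ->
  `|Em - Eg| <= t2 * e -> Eg <= 1 -> EF <= 1 + t2 * e + t1.
Proof. by move=> h1; rewrite ler_norml => /andP[_ h2] h3; lra. Qed.

Lemma fourth_moment (EF Em Eg t1 t2 e : R) : Em <= EF ->
  `|Em - Eg| <= t2 * e -> 3 - t1 <= Eg -> 3 - t1 - t2 * e <= EF.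
Proof. by move=> h1; rewrite ler_norml => /andP[h2 _] h3; lra. Qed.

End moment_transfer.

Section half_line.
Context {R : realType}.
Local Notation TR := (measurableTypeR R).
Local Notation g1 := (@normal_prob R 0 1).
Local Notation gauss := (@gauss_tuple R).

(** The clipped square of a profile that is close enough to the half-normal law has
nearly the mean 1 and the variance 2 of the square of a standard normal variable. *)
Lemma half_line_notin_GammaInfU1 : ~ GammaInfU1 (H1 R).
Proof.
move=> HU.
pose M10 := Ex g1 (fun x : TR => x ^+ 10).
have M0 : 0 <= M10.
  by apply: Ex_ge0 => x; rewrite (_ : 10 = 5 * 2)%N// exprM sqr_ge0.
have [c c1 cE] : exists2 c : R, 1 <= c & c^-1 <= 4000^-1.
  by exists 4000; rewrite ?lexx// ler1n.
have c0 : 0 < c by exact: lt_le_trans ltr01 c1.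
pose K := 1 + 2 * c ^+ 2 * M10; pose l := (c * K ^+ 2)^-1.
pose e := l ^+ 2 / (100 * K ^+ 4).
have K1 : 1 <= K by rewrite lerDl mulr_ge0// mulr_ge0// sqr_ge0.
have K0 : 0 < K by exact: lt_le_trans ltr01 K1.
have l0 : 0 < l by rewrite invr_gt0 mulr_gt0 ?exprn_gt0.
have e0 : 0 < e by rewrite divr_gt0 ?exprn_gt0// mulr_gt0 ?exprn_gt0.
have e1 : e < 1.
  have l1 : l <= 1.
    rewrite invf_le1 ?mulr_gt0 ?exprn_gt0////.
    by rewrite -[leLHS](mulr1 1); apply: ler_pM => //; exact: exprn_ege1.
  have k4 : 1 < 100 * K ^+ 4.
    apply: lt_le_trans (ler_peMr _ (exprn_ege1 4 K1)); last by rewrite ler0n.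
    by rewrite ltr1n.
  rewrite ltr_pdivrMr; last by apply: lt_trans k4.
  by rewrite mul1r; apply: le_lt_trans k4; apply: exprn_ile1 => //; exact: ltW.
have [n [v [v0 vlip vJ vG]]] := profile_of_GammaInfU1 HU e0 e1.
pose F := @clip_sqr R (n + n) v e K.
have bF : bm F := bm_clip_sqr v0 vlip e0 K1.
have F0 x : 0 <= F x := sqr_ge0 _.
have FL x : F x <= K ^+ 2 := clip_sqr_le e v0 vlip K1 x.
have FJ x : F (rotJ x) = F x by rewrite /F /clip_sqr (softconv_rotJ _ v0 vJ).
have Fsc : semiconcave F := semiconcave_clip_sqr v0 vlip e0 K1.
pose m (t : (n + n).-tuple TR) := Num.min (v (euclid_of_tuple t)) K.
have mmin : measurable_fun [set: TR] (fun x : TR => Num.min x K).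
  exact: measurable_minr.
have r2 x : 0 <= x -> 0 <= Num.min x K ^+ 2 <= K ^+ 2.
  move=> x0; have /andP[h1 h2] := min_range x0 (ltW K0).
  by rewrite sqr_ge0/= ler_pXn2r// nnegrE// ltW.
have r4 x : 0 <= x -> 0 <= (Num.min x K ^+ 2) ^+ 2 <= K ^+ 4.
  move=> x0; have /andP[h1 h2] := r2 _ x0.
  by rewrite sqr_ge0/= (exprM K 2 2) ler_pXn2r// nnegrE// sqr_ge0.
have V2 := vG (fun x => Num.min x K ^+ 2) (K ^+ 2) (2 * K) (measurable_funX 2 mmin) r2
  (fun x y x0 y0 => clip2_lip x0 y0 (ltW K0)).
have V4 := vG (fun x => (Num.min x K ^+ 2) ^+ 2) (K ^+ 4) (4 * K ^+ 3)
  (measurable_funX 2 (measurable_funX 2 mmin)) r4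
  (fun x y x0 y0 => clip4_lip x0 y0 (ltW K0)).
have bm2 : bm (fun t => m t ^+ 2).
  split; last by exists (K ^+ 2) => t; have /andP[h1 h2] := r2 _ (v0 (euclid_of_tuple t));
    rewrite ger0_norm.
  apply: (measurableT_comp (measurable_funX 2 mmin)).
  apply: (measurableT_comp (f := (v : borel (euclid R (n + n)) -> TR))); last exact: measurable_euclid_of_tuple.
  by apply: continuous_borel_real; exact: lip_continuous_real.
have mF t : m t ^+ 2 <= F t /\ F t <= m t ^+ 2 + 2 * K * e.
  have h1 := le_softconv e v0 vlip (euclid_of_tuple t).
  have h2 := softconv_le_eps v0 e0 (euclid_of_tuple t).
  have u0 := softconv_ge0 e v0 vlip (euclid_of_tuple t).
  have /andP[a1 a2] := min_range (v0 (euclid_of_tuple t)) (ltW K0).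
  have /andP[a3 a4] := min_range u0 (ltW K0).
  split.
    rewrite /F /clip_sqr ler_pXn2r ?nnegrE//.
    by rewrite le_min ge_min h1/= ge_min lexx orbT.
  rewrite /F /clip_sqr -lerBlDl.
  apply: le_trans (ler_norm _) _; apply: le_trans (clip2_lip u0 (v0 _) (ltW K0)) _.
  apply: ler_wpM2l; first by rewrite mulr_ge0// ltW.
  by rewrite ger0_norm ?subr_ge0// lerBlDl.
have EF2 : Ex (gauss (n + n)) (fun t => (m t ^+ 2) ^+ 2) <= Ex (gauss (n + n)) (fun t => F t ^+ 2).
  apply: le_Ex; [exact: bm_itg (bmX 2 bm2)|exact: bm_itg (bmX 2 bF)|] => t.
  by rewrite ler_pXn2r ?nnegrE ?sqr_ge0//; exact: (mF t).1.
have EF1 : Ex (gauss (n + n)) F <= Ex (gauss (n + n)) (fun t => m t ^+ 2) + 2 * K * e.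
  rewrite -[X in _ + X](Ex_cst (gauss (n + n))).
  rewrite -(ExD (bm_itg _ bm2) (itg_cst _ _)).
  apply: le_Ex; [exact: bm_itg|exact: itgD (bm_itg _ bm2) (itg_cst _ _)|] => t.
  exact: (mF t).2.
have mabs : measurable_fun [set: TR] (fun x : TR => `|x|) by exact: measurableT_comp.
have bc2 : bm (fun x : TR => Num.min `|x| K ^+ 2).
  split; first exact: (measurableT_comp (measurable_funX 2 mmin) mabs).
  by exists (K ^+ 2) => x; have /andP[h1 h2] := r2 _ (normr_ge0 x); rewrite ger0_norm.
have X2 : Ex g1 (fun x => Num.min `|x| K ^+ 2) <= 1.
  have i2 : itg g1 (fun x : TR => (x ^+ 2) ^+ 1) := @itg_normalX R 1 isT.
  apply: (@le_trans _ _ (Ex g1 (fun x : TR => (x ^+ 2) ^+ 1))); last by rewrite Ex_normal_sqr.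
  apply: (le_Ex (bm_itg g1 bc2) i2) => x.
  have /andP[h1 h2] := min_range (normr_ge0 x) (ltW K0).
  rewrite expr1 -[leRHS]real_normK ?num_real// ler_pXn2r ?nnegrE//.
  by rewrite ge_min lexx.
have X4 : 3 - K ^- 6 * M10 <= Ex g1 (fun x => (Num.min `|x| K ^+ 2) ^+ 2).
  have i10 := itgZ (K ^- 6) (@itg_normalX10 R).
  have i4 := bm_itg g1 (bmX 2 bc2).
  rewrite lerBlDr -(ExZ _ (@itg_normalX10 R)) -(ExD i4 i10).
  have i4' : itg g1 (fun x : TR => (x ^+ 2) ^+ 2) := @itg_normalX R 2 isT.
  apply: le_trans (@Ex_normal_pow4_ge R) _.
  apply: (le_Ex i4' (itgD i4 i10)) => x.
  exact: clip4_tail.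
have EF0 : 0 <= Ex (gauss (n + n)) F := Ex_ge0 (gauss (n + n)) F0.
have [c2 c3] := @clip_constants R c M10 K l e (Ex (gauss (n + n)) F)
  (Ex (gauss (n + n)) (fun t => F t ^+ 2)) c1 M0 erefl erefl erefl EF0
  (first_moment EF1 V2 X2) (fourth_moment EF2 V4 X4).
apply: (no_chi_square_profile bF F0 FL FJ Fsc l0 _ _ c2 c3).
  by rewrite exprn_ege1.
rewrite (_ : K ^+ 2 * l = c^-1)// /l.
by field; rewrite !gt_eqF.
Qed.

End half_line.

(** * Quantile functions as parameters *)

Section quantile.
Context {R : realType} (P : probability (measurableTypeR R) R).
Local Notation TR := (measurableTypeR R).

Let idTR : TR -> R := idfun.

#[local] HB.instance Definition _ :=
  @isMeasurableFun.Build _ _ _ _ idTR (@measurable_id _ _ setT).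

Definition dist_fun (x : R) : R := fine (P `]-oo, x]%classic).

Let cdfE : cdf (idTR : {RV P >-> R}) = EFin \o dist_fun.
Proof. by apply/funext => x; rewrite /= fineK ?fin_num_measure. Qed.

Let dist_fun_nd x y : x <= y -> dist_fun x <= dist_fun y.
Proof. by move=> xy; rewrite -lee_fin; have := cdf_nondecreasing (idTR : {RV P >-> R}) xy; rewrite cdfE. Qed.

Let dist_fun_rc x s : dist_fun x < s -> exists2 d, 0 < d & dist_fun (x + d) < s.
Proof.
move=> xs.
have cd : dist_fun y @[y --> x^'+] --> dist_fun x.
  by have := @cdf_right_continuous _ _ _ P (idTR : {RV P >-> R}) x; rewrite cdfE => /fine_cvg.
have near_s : \forall y \near x^'+, dist_fun y < s by exact: (cvgr_lt _ cd).
have near_sx : \forall y \near x^'+, dist_fun y < s /\ x < y.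
  by apply: filterI near_s _; exact: nbhs_right_gt.
have [y [ys xy]] : exists y, dist_fun y < s /\ x < y.
  exact: (@filter_ex _ _ (at_right_proper_filter x) _ near_sx).
by exists (y - x); rewrite ?subr_gt0// addrC subrK.
Qed.

Let dist_fun_lo s : 0 < s -> exists x, dist_fun x < s.
Proof.
move=> s0.
have cd : dist_fun y @[y --> -oo] --> (0 : R).
  by have := @cvg_cdfNy0 _ _ _ P (idTR : {RV P >-> R}); rewrite cdfE => /fine_cvg.
have : \forall y \near -oo, dist_fun y < s by exact: (cvgr_lt _ cd).
by move/filter_ex.
Qed.

Let dist_fun_hi s : s < 1 -> exists x, s <= dist_fun x.
Proof.
move=> s1.
have cd : dist_fun y @[y --> +oo] --> (1 : R).
  by have := @cvg_cdfy1 _ _ _ P (idTR : {RV P >-> R}); rewrite cdfE => /fine_cvg.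
have : \forall y \near +oo, s < dist_fun y by exact: (cvgr_gt _ cd).
by move/filter_ex => [x /ltW]; exists x.
Qed.

Definition quantile (s : R) : R := inf [set x | s <= dist_fun x].

(** The Galois connection between the quantile function and the distribution
function, which rests on right continuity. *)
Lemma quantile_gt s x : 0 < s -> s < 1 -> (x < quantile s) = (dist_fun x < s).
Proof.
move=> s0 s1; have [y0 y0P] := dist_fun_lo s0.
have hi : has_inf [set x | s <= dist_fun x].
  split; first by have [y yP] := dist_fun_hi s1; exists y.
  exists y0 => y /= yP; rewrite leNgt; apply/negP => /ltW/dist_fun_nd.
  by rewrite leNgt (lt_le_trans y0P).
apply/idP/idP => [|xs].
  by apply: contraTT; rewrite -!leNgt => h; apply: ge_inf; [exact: hi.2|].
have [d d0 dP] := dist_fun_rc xs.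
apply: (@lt_le_trans _ _ (x + d)); first by rewrite ltrDl.
apply: lb_le_inf; first exact: hi.1.
move=> y /= yP; rewrite leNgt; apply/negP => /ltW/dist_fun_nd.
by rewrite leNgt (lt_le_trans dP).
Qed.

Definition quantile_ext (s : TR) : TR :=
  if s \in (`]0, 1[%classic : set R) then quantile s else 0.

Lemma measurable_quantile_ext : measurable_fun [set: TR] quantile_ext.
Proof.
have m01 : measurable (`]0, 1[%classic : set TR) by exact: measurable_itv.
apply: measurable_fun_if => //.
  by apply: (measurable_fun_bool true); rewrite setTI preimage_mem_true.
rewrite setTI preimage_mem_true => _.
apply: (measurability _ (RGenOInfty.measurableE R)) => // _ [_ [x ->] <-].
rewrite (_ : _ `&` _ = `]0, 1[ `&` `]dist_fun x, +oo[)%classic.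
  by apply: measurableI; exact: measurable_itv.
apply/seteqP; split=> s [s01]; rewrite /= !in_itv/= !andbT;
  by move: (s01); rewrite /= in_itv/= => /andP[s0 s1]; rewrite quantile_gt.
Qed.

(** The rays ]x, +oo[ generate the Borel sets, and by [quantile_gt] the preimage of
such a ray is ]F x, 1[, up to the point 0. *)
Lemma quantile_law A : measurable A -> P A = unif01 (quantile_ext @^-1` A).
Proof.
pose Q := distribution (@unif01 R) (mfun_Sub (mem_set measurable_quantile_ext)).
move=> mA; rewrite -[RHS]/(Q A).
have h0 : @measurable _ TR = <<s @RGenOInfty.G R >> by exact: RGenOInfty.measurableE.
have h1 : setI_closed (@RGenOInfty.G R).
  move=> _ _ [x ->] [y ->]; exists (Num.max x y).
  by apply/seteqP; split=> z /=; rewrite !in_itv/= !andbT gt_max; [move=> [-> ->]|move=> /andP].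
pose g (n : nat) : set TR := `](- n%:R), +oo[%classic.
have h2 n : RGenOInfty.G (g n) by exists (- n%:R).
have h3 : \bigcup_n (g n) = [set: TR].
  apply/seteqP; split=> // x _; exists (Num.truncn `|x|).+1 => //=.
  rewrite /g /= in_itv/= andbT ltrNl; apply: le_lt_trans (ler_norm _) _.
  by rewrite normrN truncnS_gt.
have h4 B : RGenOInfty.G B -> P B = Q B.
  move=> [x ->]; rewrite [RHS](_ : _ = unif01 (quantile_ext @^-1` `]x, +oo[%classic))//.
  have -> : P `]x, +oo[%classic = (1 - dist_fun x)%:E.
    rewrite -setCitvl probability_setC ?EFinB ?fineK ?fin_num_measure//.
  have m1 : measurable (`](dist_fun x), 1[%classic : set TR) by exact: measurable_itv.
  have d0 : 0 <= dist_fun x by exact: fine_ge0.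
  have d1 : dist_fun x <= 1.
    by rewrite -lee_fin fineK ?fin_num_measure//; exact: probability_le1.
  have leb : lebesgue_measure (`](dist_fun x), 1[%classic : set TR) = (1 - dist_fun x)%:E.
    rewrite lebesgue_measure_itv/= lte_fin; case: ltP => // h.
    by rewrite (_ : dist_fun x = 1) ?subrr//; apply/eqP; rewrite eq_le d1 h.
  rewrite -leb; apply/eqP; rewrite eq_le; apply/andP; split.
    apply: le_measure; rewrite ?inE//.
      apply: measurableI; last exact: measurable_itv.
      by rewrite -[X in measurable X]setTI; exact: measurable_quantile_ext.
    move=> s; rewrite /= !in_itv/= => /andP[ds s1].
    have s0 : 0 < s by exact: le_lt_trans ds.
    split; last by rewrite /unitI /= in_itv/= s1 ltW.
    rewrite /quantile_ext ifT ?andbT ?quantile_gt//.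
    by rewrite inE/= in_itv/= s0.
  apply: (@le_trans _ _ (lebesgue_measure ((`](dist_fun x), 1[%classic : set TR) `|` [set 0]))).
    apply: le_measure; rewrite ?inE//.
    - apply: measurableI; last exact: measurable_itv.
      by rewrite -[X in measurable X]setTI; exact: measurable_quantile_ext.
    - by apply: measurableU => //; exact: measurable_set1.
    move=> s [/= + ]; rewrite !in_itv/= andbT => xs /andP[s0 s1].
    have [->|sn0] := eqVneq s 0; [by right|left].
    have s0' : 0 < s by rewrite lt_neqAle eq_sym sn0.
    move: xs; rewrite /quantile_ext ifT ?quantile_gt// ?inE/= ?in_itv/= ?s0' ?s1//.
    by move=> ->.
  apply: le_trans (measureU2 lebesgue_measure m1 (@measurable_set1 R 0)) _.
  rewrite [X in (_ + X <= _)%E](_ : _ = 0%E) ?adde0//.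
  exact: (lebesgue_measure_set1 0).
have h5 n : (P (g n) < +oo)%E.
  by apply: le_lt_trans (probability_le1 P _) (ltry 1); exact: measurable_itv.
exact: (@measure_unique _ R TR _ g h0 h1 h2 h3 P Q h4 h5 A mA).
Qed.

End quantile.

(** * Comparison of the two pyramids *)

Section z2_orbits.
Context {R : realType}.

Section cover.
Variable n : nat.
Local Notation G := (Gamma R (n + n)).

Lemma u1_class_Z2 (g : Z2 R) (x : G) : u1_class (Z2_scale g x) = u1_class x.
Proof.
apply/esym/orbit_piP.
have u1 : `|(val g)%:C%C : R[i]| == 1 by rewrite normc_def /= expr0n addr0 sqrtr_sqr unit_scalarP.
exists (exist (fun u : R[i] => `|u| == 1) (val g)%:C%C u1).
apply/rowP => j; rewrite /= /U1_scale /Z2_scale /ceuclid_of_euclid !mxE /=.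
by apply/eqP; rewrite eq_complex /=; apply/andP; split; apply/eqP; ring.
Qed.

Definition z2_to_u1 (q : orbit_space (Z2_action R (n + n))) :
  orbit_space (U1_action R n) := u1_class (repr q).

Lemma z2_to_u1_pi (x : G) : z2_to_u1 (orbit_pi (Z2_action R (n + n)) x) = u1_class x.
Proof.
rewrite /z2_to_u1.
have [g <-] := (@orbit_piP _ _ (Z2_action R (n + n)) _ _).1
  (esym (orbit_piK (orbit_pi (Z2_action R (n + n)) x))).
exact: u1_class_Z2.
Qed.

(** The points g y and y have the same class, so the quotient distance
in C^n / U(1) is at most the distance from x to g y for each sign g. *)
Lemma z2_to_u1_lip p q : mdist (z2_to_u1 p) (z2_to_u1 q) <= mdist p q.
Proof.
apply: orbit_mdist_ge => g.
rewrite /z2_to_u1 -[X in mdist _ X](u1_class_Z2 g).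
exact: u1_class_lip.
Qed.

Lemma lip_le_U1_Z2 : lip_le (mm_quotient (U1_action R n)) (mm_quotient (Z2_action R (n + n))).
Proof.
exists z2_to_u1; split; first exact: z2_to_u1_lip.
move=> A mA; pose gauss := @gauss_tuple R (n + n).
rewrite -[RHS]/(gauss ((fun t => u1_class (euclid_of_tuple t)) @^-1` A)).
rewrite -[LHS]/(gauss ((fun t => z2_to_u1 (orbit_pi (Z2_action R (n + n)) (euclid_of_tuple t))) @^-1` A)).
by congr (gauss _); apply/seteqP; split=> t /=; rewrite z2_to_u1_pi.
Qed.

End cover.
End z2_orbits.

Lemma lip_le_trans {R : realType} (X Y Z : mmSpace R) :
  lip_le X Y -> lip_le Y Z -> lip_le X Z.
Proof.
move=> [f [fl fm]] [g [gl gm]]; exists (f \o g); split=> [x y|A mA].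
  exact: le_trans (fl _ _) (gl _ _).
have mf : measurable_fun [set: borel Y] (f : borel Y -> borel X).
  by apply: continuous_borel; exact: lip_continuous.
have mA' : measurable ((f : borel Y -> borel X) @^-1` A).
  by rewrite -[X in measurable X]setTI; exact: mf.
by rewrite -(fm _ mA) /pushforward -(gm _ mA').
Qed.

Lemma GammaInfU1_Z2 {R : realType} (X : mmSpace R) : GammaInfU1 X -> GammaInfZ2 X.
Proof.
move=> HX e e0; have [Y [n n0 YQ] XY] := HX e e0.
exists Y => //; exists (n + n)%N; first by rewrite addn_gt0 n0.
exact: lip_le_trans YQ (lip_le_U1_Z2 n).
Qed.

Section half_line_in_Z2.
Context {R : realType}.
Local Notation TR := (measurableTypeR R).

Lemma box_refl (X : mmSpace R) (phi : R -> X) : parameter phi -> box X X = 0%E.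
Proof.
move=> pphi; apply/eqP; rewrite eq_le; apply/andP; split; last first.
  by apply: le_ereal_inf_tmp => _ [e [e0 _] <-]; rewrite lee_fin.
apply: ereal_inf_lbound; exists 0 => //; split=> //.
exists phi, phi, (@unitI R); split=> //.
- by split=> //; exact: measurable_itv.
- by rewrite subr0 lebesgue_measure_itv/= lte_fin ltr01 sube0.
- by move=> s t _ _; rewrite subrr normr0.
Qed.

Lemma half_line_parameter : exists phi : R -> H1 R, parameter phi.
Proof.
pose P := @normal_prob R 0 1.
exists (fun s => half_line_abs (quantile_ext P s)).
have mh := measurableT_comp (@measurable_half_line_abs R) (measurable_quantile_ext P).
split; first exact: measurable_funTS mh.
move=> A mA; have mB : measurable (@half_line_abs R @^-1` A : set TR).
  by rewrite -[X in measurable X]setTI; exact: measurable_half_line_abs.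
by rewrite setIC; exact: esym (quantile_law P mB).
Qed.

Definition z2_abs (q : orbit_space (Z2_action R 1)) : H1 R :=
  half_line_abs ((repr q : 'rV[R]_1) ord0 ord0).

Lemma z2_abs_pi (x : Gamma R 1) :
  z2_abs (orbit_pi (Z2_action R 1) x) = half_line_abs ((x : 'rV[R]_1) ord0 ord0).
Proof.
rewrite /z2_abs.
have [g <-] := (@orbit_piP _ _ (Z2_action R 1) _ _).1
  (esym (orbit_piK (orbit_pi (Z2_action R 1) x))).
by apply/val_inj; rewrite /= /Z2_scale mxE normrM unit_scalarP mul1r.
Qed.

Lemma lip_le_half_line_Z2 : lip_le (H1 R) (mm_quotient (Z2_action R 1)).
Proof.
exists z2_abs; split=> [p q|A mA].
  apply: orbit_mdist_ge => g; rewrite half_line_mdistE /=.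
  set x := (repr p : 'rV[R]_1) ord0 ord0; set y := (repr q : 'rV[R]_1) ord0 ord0.
  have -> : `|y| = `|val g * y| by rewrite normrM unit_scalarP mul1r.
  apply: le_trans (ler_dist_dist _ _) _.
  have := coord_le_norm2 ((repr p : 'rV[R]_1) - Z2_scale g (repr q : 'rV[R]_1)) ord0.
  by rewrite !mxE.
pose gauss := @gauss_tuple R 1; pose B : set TR := @half_line_abs R @^-1` A.
have mB : measurable B.
  by rewrite -[X in measurable X]setTI; exact: measurable_half_line_abs.
rewrite -[RHS]/(normal_prob 0 1 B).
rewrite -[LHS]/(gauss ((fun t => z2_abs (orbit_pi (Z2_action R 1) (euclid_of_tuple t))) @^-1` A)).
rewrite (same_law (P1 := gauss) (h := fun t => tnth t ord0) _ _ mB); last 2 first.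
- exact: measurable_tnth.
- exact: Ex_marginal.
by congr (gauss _); apply/seteqP; split=> t /=; rewrite z2_abs_pi mxE.
Qed.

Lemma half_line_in_GammaInfZ2 : GammaInfZ2 (H1 R).
Proof.
move=> e e0; exists (H1 R).
  by exists 1%N => //; exact: lip_le_half_line_Z2.
by have [phi /box_refl->] := half_line_parameter; rewrite lte_fin.
Qed.

End half_line_in_Z2.

Theorem theorem5p5 (R : realType) :
  ~ GammaInfU1 (H1 R) /\
  ((forall X : mmSpace R, GammaInfU1 X -> GammaInfZ2 X) /\
   ~ (forall X : mmSpace R, GammaInfZ2 X -> GammaInfU1 X)).
Proof.
have notU1 := @half_line_notin_GammaInfU1 R.
split=> //; split; first exact: GammaInfU1_Z2.
by move=> h; apply: notU1; apply: h; exact: half_line_in_GammaInfZ2.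
Qed.
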